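(* Let $0<\alpha<1$, $T>0$, let $\Omega\subseteq\mathbb{R}^d$ ($d\ge1$) be a bounded Lipschitz domain, and let $\kappa=\kappa(x)$ be a real symmetric positive-definite $d\times d$ matrix-valued function on $\Omega$ whose minimal eigenvalue is bounded away from zero uniformly for $x\in\Omega$. Assume that \[ \kappa\in L_\infty(\Omega)^{d\times d},\qquad \vec F,\vec G\in C^2\bigl([0,T];W^1_\infty(\Omega)^d\bigr),\qquad a,b\in C^1\bigl([0,T];L_\infty(\Omega)\bigr), \] that $g:(0,T]\to L_2(\Omega)$ is a measurable function satisfying $\|g(t)\|\le Mt^{\eta-1}$ for $0<t\le T$, where $M$ and $\eta$ are positive constants, and that $u_0\in L_2(\Omega)$. Put $f(t)=u_0+\int_0^tg(s)\,ds$. Then there is at most one function $u$ (up to equality for almost every $t\in(0,T)$) such that $u$ and $\mathcal{I}^\alpha u$ belong to $L_2\bigl((0,T);L_2(\Omega)\bigr)$, $(\mathcal{I}^\alpha u)(t)\in H^1_0(\Omega)$ for almost every $t\in(0,T)$, $\mathcal{I}^\alpha\nabla u$ belongs to $L_2\bigl((0,T);L_2(\Omega)^d\bigr)$, and, for almost every $t\in(0,T)$ and all $v\in H^1_0(\Omega)$, \[ \langle u(t),v\rangle+\bigl\langle\kappa(\mathcal{I}^\alpha\nabla u)(t),\nabla v\bigr\rangle-\bigl\langle(\vec B_1u)(t),\nabla v\bigr\rangle+\langle(B_2u)(t),v\rangle=\langle f(t),v\rangle. \] That is, the weak solution of the initial-boundary value problem \[ \partial_tu-\nabla\cdot\bigl(\kappa\nabla\partial_t^{1-\alpha}u-\vec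 F\partial_t^{1-\alpha}u-\vec Gu\bigr)+a\,\partial_t^{1-\alpha}u+bu=g\quad\text{for }x\in\Omega,\ 0<t\le T, \] with $u=0$ on $\partial\Omega$ and $u(\cdot,0)=u_0$, is unique.
   Context: All functions are real-valued. $\langle\cdot,\cdot\rangle$ and $\|\cdot\|$ denote the inner product and norm in $L_2(\Omega)$ or $L_2(\Omega)^d$. $W^1_\infty(\Omega)$ is the Sobolev space of functions whose partial derivatives of order at most one belong to $L_\infty(\Omega)$. Dependence on $x$ is suppressed. For $\mu>0$ put $\omega_\mu(t)=t^{\mu-1}/\Gamma(\mu)$ and define the fractional integral $\mathcal{I}^\mu v(t)=\int_0^t\omega_\mu(t-s)v(s)\,ds$. The Riemann--Liouville fractional derivative is $\partial_t^{1-\alpha}v=\partial_t\mathcal{I}^\alpha v$. Here $\mathcal{I}^\alpha\nabla u$ means the spatial gradient $\nabla(\mathcal{I}^\alpha u)$. The operators $\vec B_1$ and $B_2$ are \[ \vec B_1\phi(t)=\int_0^t\bigl(\vec F(s)\partial_s^{1-\alpha}\phi(s)+\vec G(s)\phi(s)\bigr)\,ds,\qquad B_2\phi(t)=\int_0^t\bigl(a(s)\partial_s^{1-\alpha}\phi(s)+b(s)\phi(s)\bigr)\,ds, \] understood in their integrated-by-parts form $\vec B_1=B^\alpha_{\vec F}+B^1_{\vec G}$ and $B_2=B^\alpha_a+B^1_b$, where, for a time-dependent coefficient $\psi$ with time derivative $\psi'$, \[ (B^\mu_\psi\phi)(t)=\psi(t)\,\mathcal{I}^\mu\phi(t)-\int_0^t\psi'(s)\,\mathcal{I}^\mu\phi(s)\,ds.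 \] *)

(* Defs.v *)
From HB Require Import structures.
From mathcomp Require Import all_boot all_order all_algebra.
From mathcomp Require Import all_classical all_reals all_analysis.

Set Implicit Arguments.
Unset Strict Implicit.
Unset Printing Implicit Defensive.

Import Order.TTheory GRing.Theory Num.Theory.
Import numFieldNormedType.Exports.

Local Open Scope classical_set_scope.
Local Open Scope ring_scope.

(** The sigma-algebra generated by the coordinates, that is, the Borel sets. *)
Section borel_rV.
Context {R : realType} (n : nat).

Let coor (i : 'I_n) (x : 'rV[R]_n) : R := x ord0 i.

Let rV_set0 : g_sigma_preimage coor set0.
Proof. exact: sigma_algebra0. Qed.

Let rV_setC A : g_sigma_preimage coor A -> g_sigma_preimage coor (~` A).
Proof. exact: sigma_algebraC. Qed.

Let rV_bigcup (F : _^nat) : (forall i, g_sigma_preimage coor (F i)) ->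
  g_sigma_preimage coor (\bigcup_i (F i)).
Proof. exact: sigma_algebra_bigcup. Qed.

HB.instance Definition _ :=
  @isMeasurable.Build (measure_tuple_display default_measure_display)
    'rV[R]_n (g_sigma_preimage coor) rV_set0 rV_setC rV_bigcup.

Lemma measurable_coor (i : 'I_n) :
  measurable_fun [set: 'rV[R]_n] (fun x : 'rV[R]_n => x ord0 i : R).
Proof.
move=> _ Y mY; rewrite setTI; apply: sub_sigma_algebra => /=.
rewrite -bigcup_seq/=; exists i => /=; first by rewrite mem_index_enum.
by exists Y => //; rewrite setTI.
Qed.

Lemma measurable_fun_rV d (T : measurableType d) (f : T -> 'rV[R]_n) :
  (forall i, measurable_fun [set: T] (fun t => f t ord0 i : R)) ->
  measurable_fun [set: T] f.
Proof.
move=> mf _ A mA; rewrite setTI.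
suff : [set A : set 'rV[R]_n | measurable (f @^-1` A)] A by [].
apply: (smallest_sub _ _ mA); first split => /=.
- by rewrite preimage_set0.
- by move=> B mB; rewrite setTD preimage_setC; exact: measurableC.
- by move=> F mF; rewrite preimage_bigcup; exact: bigcupT_measurable.
move=> B; rewrite -bigcup_seq/= => -[i _ [Y mY <-]].
by have := mf i measurableT _ mY; rewrite !setTI.
Qed.

End borel_rV.

Section lebesgue_rV.
Context {R : realType}.

Definition cons_rV n (p : R * 'rV[R]_n) : 'rV[R]_n.+1 :=
  \row_i oapp (fun j => p.2 ord0 j) p.1 (unlift ord0 i).

Definition uncons_rV n (x : 'rV[R]_n.+1) : R * 'rV[R]_n :=
  (x ord0 ord0, \row_j x ord0 (lift ord0 j)).

Lemma cons_rVE0 n (p : R * 'rV[R]_n) : cons_rV p ord0 ord0 = p.1.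
Proof. by rewrite mxE unlift_none. Qed.

Lemma cons_rVES n (p : R * 'rV[R]_n) j :
  cons_rV p ord0 (lift ord0 j) = p.2 ord0 j.
Proof. by rewrite mxE liftK. Qed.

Lemma cons_rVK n : cancel (@cons_rV n) (@uncons_rV n).
Proof.
case=> a x; congr pair; first by rewrite cons_rVE0.
by apply/rowP => j; rewrite mxE cons_rVES.
Qed.

Lemma measurable_cons_rV n : measurable_fun setT (@cons_rV n).
Proof.
apply: measurable_fun_rV => i; case: (unliftP ord0 i) => [j|] ->.
  apply: (eq_measurable_fun ((fun x : 'rV[R]_n => x ord0 j) \o snd)).
    by move=> p _; rewrite cons_rVES.
  exact: (measurableT_comp (measurable_coor j) measurable_snd).
apply: (eq_measurable_fun fst) => [p _|]; first by rewrite cons_rVE0.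
exact: measurable_fst.
Qed.

Lemma measurable_uncons_rV n : measurable_fun setT (@uncons_rV n).
Proof.
apply/measurable_fun_pairP; split; first exact: measurable_coor.
apply: measurable_fun_rV => i.
apply: (eq_measurable_fun (fun x : 'rV[R]_n.+1 => x ord0 (lift ord0 i))).
  by move=> x _; rewrite mxE.
exact: measurable_coor.
Qed.

Section step.
Variables (n : nat) (m : {sigma_finite_measure set 'rV[R]_n -> \bar R}).

Definition lebesgue_step : set 'rV[R]_n.+1 -> \bar R :=
  pushforward (lebesgue_measure \x m)%E (@cons_rV n).

Let lebesgue_step0 : lebesgue_step set0 = 0%E.
Proof. by rewrite /lebesgue_step /pushforward preimage_set0 measure0. Qed.

Let lebesgue_step_ge0 A : (0 <= lebesgue_step A)%E.
Proof. by rewrite /lebesgue_step /pushforward; exact: measure_ge0. Qed.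

Let lebesgue_step_sigma_additive : semi_sigma_additive lebesgue_step.
Proof.
move=> F mF tF mUF; rewrite /lebesgue_step /pushforward preimage_bigcup.
have mf A : measurable A -> measurable (@cons_rV n @^-1` A).
  by move=> mA; rewrite -[X in measurable X]setTI; exact: measurable_cons_rV.
apply: measure_semi_sigma_additive.
- by move=> k; exact: mf.
- apply/trivIsetP => /= i j _ _ ij; rewrite -preimage_setI.
  by move/trivIsetP : tF => /(_ _ _ _ _ ij) ->//; rewrite preimage_set0.
- by rewrite -preimage_bigcup; exact: mf.
Qed.

HB.instance Definition _ := isMeasure.Build _ _ _ lebesgue_step
  lebesgue_step0 lebesgue_step_ge0 lebesgue_step_sigma_additive.

Let lebesgue_step_sigma_finite : sigma_finite setT lebesgue_step.
Proof.
have /sigma_finiteP[F [TF ndF Foo]] := sigma_finiteT (@lebesgue_measure R).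
have /sigma_finiteP[G [TG ndG Goo]] := sigma_finiteT m.
exists (fun k => @uncons_rV n @^-1` (F k `*` G k)).
  rewrite -preimage_bigcup -[LHS](preimage_setT (@uncons_rV n)); congr preimage.
  rewrite -setXTT TF TG predeqE => -[x y]; split.
    move=> [/= [i _ Fx] [j _ Gy]]; exists (maxn i j) => //; split.
    - by move: x Fx; exact/subsetPset/ndF/leq_maxl.
    - by move: y Gy; exact/subsetPset/ndG/leq_maxr.
  by move=> [k _ []/= ? ?]; split; exists k.
move=> k; have [mFk Fk] := Foo k; have [mGk Gk] := Goo k; split.
  rewrite -[X in measurable X]setTI; apply: measurable_uncons_rV => //.
  exact: measurableX.
rewrite /lebesgue_step /pushforward -comp_preimage.
rewrite (_ : _ \o _ = id) ?preimage_id; last exact/funext/cons_rVK.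
by rewrite product_measure1E// lte_mul_pinfty// ge0_fin_numE.
Qed.

HB.instance Definition _ := Measure_isSigmaFinite.Build _ _ _ lebesgue_step
  lebesgue_step_sigma_finite.

End step.

(** Lebesgue measure on R^n, as the n-fold product of [lebesgue_measure]. *)
Fixpoint lebesgue_rV n : {sigma_finite_measure set 'rV[R]_n -> \bar R} :=
  match n with
  | 0 => \d_(0 : 'rV[R]_0)
  | m.+1 => lebesgue_step (lebesgue_rV m)
  end.

End lebesgue_rV.

Lemma lebesgue_rV_box {R : realType} n (A : 'I_n -> set R) :
  (forall i, measurable (A i)) ->
  lebesgue_rV n [set x : 'rV[R]_n | forall i, A i (x ord0 i)] =
  (\prod_(i < n) lebesgue_measure (A i))%E.
Proof.
elim: n A => [|n IH] A mA.
  by rewrite big_ord0 /= diracE mem_set// => -[].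
have mB : measurable
    [set x : 'rV[R]_n | forall i, A (lift ord0 i) (x ord0 i)].
  rewrite (_ : mkset _ = \bigcap_(i in setT)
      ((fun x : 'rV[R]_n => x ord0 i) @^-1` A (lift ord0 i))); last first.
    by apply/seteqP; split => [x Ax i _|x Ax i] /=; [exact: Ax|exact: (Ax i)].
  apply: fin_bigcap_measurable => [|i _]; first exact: finite_finset.
  by rewrite -[X in measurable X]setTI; exact: measurable_coor.
rewrite big_ord_recl -IH// -product_measure1E//; last exact: (mA ord0).
rewrite /lebesgue_step /pushforward; congr (product_measure1 _ _ _).
apply/seteqP; split => -[a x] /=.
  move=> Ax; split; first by have := Ax ord0; rewrite cons_rVE0.
  by move=> i; have := Ax (lift ord0 i); rewrite cons_rVES.
move=> [Aa Ax] i; case: (unliftP ord0 i) => [j|] ->.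
  by rewrite cons_rVES.
by rewrite cons_rVE0.
Qed.

Section function_spaces.
Context {R : realType} {n : nat}.
Implicit Types (Omega : set 'rV[R]_n) (v w phi : 'rV[R]_n -> R)
  (dv : 'rV[R]_n -> 'rV[R]_n).

Definition vdot (x y : 'rV[R]_n) : R := \sum_(i < n) x ord0 i * y ord0 i.

Definition inner Omega v w : R :=
  \int[lebesgue_rV n]_(x in Omega) (v x * w x).

Definition vinner Omega (p q : 'rV[R]_n -> 'rV[R]_n) : R :=
  \int[lebesgue_rV n]_(x in Omega) vdot (p x) (q x).

Definition LpN (p : \bar R) Omega v : \bar R :=
  Lnorm (lebesgue_rV n) p (EFin \o (v \_ Omega)).

Definition inLp (p : \bar R) Omega v : Prop :=
  measurable_fun Omega v /\ (LpN p Omega v < +oo)%E.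

Definition partial (i : 'I_n) phi : 'rV[R]_n -> R :=
  'D_(delta_mx ord0 i) phi.

Definition smooth phi : Prop :=
  forall s : seq 'I_n, let psi := foldr partial phi s in
  continuous psi /\ forall i x, derivable psi x (delta_mx ord0 i).

Definition test_function Omega phi : Prop :=
  let supp := closure [set x | phi x != 0] in
  [/\ smooth phi, compact supp & supp `<=` Omega].

Definition locally_L1 Omega v : Prop :=
  forall K, compact K -> K `<=` Omega ->
    (lebesgue_rV n).-integrable K (EFin \o v).

Definition weak_partial Omega (i : 'I_n) v w : Prop :=
  [/\ locally_L1 Omega v, locally_L1 Omega w &
      forall phi, test_function Omega phi ->
        inner Omega v (partial i phi) = - inner Omega w phi].

Definition weak_gradient Omega v dv : Prop :=
  forall i, weak_partial Omega i v (fun x => dv x ord0 i).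

(** Membership of [v] in H^1(Omega) or H^1_0(Omega) is stated together with the
    weak gradient [dv] of [v], which is determined up to null sets; H^1_0(Omega)
    is the closure of the test functions in H^1(Omega). *)
Definition in_H1 Omega v dv : Prop :=
  [/\ inLp 2%:E Omega v,
      forall i, inLp 2%:E Omega (fun x => dv x ord0 i) &
      weak_gradient Omega v dv].

Definition in_H10 Omega v dv : Prop :=
  in_H1 Omega v dv /\
  exists phi : nat -> 'rV[R]_n -> R,
    [/\ forall k, test_function Omega (phi k),
        LpN 2%:E Omega (fun x => phi k x - v x) @[k --> \oo] --> 0%E &
        forall i, LpN 2%:E Omega
          (fun x => partial i (phi k) x - dv x ord0 i) @[k --> \oo] --> 0%E].

Definition LooN Omega v : \bar R := LpN +oo%E Omega v.

(** The weak gradient is unique up to null sets, so that the infimum is over at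
    most one value; it is [+oo] if [v] has no weak gradient. *)
Definition W1ooN Omega v : \bar R :=
  ereal_inf [set \big[maxe/LooN Omega v]_(i < n)
                   LooN Omega (fun x => dv x ord0 i)
            | dv in weak_gradient Omega v].

End function_spaces.

Section lipschitz_domain.
Context {R : realType} {d : nat}.

(** Bounded domain that, near each boundary point and in suitable orthonormal
    coordinates, is the region above the graph of a Lipschitz function. *)
Definition bounded_lipschitz_domain (Omega : set 'rV[R]_d.+1) : Prop :=
  [/\ open Omega, connected Omega, Omega !=set0, bounded_set Omega &
    forall p, (closure Omega `\` Omega) p ->
      exists (Q : 'M[R]_d.+1) (gamma : 'rV[R]_d -> R) (L : R),
        [/\ Q *m Q^T = 1%:M, L.-lipschitz gamma &
          \forall x \near p, Omega x <->
            gamma (col' ord0 (x *m Q)) < (x *m Q) ord0 ord0]].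

End lipschitz_domain.

(** A function from a time interval into a space of (classes of) functions on
   Omega is represented by a jointly measurable function of [t] and [x]; every
   strongly measurable L_2(Omega)-valued function and every continuous
   L_oo(Omega)-valued function on [0, T] has such a representative, and its
   Bochner integral over time is then computed pointwise in [x]. *)

Section time_dependent.
Context {R : realType} {n : nat}.
Implicit Types (Omega : set 'rV[R]_n) (u psi dpsi phi : R -> 'rV[R]_n -> R).

Definition jointly_measurable (I : set R) Omega psi : Prop :=
  measurable_fun (I `*` Omega) (fun p : R * 'rV[R]_n => psi p.1 p.2).

Definition L2L2 (T : R) Omega u : Prop :=
  jointly_measurable `]0, T[ Omega u /\
  (\int[lebesgue_measure]_(t in `]0%R, T[) (LpN 2%:E Omega (u t) ^+ 2)
    < +oo)%E.

(** Curves in the Banach space of the functions on Omega with finite norm [N],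
    to be instantiated with [LooN Omega] or [W1ooN Omega]; [t^'] below is the
    filter of punctured neighbourhoods of [t]. *)
Section curves.
Variables (N : ('rV[R]_n -> R) -> \bar R) (T : R) (Omega : set 'rV[R]_n).

Definition curve psi : Prop :=
  jointly_measurable `[0, T] Omega psi /\
  forall t, t \in `[0, T] -> (N (psi t) < +oo)%E.

Definition time_continuous psi : Prop :=
  forall t, t \in `[0, T] ->
    N (fun x => psi s x - psi t x) @[s --> within `[0, T] (nbhs t)] --> 0%E.

Definition time_derivative psi dpsi : Prop :=
  forall t, t \in `[0, T] ->
    N (fun x => (psi s x - psi t x) / (s - t) - dpsi t x)
      @[s --> within `[0, T] t^'] --> 0%E.

Fixpoint Ck (k : nat) psi : Prop :=
  curve psi /\
  match k with
  | 0 => time_continuous psi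
  | k'.+1 => exists dpsi, time_derivative psi dpsi /\ Ck k' dpsi
  end.

(** [psi] is of class C^(k+1), with time derivative [dpsi]. *)
Definition CkS_with_derivative (k : nat) psi dpsi : Prop :=
  [/\ curve psi, time_derivative psi dpsi & Ck k dpsi].

End curves.

Definition Gamma (mu : R) : R :=
  \int[lebesgue_measure]_(t in `]0, +oo[) (t `^ (mu - 1) * expR (- t)).

Definition omega (mu t : R) : R := t `^ (mu - 1) / Gamma mu.

Definition fint (mu : R) phi : R -> 'rV[R]_n -> R := fun t x =>
  \int[lebesgue_measure]_(s in `]0, t[) (omega mu (t - s) * phi s x).

Definition Bop (mu : R) psi dpsi phi : R -> 'rV[R]_n -> R := fun t x =>
  psi t x * fint mu phi t x
  - \int[lebesgue_measure]_(s in `]0, t[) (dpsi s x * fint mu phi s x).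

Definition vBop (mu : R) (F dF : R -> 'rV[R]_n -> 'rV[R]_n) phi :
    R -> 'rV[R]_n -> 'rV[R]_n := fun t x =>
  \row_j Bop mu (fun s y => F s y ord0 j) (fun s y => dF s y ord0 j) phi t x.

Definition B1 (alpha : R) (F dF G dG : R -> 'rV[R]_n -> 'rV[R]_n) phi :
    R -> 'rV[R]_n -> 'rV[R]_n := fun t x =>
  vBop alpha F dF phi t x + vBop 1 G dG phi t x.

Definition B2 (alpha : R) (a da b db : R -> 'rV[R]_n -> R) phi :
    R -> 'rV[R]_n -> R := fun t x =>
  Bop alpha a da phi t x + Bop 1 b db phi t x.

Definition weak_solution (T alpha : R) Omega
    (kappa : 'rV[R]_n -> 'M[R]_n) (F dF G dG : R -> 'rV[R]_n -> 'rV[R]_n)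
    (a da b db f : R -> 'rV[R]_n -> R) u : Prop :=
  [/\ L2L2 T Omega u,
      L2L2 T Omega (fint alpha u) &
      exists W : R -> 'rV[R]_n -> 'rV[R]_n,
      [/\ forall j, L2L2 T Omega (fun t x => W t x ord0 j),
          \forall t \ae lebesgue_measure, t \in `]0, T[ ->
            in_H10 Omega (fint alpha u t) (W t) &
          \forall t \ae lebesgue_measure, t \in `]0, T[ ->
            forall v dv, in_H10 Omega v dv ->
              inner Omega (u t) v
              + vinner Omega (fun x => W t x *m (kappa x)^T) dv
              - vinner Omega (B1 alpha F dF G dG u t) dv
              + inner Omega (B2 alpha a da b db u t) v
              = inner Omega (f t) v]].

End time_dependent.

(* Main.v *)
(** Let [u] be the difference of two solutions, [w] its fractional integral of
    order [alpha], [v0] its primitive and [W] the gradient of [w].  Testing each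
    equation with the fractional integral of each solution, which is admissible
    at almost every time, shows that the integral over [Omega] of
    [P = u w + kappa W . W - B1 u . W + (B2 u) w] vanishes at almost every time.
    Young's inequality absorbs [W] into the elliptic term and leaves, pointwise
    in space, [P >= u w - C Z], where [Z] is the sum of [w^2], [v0^2] and their
    time integrals.
    The kernel [t^(alpha-1)] is a superposition of the exponentials [e^(-rt)]
    with density [r^(-alpha)], up to a constant factor.  For an exponential
    kernel, with [wr] the convolution of [e^(-rt)] and [u], the energy is exact:
    [int e^(-2 lambda t) u wr = (lambda + r) int e^(-2 lambda t) wr^2].
    Superposing, the weighted integral of [u w] dominates that of [w^2] with a
    factor [lambda^alpha] and that of [v0^2] with a factor [lambda].  For large
    [lambda], uniform in [x], the weighted time integral of [P] is thus bounded
    below by a multiple of that of [v0^2].  As its integral over [Omega]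
    vanishes, [v0 = 0] almost everywhere, hence [u = 0]. *)

Require Import Defs.
From HB Require Import structures.
From mathcomp Require Import all_boot all_order all_algebra.
From mathcomp Require Import all_classical all_reals all_analysis.
From mathcomp Require Import measurable_realfun ess_sup_inf.
From mathcomp Require Import ring lra.

Set Implicit Arguments.
Unset Strict Implicit.
Unset Printing Implicit Defensive.

Import Order.TTheory GRing.Theory Num.Theory.
Import numFieldNormedType.Exports.

Local Open Scope classical_set_scope.
Local Open Scope ring_scope.

(** * Real-valued integrals and Fubini's theorem *)

(** The equation holds at almost every time after integration over [Omega], whereas the coercivity
    holds at almost every point of space after integration over time. The estimates are therefore
    made for scalar functions of time at a fixed point, and Fubini's theorem joins the two. This
    forces [lambda] to be chosen from the coefficient bounds alone, before the point of space. After
    extension by zero to the whole line the exponential weight leaves no boundary term. It also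
    replaces Gronwall's inequality: the lower-order terms are absorbed because their bounds in terms
    of the weighted integral of [u w] shrink as [lambda] grows. The primitive [v0] enters because
    the order-one parts of [B1] and [B2] act on it. Testing the equations crosswise, in four pairs,
    spares a proof that [in_H10] is stable under differences. *)

Section L1_tools.
Context d (T : measurableType d) (R : realType).
Variable mu : {measure set T -> \bar R}.
Implicit Types f g : T -> R.

Notation L1 f := (mu.-integrable [set: T] (EFin \o f)).

Lemma L1_measurable f : L1 f -> measurable_fun setT f.
Proof. by move=> /measurable_int /measurable_EFinP. Qed.

Lemma L1_le f g : measurable_fun setT f -> L1 g ->
  (forall x, `|f x| <= g x) -> L1 f.
Proof.
move=> mf ig fg; apply: le_integrable ig => //; first exact/measurable_EFinP.
by move=> x _ /=; rewrite lee_fin (le_trans (fg x)) ?ler_norm.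
Qed.

Lemma eq_L1 f g : (forall x, f x = g x) -> L1 f -> L1 g.
Proof. by move=> /funext ->. Qed.

Lemma eq_Rint f g : (forall x, f x = g x) ->
  \int[mu]_x f x = \int[mu]_x g x.
Proof. by move=> /funext ->. Qed.

Lemma L1D f g : L1 f -> L1 g -> L1 (fun x => f x + g x).
Proof. by move=> fi gi; have := integrableD measurableT fi gi. Qed.

Lemma L1B f g : L1 f -> L1 g -> L1 (fun x => f x - g x).
Proof. by move=> fi gi; have := integrableB measurableT fi gi. Qed.

Lemma L1Z k f : L1 f -> L1 (fun x => k * f x).
Proof. by move=> fi; have := integrableZl measurableT k fi. Qed.

Lemma L1_sum (I : finType) (h : I -> T -> R) :
  (forall i, L1 (h i)) -> L1 (fun x => \sum_i h i x).
Proof.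
move=> hi; have := @integrable_sum _ _ _ mu _ measurableT I (index_enum I)
  xpredT (fun i x => (h i x)%:E) (fun i _ => hi i).
by apply: eq_integrable => // x _ /=; rewrite sumEFin.
Qed.

Lemma L1_norm f : L1 f -> L1 (fun x => `|f x|).
Proof. by move=> /integrable_norm. Qed.

Lemma Rint_ge0 f : (forall x, 0 <= f x) -> 0 <= \int[mu]_x f x.
Proof. by move=> f0; apply: Rintegral_ge0. Qed.

Lemma Rint_le f g : L1 f -> L1 g -> (forall x, f x <= g x) ->
  \int[mu]_x f x <= \int[mu]_x g x.
Proof. by move=> fi gi fg; apply: le_Rintegral. Qed.

Lemma Rint_norm f : L1 f -> `|\int[mu]_x f x| <= \int[mu]_x `|f x|.
Proof. by move=> fi; apply: le_normr_Rintegral. Qed.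

Lemma EFin_Rint f : L1 f -> (\int[mu]_x f x)%:E = (\int[mu]_x (f x)%:E)%E.
Proof. by move=> fi; rewrite /Rintegral fineK//; exact: integrable_fin_num. Qed.

Lemma ae_Rint f g : L1 f -> measurable_fun setT g ->
  {ae mu, forall x, f x = g x} -> \int[mu]_x f x = \int[mu]_x g x.
Proof.
move=> /L1_measurable mf mg fg; congr fine; apply: ae_eq_integral => //.
- exact/measurable_EFinP.
- exact/measurable_EFinP.
- by apply: filterS fg => x -> _.
Qed.

Lemma ae_L1 f g : measurable_fun setT g ->
  {ae mu, forall x, f x = g x} -> L1 f -> L1 g.
Proof.
move=> mg fg fi; apply/integrableP; split; first exact/measurable_EFinP.
rewrite (@ae_eq_integral _ _ _ mu setT (fun x => `|(f x)%:E|%E)) //.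
- by case/integrableP: fi.
- by apply: measurableT_comp => //; exact/measurable_EFinP.
- by apply: measurableT_comp => //; case/integrableP: fi.
- by apply: filterS fg => x /= -> _.
Qed.

(** The truncation of [f] to values between [- |g|] and [|g|] is dominated everywhere and agrees
    with [f] almost everywhere, so the pointwise [L1_le] applies to it. *)
Lemma ae_L1_le f g : measurable_fun setT f -> L1 g ->
  {ae mu, forall x, `|f x| <= g x} -> L1 f.
Proof.
move=> mf gi fg; have mg := L1_measurable gi.
apply: (@ae_L1 (fun x => Num.max (- `|g x|) (Num.min `|g x| (f x)))) => //.
  apply: filterS fg => x fgx.
  have := ler_norm (g x); move: fgx; rewrite ler_norml => /andP[h1 h2] h3.
  by rewrite min_r ?max_r//; lra.
apply: (@L1_le _ (fun x => `|g x|)); last 2 first.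
- exact: L1_norm.
- move=> x; rewrite ler_norml le_max lexx/= ge_max ge_min lexx/=.
  by rewrite andbT; have := normr_ge0 (g x); lra.
apply: measurable_maxr.
- by apply: measurableT_comp => //; apply: measurableT_comp.
- by apply: measurable_minr => //; apply: measurableT_comp.
Qed.

Lemma ae_Rint_le f g : L1 f -> L1 g -> {ae mu, forall x, f x <= g x} ->
  \int[mu]_x f x <= \int[mu]_x g x.
Proof.
move=> fi gi fg; have [mf mg] := (L1_measurable fi, L1_measurable gi).
have mm : measurable_fun setT (fun x => Num.min (f x) (g x)).
  exact: measurable_minr.
have fm : {ae mu, forall x, f x = Num.min (f x) (g x)}.
  by apply: filterS fg => x fgx; rewrite min_l.
rewrite (ae_Rint fi mm fm); apply: Rint_le => //.
- exact: ae_L1 mm fm fi.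
- by move=> x; rewrite ge_min lexx orbT.
Qed.

Lemma Rint0_ae0 f : L1 f -> (forall x, 0 <= f x) -> \int[mu]_x f x <= 0 ->
  {ae mu, forall x, f x = 0}.
Proof.
move=> fi f0 If.
have {}If : (\int[mu]_x `|(f x)%:E| = 0)%E.
  under eq_integral do rewrite gee0_abs ?lee_fin//.
  rewrite -EFin_Rint//; congr EFin; apply/eqP; rewrite eq_le If/=.
  exact: Rint_ge0.
have mf := L1_measurable fi; have mEf : measurable_fun setT (EFin \o f).
  exact/measurable_EFinP.
have := (ae_eq_integral_abs mu measurableT mEf).1 If.
by apply: filterS => x /= /(_ I) [].
Qed.

Lemma L1_sqrM f g : measurable_fun setT f -> measurable_fun setT g ->
  L1 (fun x => f x ^+ 2) -> L1 (fun x => g x ^+ 2) ->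
  L1 (fun x => f x * g x).
Proof.
move=> mf mg fi gi.
apply: (@L1_le _ (fun x => f x ^+ 2 + g x ^+ 2)).
- exact: measurable_funM.
- exact: L1D.
- move=> x; rewrite normrM -(real_normK (num_real (f x))).
  rewrite -(real_normK (num_real (g x))).
  by have := sqr_ge0 (`|f x| - `|g x|); have := normr_ge0 (f x);
     have := normr_ge0 (g x); nra.
Qed.

End L1_tools.

Notation L1 mu f := (mu.-integrable [set: _] (EFin \o f)).

Section fubini_tools.
Context d1 d2 (T1 : measurableType d1) (T2 : measurableType d2) (R : realType).
Variable m1 : {sigma_finite_measure set T1 -> \bar R}.
Variable m2 : {sigma_finite_measure set T2 -> \bar R}.
Implicit Type k : T1 * T2 -> R.

(** The inner integral is [fine] of a difference of two Tonelli integrals, those of the positive and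
    negative parts. Measurability thus holds without integrability, default values included, as
    needed for convolutions that converge only almost everywhere. *)
Lemma measurable_Rint2 k : measurable_fun setT k ->
  measurable_fun setT (fun x => \int[m2]_y k (x, y)).
Proof.
move=> mk; have mEk : measurable_fun setT (EFin \o k) by exact/measurable_EFinP.
rewrite /Rintegral; apply: measurableT_comp; first exact: fine_measurable.
rewrite (_ : (fun _ => _) = (fun x => \int[m2]_y ((EFin \o k)^\+ (x, y)) -
   \int[m2]_y ((EFin \o k)^\- (x, y)))%E); last first.
  apply/funext => x; rewrite [LHS]integralE.
  rewrite -[X in (\int[m2]_y (X^\+) y)%E]/((EFin \o k) \o pair x).
  rewrite -[X in (_ - \int[m2]_y (X^\-) y)%E]/((EFin \o k) \o pair x).
  by rewrite funepos_comp funeneg_comp.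
apply: emeasurable_funB.
- apply: (measurable_fun_fubini_tonelli_F (EFin \o k)^\+%E) => //.
  exact: measurable_funepos.
- apply: (measurable_fun_fubini_tonelli_F (EFin \o k)^\-%E) => //.
  exact: measurable_funeneg.
Qed.

Lemma measurable_section1 k x : measurable_fun setT k ->
  measurable_fun setT (fun y => k (x, y)).
Proof. by move=> mk; apply: measurableT_comp => //; exact: measurable_pair1. Qed.

Lemma measurable_section2 k y : measurable_fun setT k ->
  measurable_fun setT (fun x => k (x, y)).
Proof. by move=> mk; apply: measurableT_comp => //; exact: measurable_pair2. Qed.

Lemma ae_L1_section k : L1 (m1 \x m2)%E k ->
  {ae m1, forall x, L1 m2 (fun y => k (x, y))}.
Proof. by move=> ik; have := ae_integrable1 ik. Qed.

Lemma ae_L1_section2 k : L1 (m1 \x m2)%E k ->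
  {ae m2, forall y, L1 m1 (fun x => k (x, y))}.
Proof. by move=> ik; have := ae_integrable2 ik. Qed.

Lemma L1_Rint2 k : L1 (m1 \x m2)%E k -> L1 m1 (fun x => \int[m2]_y k (x, y)).
Proof.
move=> ik; have mk := L1_measurable ik; have := integrable_fubini_F ik.
move=> i; apply: (le_integrable measurableT _ _ i).
  by apply/measurable_EFinP; exact: measurable_Rint2.
move=> x _; rewrite /= /fubini_F/= /Rintegral.
(* Where the inner integral is infinite, [fine] returns 0, which only lowers the absolute value. *)
by case: (\int[m2]_y (k (x, y))%:E)%E => [r| |] //=; rewrite normr0 ?leey.
Qed.

Lemma Rint_prod k : L1 (m1 \x m2)%E k ->
  \int[m1]_x \int[m2]_y k (x, y) = \int[(m1 \x m2)%E]_z k z.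
Proof.
move=> ik; rewrite {3}/Rintegral -(integral12_prod_meas1 ik); congr fine.
have mk := L1_measurable ik.
apply: ae_eq_integral => //.
- apply/measurable_EFinP; exact: measurable_Rint2.
- exact: (measurable_fubini_F ik).
- apply: filterS (ae_L1_section ik) => x ikx _ /=.
  by rewrite EFin_Rint.
Qed.

End fubini_tools.

Section fubini_swap.
Context d1 d2 (T1 : measurableType d1) (T2 : measurableType d2) (R : realType).
Variable m1 : {sigma_finite_measure set T1 -> \bar R}.
Variable m2 : {sigma_finite_measure set T2 -> \bar R}.
Implicit Type k : T1 * T2 -> R.

Lemma L1_swap k : L1 (m1 \x m2)%E k -> L1 (m2 \x m1)%E (fun z => k (z.2, z.1)).
Proof.
move=> ik; have mk := L1_measurable ik.
have mk' : measurable_fun setT (fun z : T2 * T1 => k (z.2, z.1)).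
  by apply: measurableT_comp mk _; exact: measurable_swap.
have mEk : measurable_fun setT (EFin \o k) by exact/measurable_EFinP.
by apply/integrable12ltyP; [exact/measurable_EFinP|];
   have := (integrable21ltyP m1 m2 mEk).1 ik.
Qed.

Lemma L1_prod_le k (g : T1 -> R) : measurable_fun setT k -> L1 m1 g ->
  {ae m1, forall x, L1 m2 (fun y => k (x, y)) /\
    \int[m2]_y `|k (x, y)| <= g x} ->
  L1 (m1 \x m2)%E k.
Proof.
move=> mk ig kg; apply/integrable12ltyP; first exact/measurable_EFinP.
case/integrableP : ig => mg; apply: le_lt_trans.
apply: ae_ge0_le_integral => //.
- by move=> x _; apply: integral_ge0.
- apply: (measurable_fun_fubini_tonelli_F (fun z => `|(k z)%:E|%E)) => //.
  by apply: measurableT_comp => //; exact/measurable_EFinP.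
- exact: measurableT_comp.
- apply: filterS kg => x [ik le] _; rewrite /=.
  rewrite -(@EFin_Rint _ _ _ _ (fun y => `|k (x, y)|)) ?lee_fin; last exact: L1_norm.
  exact: le_trans le (ler_norm _).
Qed.

Lemma Rint_swap k : L1 (m1 \x m2)%E k ->
  \int[m1]_x \int[m2]_y k (x, y) = \int[m2]_y \int[m1]_x k (x, y).
Proof.
move=> ik; rewrite Rint_prod// /Rintegral -(integral21_prod_meas1 ik).
congr fine; have mk := L1_measurable ik.
apply: ae_eq_integral => //.
- exact: (measurable_fubini_G ik).
- by apply/measurable_EFinP; exact: (measurable_Rint2 m1 (L1_measurable (L1_swap ik))).
- apply: filterS (ae_L1_section2 ik) => x ikx _.
  exact/esym/(EFin_Rint ikx).
Qed.

Lemma L1_Rint1 k : L1 (m1 \x m2)%E k -> L1 m2 (fun y => \int[m1]_x k (x, y)).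
Proof. by move=> /L1_swap/L1_Rint2. Qed.

End fubini_swap.

(** * Laplace representation of the fractional kernel *)

Section laplace.
Context {R : realType}.
Implicit Types (x y s t theta beta : R).
Notation mu := (@lebesgue_measure R).

Lemma Rint_if d (T : measurableType d) (m : {measure set T -> \bar R})
    (D : set T) (f : T -> R) :
  \int[m]_(z in D) f z = \int[m]_z (if z \in D then f z else 0).
Proof. by rewrite Rintegral_mkcond; apply: eq_Rintegral => z _; rewrite patchE. Qed.

Lemma L1_if d (T : measurableType d) (m : {measure set T -> \bar R})
    (D : set T) (f : T -> R) : measurable D ->
  m.-integrable D (EFin \o f) <-> L1 m (fun z => if z \in D then f z else 0).
Proof.
move=> mD; rewrite (integrable_mkcond _ mD); split.
- by apply: eq_integrable => // z _; rewrite patchE/=; case: ifP.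
- by apply: eq_integrable => // z _; rewrite patchE/=; case: ifP.
Qed.

Lemma exp_tail theta s : 0 < theta ->
  L1 mu (fun y => if s < y then expR (- (theta * y)) else 0) /\
  \int[mu]_y (if s < y then expR (- (theta * y)) else 0) =
    expR (- (theta * s)) / theta.
Proof.
move=> th0; set f := fun y => expR (- (theta * y)).
have cf : continuous f.
  move=> y; apply: continuous_comp; last exact: continuous_expR.
  by apply: (@continuousN _ R^o); apply: continuousM => //; exact: cst_continuous.
have If : (\int[mu]_(y in `]s, +oo[) (f y)%:E = (f s / theta)%:E)%E.
  rewrite integral_itv_obnd_cbnd; last first.
    by apply/measurable_EFinP/measurable_funTS; exact: continuous_measurable_fun.
  rewrite (@ge0_continuous_FTC2y _ f (fun y => - (theta^-1 * f y)) s 0) //.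
  - by rewrite sub0e -EFinN opprK mulrC.
  - by move=> x _; exact: expR_ge0.
  - by apply: continuous_subspaceT.
  - rewrite -oppr0; apply: cvgN; rewrite -(mulr0 theta^-1); apply: cvgMr.
    apply: (@cvg_comp _ _ _ (fun x => theta * x) (fun z => expR (- z)) _
      (pinfty_nbhs R)); last exact: cvgr_expR.
    by apply: gt0_cvgMry.
  - apply: cvgN; apply: cvgMr; apply: cvg_at_right_filter; exact: cf.
  - move=> x _; rewrite derive1E.
    have d1 : is_derive x 1 (fun y : R => - (theta * y)) (- theta).
      by apply: is_derive_eq; rewrite scaler1.
    have d2 : is_derive x 1 f (- theta * f x).
      by apply: is_derive_eq; rewrite mulrC.
    have d3 : is_derive x 1 (fun y => - (theta^-1 * f y)) (f x).
      by apply: is_derive_eq; rewrite scalerA mulrN mulVf ?gt_eqF// scaleN1r opprK.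
    exact: derive_val.
have mif : measurable_fun setT (fun y => if s < y then f y else 0).
  apply: measurable_fun_ifT => //; first exact: measurable_fun_ltr.
  exact: continuous_measurable_fun.
have E : (\int[mu]_y (if s < y then f y else 0)%:E = (f s / theta)%:E)%E.
  rewrite -If [RHS]integral_mkcond; apply: eq_integral => y _.
  by rewrite patchE/= mem_setE/= in_itv/= andbT; case: ifP.
split; last by rewrite /Rintegral E.
apply/integrableP; split; first exact/measurable_EFinP.
under eq_integral.
  move=> y _; rewrite gee0_abs; last by rewrite lee_fin; case: ifP => // _; exact: expR_ge0.
  over.
by rewrite E ltry.
Qed.

(** By uniqueness of Lebesgue measure: [x] times its push-forward under [y -> x * y] gives every
    half-open interval its length. *)
Lemma Rint_scale (f : R -> R) x : 0 < x -> measurable_fun setT f ->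
  (forall y, 0 <= f y) ->
  (\int[mu]_y (f y)%:E = x%:E * \int[mu]_y (f (x * y))%:E)%E.
Proof.
move=> x0 mf f0.
have mx : measurable_fun setT (fun y : measurableTypeR R => x * y : measurableTypeR R).
  exact: measurable_funM.
pose pf : {measure set (measurableTypeR R) -> \bar R} :=
  measure_function_pushforward__canonical__measure_function_Measure mu mx.
pose nu := mscale (NngNum (ltW x0)) pf.
have nuE A : measurable A -> mu A = nu A.
  apply: lebesgue_measure_unique => _ [[a b]] _ <-.
  rewrite /nu/= /mscale/= /pushforward.
  rewrite (_ : _ @^-1` _ = `]a / x, b / x]%classic); last first.
    apply/seteqP; split => y /=; rewrite !in_itv/= ltr_pdivrMr// ler_pdivlMr//;
    by rewrite mulrC.
  rewrite !lebesgue_measure_itv/= !lte_fin ltr_pM2r ?invr_gt0//.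
  case: ifP => _; last by rewrite mule0.
  by rewrite -!EFinD -EFinM -mulrBl mulrCA divff ?mulr1 ?gt_eqF.
have mEf : measurable_fun setT (EFin \o f) by exact/measurable_EFinP.
rewrite (eq_measure_integral nu); last by move=> A mA _; exact: nuE.
rewrite ge0_integral_mscale//=; last by move=> y _; rewrite lee_fin.
by rewrite ge0_integral_pushforward//= => y _; rewrite lee_fin.
Qed.

End laplace.

Section gamma.
Context {R : realType}.
Implicit Types (x y s t beta : R).
Notation mu := (@lebesgue_measure R).

(** Extension by zero lets a convolution with the kernel run over the whole line, since it vanishes
    for [s >= t]. It serves with [alpha] as the fractional kernel and with [1 - alpha] as the
    density [r^(-alpha)]. *)
Definition powk beta y : R := if 0 < y then y `^ (beta - 1) else 0.

Lemma powk_ge0 beta y : 0 <= powk beta y.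
Proof. by rewrite /powk; case: ifP => // _; exact: powR_ge0. Qed.

Lemma measurable_powk beta : measurable_fun setT (powk beta).
Proof. by apply: measurable_fun_ifT => //; exact: measurable_fun_ltr. Qed.

(** Exhaustion of []0, 1]] by intervals away from 0: the fundamental theorem of calculus bounds the
    integral on each of them by [beta^-1], and monotone convergence passes to the limit. *)
Lemma powk_L1_itv01 beta : 0 < beta ->
  L1 mu (fun y : R => if y \in (`]0, 1]%classic : set R) then powk beta y else 0).
Proof.
move=> b0; apply: (L1_if _ _ _).1 => //.
have mE : measurable_fun (`]0, 1]%classic : set R) (EFin \o powk beta).
  by apply/measurable_EFinP/measurable_funTS; exact: measurable_powk.
apply/integrableP; split; first exact: mE.
under eq_integral do rewrite gee0_abs ?lee_fin ?powk_ge0//.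
(* With [i.+2] the left endpoint stays strictly below 1, as the fundamental theorem of calculus
   requires. *)
pose F (i : nat) : set R := `[i.+2%:R^-1, 1%R]%classic.
have FE : \bigcup_i F i = `]0%R, 1%R]%classic.
  apply/seteqP; split=> [y [i _]|y]; rewrite /F/= !in_itv/= => /andP[y0 y1]; rewrite ?y1.
    by rewrite andbT (lt_le_trans _ y0)// invr_gt0.
  have [k] := ltr_add_invr y0; rewrite add0r => /ltW ky; exists k => //=.
  rewrite in_itv/= y1 andbT (le_trans _ ky)// lef_pV2 ?posrE// ler_nat.
  exact: leqnSn.
rewrite -FE.
have ndF : nondecreasing_seq F.
  move=> i j ij; apply/subsetPset => y; rewrite /F/= !in_itv/= => /andP[h ->].
  by rewrite andbT (le_trans _ h)// lef_pV2 ?posrE// ler_nat.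
have cvgF : (\int[mu]_(y in F i) (powk beta y)%:E @[i --> \oo] -->
    \int[mu]_(y in \bigcup_i F i) (powk beta y)%:E)%E.
  apply: ge0_nondecreasing_set_cvg_integral => //.
  - by move=> i; exact: measurable_itv.
  - by move=> i; apply/measurable_EFinP/measurable_funTS; exact: measurable_powk.
  - by move=> i y _; rewrite lee_fin powk_ge0.
rewrite -(cvg_lim _ cvgF)//; apply: (@le_lt_trans _ _ (beta^-1%:E)); last exact: ltry.
apply: lime_le; first by apply/cvg_ex; eexists; exact: cvgF.
apply: nearW => i; rewrite /F.
have i0 : 0 < (i.+2%:R^-1 : R) by rewrite invr_gt0.
have pos y : i.+2%:R^-1 <= y -> 0 < y by move=> /(lt_le_trans i0).
have cp (r : R) y : 0 < y -> {for y, continuous (fun z : R => z `^ r)}.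
  move=> y0; apply: differentiable_continuous; apply/derivable1_diffP.
  by apply: derivable_powR; rewrite in_itv/= y0.
rewrite (_ : (\int[mu]_(y in _) _ = \int[mu]_(y in `[(i.+2%:R^-1)%R, 1%R]) (y `^ (beta - 1))%:E)%E); last first.
  apply: eq_integral => y; rewrite inE/= in_itv/= => /andP[/pos y0 _].
  by rewrite /powk y0.
rewrite (@continuous_FTC2 _ _ (fun y => beta^-1 * y `^ beta)).
- by rewrite powR1 mulr1 -EFinB lee_fin gerBl mulr_ge0 ?invr_ge0 ?powR_ge0 1?ltW.
- by rewrite invf_lt1// ltr1n.
- apply: continuous_in_subspaceT => y; rewrite inE/= in_itv/= => /andP[/pos y0 _].
  exact: cp.
- split.
  + move=> y; rewrite in_itv/= => /andP[/ltW/pos y0 _].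
    by apply: derivableM => //; apply: derivable_powR; rewrite in_itv/= y0.
  + apply: cvgMr; apply: cvg_at_right_filter; exact: cp.
  + apply: cvgMr; apply: cvg_at_left_filter; exact: cp.
- move=> y; rewrite in_itv/= => /andP[/ltW/pos y0 _].
  have d2 := is_derive1_powR beta y0.
  rewrite derive1E; have d3 : is_derive y 1 (fun z => beta^-1 * z `^ beta) (y `^ (beta - 1)).
    by apply: is_derive_eq; rewrite scalerA mulVf ?gt_eqF// scale1r.
  exact: derive_val.
Qed.

(** Up to 1 the power is the dominating function; beyond 1 the power is at most 1, because
    [beta <= 1], and the exponential dominates. *)
Lemma gamma_L1 beta x : 0 < beta <= 1 -> 0 < x ->
  L1 mu (fun y => powk beta y * expR (- (x * y))).
Proof.
move=> /andP[b0 b1] x0.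
apply: L1_le; [|exact: L1D (powk_L1_itv01 b0) (exp_tail 0 x0).1|].
  apply: measurable_funM; first exact: measurable_powk.
  by apply: measurableT_comp => //; apply: measurableT_comp => //; exact: measurable_funM.
move=> y; rewrite ger0_norm ?mulr_ge0 ?powk_ge0 ?expR_ge0// mem_setE/= in_itv/=.
rewrite /powk; case: ifPn => [y0|_]; last by rewrite mul0r addr0.
have [y1|y1] := leP y 1.
  rewrite -[leLHS]addr0 lerD ?expR_ge0// ler_piMr ?powR_ge0//.
  by rewrite -expR0 ler_expR oppr_le0 mulr_ge0 // ltW.
rewrite add0r ler_piMl ?expR_ge0//.
have b10 : beta - 1 <= 0 by rewrite subr_le0.
by have := ler_powR (ltW y1) b10; rewrite powRr0.
Qed.

Lemma GammaE beta : Gamma beta = \int[mu]_y (powk beta y * expR (- y)).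
Proof.
rewrite /Gamma Rint_if; apply: eq_Rintegral => y _.
rewrite mem_setE/= in_itv/= andbT /powk.
by case: ifP => //; rewrite mul0r.
Qed.

Lemma Gamma_gt0 beta : 0 < beta <= 1 -> 0 < Gamma beta.
Proof.
move=> b01; rewrite GammaE lt_neqAle Rint_ge0 ?andbT; last first.
  by move=> y; rewrite mulr_ge0 ?powk_ge0 ?expR_ge0.
apply/eqP => I0.
have i1 : L1 mu (fun y => powk beta y * expR (- y)).
  have := gamma_L1 b01 ltr01; by under eq_fun do rewrite mul1r.
have : {ae mu, forall y, powk beta y * expR (- y) = 0}.
  apply: (Rint0_ae0 i1); last by rewrite -I0.
  by move=> y; rewrite mulr_ge0 ?powk_ge0 ?expR_ge0.
case=> N [mN N0 sub]; have : (mu `]0%R, 1%R[ <= mu N)%E.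
  apply: le_measure; rewrite ?inE//.
  move=> y; rewrite /= in_itv/= => /andP[y0 _]; apply: sub => /eqP/=.
  by rewrite /powk y0 mulf_eq0 !gt_eqF ?powR_gt0 ?expR_gt0.
by rewrite N0 lebesgue_measure_itv/= lte_fin ltr01 oppr0 adde0 lee_fin ler10.
Qed.

(** With [beta = 1 - alpha] and [x = t - s] this represents the kernel of order [alpha] as a
    superposition of exponentials in [t - s]; with [beta = alpha] and [x = lambda] it is the Laplace
    transform of that kernel. *)
Lemma gamma_scale beta x : 0 < beta <= 1 -> 0 < x ->
  \int[mu]_y (powk beta y * expR (- (x * y))) = Gamma beta * powk (1 - beta) x.
Proof.
move=> b01 x0.
pose f y := powk beta y * expR (- y).
have f0 y : 0 <= f y by rewrite mulr_ge0 ?powk_ge0 ?expR_ge0.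
have mf : measurable_fun setT f.
  apply: measurable_funM; first exact: measurable_powk.
  by apply: measurableT_comp => //; exact: measurableT_comp.
have i1 : L1 mu f.
  have := gamma_L1 b01 ltr01; by under eq_fun do rewrite mul1r.
have i2 := gamma_L1 b01 x0.
have := Rint_scale x0 mf f0.
have E y : f (x * y) = x `^ (beta - 1) * (powk beta y * expR (- (x * y))).
  rewrite /f /powk pmulr_rgt0//; case: ifP => [y0|_]; last by rewrite !mul0r mulr0.
  by rewrite powRM ?mulrA ?ltW.
have -> : (\int[mu]_y (f (x * y))%:E = (x `^ (beta - 1) *
    \int[mu]_y (powk beta y * expR (- (x * y))))%:E)%E.
  transitivity (\int[mu]_y (x `^ (beta - 1) * (powk beta y * expR (- (x * y))))%:E)%E.
    by apply: eq_integral => y _; rewrite E.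
  by rewrite -RintegralZl// EFin_Rint//; exact: L1Z.
rewrite -(EFin_Rint i1) -GammaE -EFinM => -[->].
set I := Rintegral _ _ _; rewrite /powk x0.
have -> : x * (x `^ (beta - 1) * I) * x `^ (1 - beta - 1) =
    x `^ (1 + (beta - 1) + (1 - beta - 1)) * I.
  by rewrite !powRD ?(gt_eqF x0) ?implybT// powRr1 ?(ltW x0)//; ring.
by rewrite (_ : _ + _ + _ = 0) ?powRr0 ?mul1r//; ring.
Qed.

End gamma.

Lemma L1_prodM d1 d2 (T1 : measurableType d1) (T2 : measurableType d2)
    (R : realType) (m1 : {sigma_finite_measure set T1 -> \bar R})
    (m2 : {sigma_finite_measure set T2 -> \bar R}) (f : T1 -> R) (g : T2 -> R) :
  L1 m1 f -> L1 m2 g -> L1 (m1 \x m2)%E (fun z => f z.1 * g z.2).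
Proof.
move=> fi gi; have [mf mg] := (L1_measurable fi, L1_measurable gi).
apply: (@L1_prod_le _ _ _ _ _ _ _ _ (fun x => (\int[m2]_y `|g y|) * `|f x|)).
- apply: measurable_funM; exact: measurableT_comp.
- by apply: L1Z; exact: L1_norm.
- apply: nearW => x /=; split; first exact: L1Z.
  under eq_Rintegral do rewrite normrM.
  by rewrite RintegralZl//; [rewrite mulrC|exact: L1_norm].
Qed.

(** * Weighted energy of a primitive and Volterra estimates *)

Section energy.
Context {R : realType}.
Implicit Types (h : R -> R) (x y s t theta : R).
Notation mu := (@lebesgue_measure R).

(* For Lebesgue measure on R, unification does not find the measurable structure
   carried by the measure, so that the following lemmas fix it. *)
Lemma eq_L1_mu (f g : R -> R) : (forall x, f x = g x) -> L1 mu f -> L1 mu g.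
Proof. by move=> /funext ->. Qed.

Lemma eq_Rint_mu (f g : R -> R) : (forall x, f x = g x) ->
  \int[mu]_x f x = \int[mu]_x g x.
Proof. by move=> /funext ->. Qed.

Lemma L1_le_mu (f g : R -> R) : measurable_fun setT f -> L1 mu g ->
  (forall x, `|f x| <= g x) -> L1 mu f.
Proof. exact: (@L1_le _ _ _ mu f g). Qed.

Lemma Rint_le_mu (f g : R -> R) : L1 mu f -> L1 mu g ->
  (forall x, f x <= g x) -> \int[mu]_x f x <= \int[mu]_x g x.
Proof. exact: (@Rint_le _ _ _ mu f g). Qed.

Lemma L1_eq0_mu (f : R -> R) : (forall x, f x = 0) -> L1 mu f.
Proof. by move=> /funext ->; exact: integrable0. Qed.

Lemma Rint_eq0_mu (f : R -> R) : (forall x, f x = 0) -> \int[mu]_x f x = 0.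
Proof. by move=> /funext ->; rewrite Rintegral_cst// mul0r. Qed.

Lemma ae_imp_mu (P Q : R -> Prop) : (forall t, P t -> Q t) ->
  {ae mu, forall t, P t} -> {ae mu, forall t, Q t}.
Proof. exact: (@filterS _ _ (ae_filter_ringOfSetsType mu) P Q). Qed.

Lemma ae_and_mu (P Q : R -> Prop) : {ae mu, forall t, P t} ->
  {ae mu, forall t, Q t} -> {ae mu, forall t, P t /\ Q t}.
Proof. exact: (@filterI _ _ (ae_filter_ringOfSetsType mu) P Q). Qed.

Lemma ae_L1_mu (f g : R -> R) : measurable_fun setT g ->
  {ae mu, forall x, f x = g x} -> L1 mu f -> L1 mu g.
Proof. exact: (@ae_L1 _ _ _ mu f g). Qed.

Lemma ae_Rint_mu (f g : R -> R) : L1 mu f -> measurable_fun setT g ->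
  {ae mu, forall x, f x = g x} -> \int[mu]_x f x = \int[mu]_x g x.
Proof. exact: (@ae_Rint _ _ _ mu f g). Qed.

Lemma ae_L1_le_mu (f g : R -> R) : measurable_fun setT f -> L1 mu g ->
  {ae mu, forall x, `|f x| <= g x} -> L1 mu f.
Proof. exact: (@ae_L1_le _ _ _ mu f g). Qed.

Lemma ae_Rint_le_mu (f g : R -> R) : L1 mu f -> L1 mu g ->
  {ae mu, forall x, f x <= g x} -> \int[mu]_x f x <= \int[mu]_x g x.
Proof. exact: (@ae_Rint_le _ _ _ mu f g). Qed.

(** The lower limit is minus infinity: for a function that vanishes on the negative half-line this
    is the primitive starting at 0, and no initial value has to be carried. *)
Definition prim h t : R := \int[mu]_s (if s < t then h s else 0).

Lemma L1_iflt h t : L1 mu h -> L1 mu (fun s => if s < t then h s else 0).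
Proof.
move=> ih; apply: L1_le (L1_norm ih) _.
  by apply: measurable_fun_ifT => //; [exact: measurable_fun_ltr|exact: L1_measurable ih].
by move=> s; case: ifP => //; rewrite normr0.
Qed.

Lemma measurable_prim h : measurable_fun setT h -> measurable_fun setT (prim h).
Proof.
move=> mh; apply: (measurable_Rint2 mu (k := fun z => if z.2 < z.1 then h z.2 else 0)).
apply: measurable_fun_ifT => //; last exact: measurableT_comp.
by apply: measurable_fun_ltr; [exact: measurable_snd|exact: measurable_fst].
Qed.

Lemma prim_le h t : L1 mu h -> `|prim h t| <= \int[mu]_s `|h s|.
Proof.
move=> ih; apply: le_trans (Rint_norm (L1_iflt t ih)) _.
apply: Rint_le; [exact/L1_norm/L1_iflt|exact: L1_norm|].
by move=> s; case: ifP => //; rewrite normr0.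
Qed.

Lemma L1_Mprim h h' : L1 mu h -> L1 mu h' -> L1 mu (fun s => h s * prim h' s).
Proof.
move=> ih ih'; apply: L1_le (L1Z (\int[mu]_s `|h' s|) (L1_norm ih)) _.
  apply: measurable_funM; first exact: L1_measurable ih.
  exact: measurable_prim (L1_measurable ih').
by move=> s; rewrite normrM mulrC ler_wpM2r// prim_le.
Qed.

(** The square of pairs [(s, s')] below [t] splits along its diagonal into two triangles over which
    [h s * h s'] has the same integral, and the right-hand side is twice the integral over one of
    them. *)
Lemma prim_sqr h t : L1 mu h ->
  prim h t ^+ 2 = 2 * \int[mu]_s (if s < t then h s * prim h s else 0).
Proof.
move=> ih; have mh := L1_measurable ih.
set J := Rintegral _ _ _.
pose k (z : R * R) := (if z.1 < t then h z.1 else 0) * (if z.2 < z.1 then h z.2 else 0).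
have ik : L1 (mu \x mu)%E k.
  apply: L1_le (L1_prodM (L1_norm ih) (L1_norm ih)) _.
    apply: measurable_funM; apply: measurable_fun_ifT => //;
      try exact: measurableT_comp; exact: measurable_fun_ltr.
  move=> z; rewrite /k normrM; apply: ler_pM => //; case: ifP => //; rewrite normr0//.
have JE : J = \int[mu]_s \int[mu]_s' k (s, s').
  apply: eq_Rintegral => s _; rewrite /k/= RintegralZl//; last exact: L1_iflt.
  by case: ifP => //; rewrite mul0r.
rewrite mulr_natl mulr2n {1}JE (Rint_swap ik).
have ip : L1 mu (fun s => if s < t then h s * prim h s else 0).
  by apply: L1_iflt; exact: L1_Mprim.
rewrite expr2 {2}/prim -RintegralZl ?L1_iflt// -RintegralD//; last first.
  exact: L1_Rint1 ik.
apply: eq_Rintegral => s' _; rewrite /k/=.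
rewrite (_ : (fun _ => _) = (fun s => (if s' < t then h s' else 0) *
   (if (s' < s) && (s < t) then h s else 0))); last first.
  apply/funext => s; case: (ltP s' s) => ss'/=; last by rewrite !mulr0.
  case: (ltP s t) => st; last by rewrite mul0r mulr0.
  by rewrite mulrC (lt_trans ss' st).
have i1 : L1 mu (fun s => if (s' < s) && (s < t) then h s else 0).
  apply: L1_le (L1_norm ih) _.
    apply: measurable_fun_ifT => //; apply: measurable_and; exact: measurable_fun_ltr.
  by move=> s; case: ifP => //; rewrite normr0.
rewrite RintegralZl//; case: ifPn => [s't|_]; last by rewrite mulr0 mul0r addr0.
rewrite -mulrDr mulrC; congr (_ * _); rewrite /prim -RintegralD//; last exact: L1_iflt.
apply: ae_Rint; first exact: L1_iflt.
  apply: measurable_funD; first exact: L1_measurable i1.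
  exact: L1_measurable (L1_iflt s' ih).
(* The conditions [s' < s] and [s < s'] miss only the point [s = s'], a null set. *)
exists [set s']; split => //; first exact: lebesgue_measure_set1.
move=> s /= ss'; apply: contrapT => /eqP ns; apply: ss'.
case: (ltgtP s s') ns => // [ss' _|ss' _].
  by rewrite add0r (lt_trans ss' s't).
by rewrite addr0.
Qed.

(* Integration by parts for [prim h ^+ 2], which is not assumed to be
   differentiable: both sides are Fubini integrals over [s < t]. *)
Lemma energy h theta : L1 mu h -> (forall s, s <= 0 -> h s = 0) -> 0 < theta ->
  [/\ L1 mu (fun t => expR (- (theta * t)) * prim h t ^+ 2),
      L1 mu (fun t => expR (- (theta * t)) * (h t * prim h t)) &
  2 * \int[mu]_t (expR (- (theta * t)) * (h t * prim h t)) =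
  theta * \int[mu]_t (expR (- (theta * t)) * prim h t ^+ 2)].
Proof.
move=> ih h0 th0; have mh := L1_measurable ih.
have mp := measurable_prim mh.
have me : measurable_fun setT (fun t => expR (- (theta * t))).
  by apply: measurableT_comp => //; apply: measurableT_comp => //; exact: measurable_funM.
have iP := L1_Mprim ih ih.
have [ie Ie] := exp_tail 0 th0.
(* The exponential is not integrable on the negative half-line; cutting it off there is harmless,
   since [prim h] vanishes for [t <= 0]. *)
pose e0 t := if 0 < t then expR (- (theta * t)) else 0.
have e0_ge0 t : 0 <= e0 t by rewrite /e0; case: ifP => // _; exact: expR_ge0.
have prim0 t : t <= 0 -> prim h t = 0.
  move=> t0; rewrite /prim (_ : (fun _ => _) = cst 0) ?Rintegral_cst ?mul0r//.
  by apply/funext => s /=; case: ltP => // st; rewrite h0// (le_trans (ltW st)).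
(* Integration in [s] first produces half the square of the primitive, by [prim_sqr]; integration in
   [t] first produces the tail of the exponential from [s] on. *)
pose k (z : R * R) := e0 z.1 * (if z.2 < z.1 then h z.2 * prim h z.2 else 0).
have ik : L1 (mu \x mu)%E k.
  apply: L1_le (L1_prodM ie (L1_norm iP)) _.
    apply: measurable_funM.
      apply: (measurableT_comp (L1_measurable ie)); exact: measurable_fst.
    apply: measurable_fun_ifT => //; first exact: measurable_fun_ltr.
    apply: (measurableT_comp (L1_measurable iP)); exact: measurable_snd.
  move=> z; rewrite /k normrM; apply: ler_pM => //; first by rewrite ger0_norm.
  by case: ifP => //; rewrite normr0.
have E1 t : \int[mu]_s k (t, s) =
    2^-1 * (expR (- (theta * t)) * prim h t ^+ 2).
  rewrite /k/= RintegralZl//; last exact: L1_iflt.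
  rewrite prim_sqr// /e0; case: ltP => [_|t0]; first by field.
  rewrite mul0r -prim_sqr// prim0//; ring.
have E2 s : \int[mu]_t k (t, s) =
    theta^-1 * (expR (- (theta * s)) * (h s * prim h s)).
  rewrite /k/=.
  have [s0|s0] := leP s 0.
    rewrite h0// (_ : (fun _ => _) = cst 0) ?Rintegral_cst ?mul0r ?mulr0//.
    by apply/funext => t /=; case: ifP => //; rewrite mulr0.
  rewrite (_ : (fun _ => _) = (fun t => (h s * prim h s) *
     (if s < t then expR (- (theta * t)) else 0))); last first.
    apply/funext => t; rewrite /e0; case: (ltP s t) => st; last by rewrite !mulr0.
    by rewrite (lt_trans s0 st) mulrC.
  have [is_ Is] := exp_tail s th0.
  by rewrite RintegralZl// Is; ring.
have i1 : L1 mu (fun t => expR (- (theta * t)) * prim h t ^+ 2).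
  have := L1Z 2 (L1_Rint2 ik); apply: eq_integrable => // t _ /=.
  by rewrite E1; congr EFin; field.
have i2 : L1 mu (fun t => expR (- (theta * t)) * (h t * prim h t)).
  have := L1Z theta (L1_Rint1 ik); apply: eq_integrable => // t _ /=.
  by rewrite E2; congr EFin; field; rewrite gt_eqF.
split => //.
have := etrans (esym (eq_Rint mu E1)) (etrans (Rint_swap ik) (eq_Rint mu E2)).
rewrite !RintegralZl// => E.
move: E; set A := Rintegral _ _ _; set B := Rintegral _ _ _ => /(congr1 ( *%R (2 * theta))).
have -> : 2 * theta * (2^-1 * A) = theta * A by field.
by have -> : 2 * theta * (theta^-1 * B) = 2 * B by field; rewrite gt_eqF.
Qed.

End energy.

Section volterra.
Context {R : realType}.
Implicit Types (f v : R -> R) (r x y s t T lambda : R).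
Notation mu := (@lebesgue_measure R).

Lemma L1_prod_le_mu (k : R * R -> R) (g : R -> R) : measurable_fun setT k ->
  L1 mu g -> {ae mu, forall x, L1 mu (fun y => k (x, y)) /\
    \int[mu]_y `|k (x, y)| <= g x} ->
  L1 (mu \x mu)%E k.
Proof. exact: (@L1_prod_le _ _ _ _ _ mu mu k g). Qed.

Lemma measurable_expM (c : R) : measurable_fun setT (fun t => expR (- (c * t))).
Proof.
by apply: measurableT_comp => //; apply: measurableT_comp => //; exact: measurable_funM.
Qed.

Lemma measurable_itvoo (a b : R) : measurable_fun setT (fun s : R => (a < s < b)).
Proof.
by apply: measurable_and; exact: measurable_fun_ltr.
Qed.

Lemma ind_itv T : 0 <= T ->
  L1 mu (fun s : R => if 0 < s < T then 1 : R else 0) /\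
  \int[mu]_s (if 0 < s < T then 1 else 0) = T.
Proof.
move=> T0; have E : (\int[mu]_s (if (0 < s < T)%R then 1%R else 0%R)%:E = T%:E)%E.
  transitivity (\int[mu]_(s in `]0%R, T[) (1%E : \bar R))%E.
    rewrite [RHS]integral_mkcond; apply: eq_integral => s _.
    by rewrite patchE mem_setE/= in_itv/=; case: ifP.
  rewrite integral_cst//= mul1e lebesgue_measure_itv/= lte_fin.
  case: ltP => [_|T0']; first by rewrite oppr0 adde0.
  by have -> : T = 0 by apply/eqP; rewrite eq_le T0' T0.
split; last by rewrite /Rintegral E.
apply/integrableP; split.
  apply/measurable_EFinP; apply: measurable_fun_ifT => //; exact: measurable_itvoo.
under eq_integral.
  move=> s _; rewrite gee0_abs; last by rewrite lee_fin; case: ifP.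
  over.
by rewrite E ltry.
Qed.

Lemma L2_itv_L1 v t : measurable_fun setT v ->
  (forall s, ~~ (0 < s < t) -> v s = 0) -> L1 mu (fun s => v s ^+ 2) -> L1 mu v.
Proof.
move=> mv v0 iv; have [t0|t0] := leP t 0.
  apply: L1_le; [exact: mv|exact: iv|] => s.
  have ns : ~~ (0 < s < t).
    by apply: contraL t0 => /andP[s0 /(lt_trans s0)]; rewrite -ltNge.
  by rewrite v0// normr0 expr0n.
have [i1 _] := ind_itv (ltW t0).
apply: L1_le; [exact: mv|exact: L1D i1 iv|].
move=> s /=; case: (boolP (0 < s < t)) => [_|/v0 vs0]; last by rewrite vs0 normr0 expr0n addr0.
have <- : `|v s| ^+ 2 = v s ^+ 2 by rewrite -normrX ger0_norm ?sqr_ge0.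
by have := sqr_ge0 (`|v s| - 1); have := normr_ge0 (v s); nra.
Qed.

Lemma cauchy_schwarz_itv v t : 0 < t -> measurable_fun setT v ->
  (forall s, ~~ (0 < s < t) -> v s = 0) -> L1 mu (fun s => v s ^+ 2) ->
  (\int[mu]_s v s) ^+ 2 <= t * \int[mu]_s (v s ^+ 2).
Proof.
move=> t0 mv v0 iv; have iv1 := L2_itv_L1 mv v0 iv.
set I := Rintegral _ _ _; set J := Rintegral _ _ _.
have [i1 I1] := ind_itv (ltW t0).
have key x : 2 * x * I <= x ^+ 2 * t + J.
  rewrite -[X in _ * X + _]I1 -!RintegralZl// -RintegralD//; last exact: L1Z.
  apply: Rint_le; [exact: L1Z|by apply: L1D => //; exact: L1Z|].
  move=> s /=; case: (boolP (0 < s < t)) => [_|/v0 vs0]; last by rewrite vs0 expr0n/= !mulr0 addr0.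
  by have := sqr_ge0 (x - v s); nra.
(* The mean value of [v] over the interval is the [x] for which the quadratic inequality [key] is
   sharpest. *)
have := key (I / t).
have -> : 2 * (I / t) * I = 2 * (I ^+ 2 / t) by ring.
have -> : (I / t) ^+ 2 * t = I ^+ 2 / t by field; rewrite gt_eqF.
rewrite mulr_natl mulr2n lerD2l ler_pdivrMr//.
by rewrite mulrC.
Qed.

(** By Fubini a primitive costs a factor [lambda^-1]: the value [v s] meets the tail of the weight
    from [s] on, which is [e^(-lambda s) / lambda]. *)
Lemma volterra_weight v lambda : 0 < lambda -> (forall s, s <= 0 -> v s = 0) ->
  L1 mu (fun t => expR (- (lambda * t)) * v t) ->
  [/\ forall t, L1 mu (fun s => if s < t then v s else 0),
      L1 mu (fun t => expR (- (lambda * t)) * prim v t) &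
      \int[mu]_t (expR (- (lambda * t)) * prim v t) =
        lambda^-1 * \int[mu]_t (expR (- (lambda * t)) * v t)].
Proof.
move=> l0 v0 iv.
pose e t := expR (- (lambda * t)).
have e_gt0 t : 0 < e t by exact: expR_gt0.
have mv : measurable_fun setT v.
  rewrite (_ : v = fun t => expR (- (- lambda * t)) * (e t * v t)).
    by apply: measurable_funM; [exact: measurable_expM|exact: L1_measurable iv].
  apply/funext => t; rewrite mulrA /e -expRD.
  by rewrite mulNr opprK subrr expR0 mul1r.
have ivt t : L1 mu (fun s => if s < t then v s else 0).
  apply: L1_le (L1Z (e t)^-1 (L1_norm iv)) _.
    by apply: measurable_fun_ifT => //; exact: measurable_fun_ltr.
  move=> s; case: ltP => [st|_]; last by rewrite normr0 mulr_ge0 // invr_ge0 ltW.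
  rewrite normrM gtr0_norm ?expR_gt0// mulrA ler_peMl//.
  rewrite ler_pdivlMl// mulr1 ler_expR lerN2 ler_pM2l// ltW//.
have [ie Ie] := exp_tail 0 l0.
pose k (z : R * R) := e z.2 * (if z.1 < z.2 then v z.1 else 0).
have mk : measurable_fun setT k.
  apply: measurable_funM.
    apply: (measurableT_comp (measurable_expM lambda)); exact: measurable_snd.
  apply: measurable_fun_ifT => //; first exact: measurable_fun_ltr.
  apply: (measurableT_comp mv); exact: measurable_fst.
have kE s : (fun t => k (s, t)) = (fun t => v s * (if s < t then e t else 0)).
  by apply/funext => t; rewrite /k/= mulrC; case: ifP => //; rewrite mul0r mulr0.
have ik : L1 (mu \x mu)%E k.
  apply: (@L1_prod_le_mu _ (fun s => lambda^-1 * `|e s * v s|)); [exact: mk|by apply: L1Z; exact: L1_norm|].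
  apply: nearW => s; have [ies Ies] := exp_tail s l0; split.
    by rewrite kE; exact: L1Z.
  rewrite (_ : (fun t => _) = (fun t => `|v s| * (if s < t then e t else 0))); last first.
    apply/funext => t; rewrite (congr1 (fun f => f t) (kE s)) normrM; congr (_ * _).
    by rewrite ger0_norm//; case: ifP => // _; exact: ltW.
  rewrite RintegralZl// Ies normrM (gtr0_norm (e_gt0 s)).
  by rewrite mulrC mulrAC mulrC mulrA.
have E2 t : \int[mu]_s k (s, t) = e t * prim v t by rewrite /k/= RintegralZl.
split => //.
  by have := L1_Rint1 ik; apply: eq_integrable => // t _ /=; rewrite E2.
under eq_Rintegral do rewrite -E2.
rewrite -(Rint_swap ik) -RintegralZl//; apply: eq_Rintegral => s _.
have [ies Ies] := exp_tail s l0.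
by rewrite kE RintegralZl// Ies; ring.
Qed.

(** Write [1 / (lambda + r)] as the integral of [e^(-(lambda + r) y)] over positive [y] and
    integrate in [r] first: [gamma_scale] turns the density into the kernel of order [alpha], whose
    Laplace transform at [lambda] remains. The resulting power [lambda^(-alpha)] is the small factor
    in the coercivity for [w]. *)
Lemma resolvent_kernel (alpha lambda : R) : 0 < alpha < 1 -> 0 < lambda ->
  L1 mu (fun r => powk (1 - alpha) r / (lambda + r)) /\
  \int[mu]_r (powk (1 - alpha) r / (lambda + r)) =
    Gamma (1 - alpha) * Gamma alpha * powk (1 - alpha) lambda.
Proof.
move=> /andP[a0 a1] l0.
have a01 : 0 < alpha <= 1 by rewrite a0 ltW.
have b01 : 0 < 1 - alpha <= 1 by rewrite subr_gt0 a1 gerBl ltW.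
pose k (z : R * R) := (if 0 < z.1 then expR (- (lambda * z.1)) else 0) *
   (powk (1 - alpha) z.2 * expR (- (z.1 * z.2))).
have mk : measurable_fun setT k.
  apply: measurable_funM.
    apply: (measurableT_comp (L1_measurable (exp_tail 0 l0).1)).
    exact: measurable_fst.
  apply: measurable_funM.
    apply: (measurableT_comp (measurable_powk _)); exact: measurable_snd.
  by apply: measurableT_comp => //; apply: measurableT_comp => //; exact: measurable_funM.
have k_ge0 z : 0 <= k z.
  by rewrite mulr_ge0 ?mulr_ge0 ?powk_ge0 ?expR_ge0//; case: ifP => // _; exact: expR_ge0.
have k1 y : L1 mu (fun r => k (y, r)) /\
    \int[mu]_r k (y, r) = Gamma (1 - alpha) * (powk alpha y * expR (- (lambda * y))).
  rewrite /k/=; have [y0|y0] := ltP 0 y.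
    have i1 := gamma_L1 b01 y0.
    split; first exact: L1Z.
    by rewrite RintegralZl// gamma_scale// subKr; ring.
  rewrite (_ : (fun r => _) = cst 0); last by apply/funext => r; rewrite mul0r.
  split; first exact: integrable0.
  by rewrite Rintegral_cst// mul0r /powk (ltNge 0 y) y0/= mul0r mulr0.
have ik : L1 (mu \x mu)%E k.
  apply: (@L1_prod_le_mu _ (fun y => Gamma (1 - alpha) * (powk alpha y * expR (- (lambda * y))))); [exact: mk|by apply: L1Z; exact: gamma_L1|].
  apply: nearW => y; have [iy Iy] := k1 y; split => //.
  by under eq_Rintegral do rewrite ger0_norm//; rewrite Iy.
have E2 r : \int[mu]_y k (y, r) = powk (1 - alpha) r / (lambda + r).
  rewrite /k/=; have [r0|r0] := ltP 0 r; last first.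
    rewrite (_ : (fun y => _) = cst 0).
      by rewrite Rintegral_cst// mul0r /powk (ltNge 0 r) r0/= mul0r.
    by apply/funext => y; rewrite /powk (ltNge 0 r) r0/= mul0r mulr0.
  have lr0 : 0 < lambda + r by exact: addr_gt0.
  have [il Il] := exp_tail 0 lr0.
  rewrite (_ : (fun y => _) = (fun y => powk (1 - alpha) r *
     (if 0 < y then expR (- ((lambda + r) * y)) else 0))); last first.
    apply/funext => y; case: ifP => _; last by rewrite mul0r mulr0.
    by rewrite mulrCA -expRD; congr (_ * expR _); ring.
  by rewrite RintegralZl// Il mulr0 oppr0 expR0 mul1r.
have i2 := L1_Rint1 ik; split.
  by move: i2; apply: eq_integrable => // r _ /=; rewrite E2.
under eq_Rintegral do rewrite -E2.
rewrite -(Rint_swap ik); under eq_Rintegral do rewrite (k1 _).2.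
rewrite RintegralZl//; last exact: gamma_L1.
by rewrite gamma_scale// mulrA.
Qed.

End volterra.

(** * Coercivity of the fractional integral *)

Section exponential_memory.
Context {R : realType}.
Implicit Types (r x y s t : R).
Notation mu := (@lebesgue_measure R).

(** The factor 2 makes the constant in [wr_energy] equal to [lambda + r]. *)
Definition expw lambda t : R := expR (- (2 * lambda * t)).

Lemma expw_gt0 lambda t : 0 < expw lambda t. Proof. exact: expR_gt0. Qed.

Lemma measurable_expw lambda : measurable_fun setT (expw lambda).
Proof. exact: measurable_expM. Qed.

(* Convolution with [e^(-rt)]; [wfrac_wr] recovers the fractional integral from
   these by integration in [r]. *)
Definition wr (f : R -> R) r t : R :=
  \int[mu]_s (if s < t then expR (- (r * (t - s))) * f s else 0).

Definition wfrac alpha (f : R -> R) t : R :=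
  \int[mu]_s (powk alpha (t - s) * f s).

Lemma measurable_wr_kernel (f : R -> R) : measurable_fun setT f ->
  measurable_fun setT (fun z : R * R * R =>
    if z.2 < z.1.2 then expR (- (z.1.1 * (z.1.2 - z.2))) * f z.2 else 0).
Proof.
move=> mf.
have m12 : measurable_fun setT (fun z : R * R * R => z.1.2).
  exact: (measurableT_comp measurable_snd measurable_fst).
have m11 : measurable_fun setT (fun z : R * R * R => z.1.1).
  exact: (measurableT_comp measurable_fst measurable_fst).
apply: measurable_fun_ifT => //.
  by apply: measurable_fun_ltr; [exact: measurable_snd|exact: m12].
apply: measurable_funM; last exact: (measurableT_comp mf measurable_snd).
apply: measurableT_comp => //; apply: measurableT_comp => //.
apply: measurable_funM => //; apply: measurable_funB => //.
Qed.

Lemma measurable_wr (f : R -> R) : measurable_fun setT f ->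
  measurable_fun setT (fun z : R * R => wr f z.1 z.2).
Proof. by move=> /measurable_wr_kernel; exact: (measurable_Rint2 mu). Qed.

Lemma measurable_wfrac alpha (f : R -> R) : measurable_fun setT f ->
  measurable_fun setT (wfrac alpha f).
Proof.
move=> mf; apply: (measurable_Rint2 mu (k := fun z : R * R => powk alpha (z.1 - z.2) * f z.2)).
apply: measurable_funM; last exact: (measurableT_comp mf measurable_snd).
apply: (measurableT_comp (measurable_powk alpha)); apply: measurable_funB.
  exact: measurable_fst.
exact: measurable_snd.
Qed.

Variables (T lambda : R) (T0 : 0 < T) (l0 : 0 < lambda).

Definition supp_itv (f : R -> R) := forall s, ~~ (0 < s < T) -> f s = 0.

Definition L2_itv (f : R -> R) :=
  [/\ measurable_fun setT f, supp_itv f & L1 mu (fun s => f s ^+ 2)].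

Let E := expw lambda.

Let E_gt0 t : 0 < E t. Proof. exact: expR_gt0. Qed.

Let mE : measurable_fun setT E. Proof. exact: measurable_expM. Qed.

Lemma L2_itv_integrable f : L2_itv f -> L1 mu f.
Proof. by case=> mf sf if2; exact: (L2_itv_L1 mf sf if2). Qed.

Lemma L2_itv_weight f : L2_itv f -> L1 mu (fun s => E s * f s ^+ 2).
Proof.
move=> [mf sf if2]; apply: L1_le if2 _.
  by apply: measurable_funM => //; exact: measurable_funX.
move=> s; rewrite ger0_norm; last by rewrite mulr_ge0 ?sqr_ge0// ltW.
have [/andP[s0 _]|/sf fs0] := boolP (0 < s < T); last first.
  by rewrite fs0 expr0n/= mulr0.
by rewrite ler_piMl ?sqr_ge0// -expR0 /E /expw ler_expR oppr_le0 !mulr_ge0// ltW.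
Qed.

Lemma L2_itv_norm f : L2_itv f -> L2_itv (fun s => `|f s|).
Proof.
move=> [mf sf if2]; split; first exact: measurableT_comp.
- by move=> s /sf ->; rewrite normr0.
- by move: if2; apply: eq_integrable => // s _ /=; rewrite -normrX ger0_norm ?sqr_ge0.
Qed.

Lemma L2_itvD f g : L2_itv f -> L2_itv g -> L2_itv (fun s => f s + g s).
Proof.
move=> [mf sf if2] [mg sg ig2]; split; first exact: measurable_funD.
- by move=> s ns; rewrite sf// sg// addr0.
- apply: L1_le (L1Z 2 (L1D if2 ig2)) _.
    by apply: measurable_funX; exact: measurable_funD.
  by move=> s; rewrite ger0_norm ?sqr_ge0//; have := sqr_ge0 (f s - g s); nra.
Qed.

Lemma L2_itv_ind : L2_itv (fun s => if 0 < s < T then 1 else 0).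
Proof.
have [i1 _] := ind_itv (ltW T0); split.
- exact: L1_measurable i1.
- by move=> s /negbTE ->.
- by move: i1; apply: eq_integrable => // s _ /=; case: ifP; rewrite ?expr1n ?expr0n.
Qed.

Section L2.
Variables (f : R -> R) (f2 : L2_itv f).

Let mf : measurable_fun setT f. Proof. by case: f2. Qed.

Let if1 : L1 mu f. Proof. exact: L2_itv_integrable. Qed.

Lemma L1_exp r : 0 <= r -> L1 mu (fun s => expR (r * s) * f s).
Proof.
move=> r0; apply: L1_le (L1Z (expR (r * T)) (L1_norm if1)) _.
  have me : measurable_fun setT (fun s => expR (r * s)).
    by apply: measurableT_comp => //; exact: measurable_funM.
  exact: measurable_funM me mf.
case: f2 => _ sf _ s; rewrite normrM ger0_norm ?expR_ge0//.
have [/andP[_ sT]|/sf fs0] := boolP (0 < s < T); last first.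
  by rewrite fs0 normr0 !mulr0.
by rewrite ler_wpM2r// ler_expR ler_wpM2l// ltW.
Qed.

(** Splitting [e^(-r(t-s))] reduces the convolution to a primitive, to which [energy] applies; the
    growing factor [e^(rs)] is harmless because [f] is supported in []0, T[]. *)
Lemma wr_prim r t : 0 <= r ->
  wr f r t = expR (- (r * t)) * prim (fun s => expR (r * s) * f s) t.
Proof.
move=> r0; rewrite /wr /prim -RintegralZl//; last exact/L1_iflt/L1_exp.
apply: eq_Rintegral => s _; case: ifP => _; last by rewrite mulr0.
by rewrite mulrA -expRD; congr (expR _ * _); ring.
Qed.

Lemma wr_energy r : 0 <= r ->
  [/\ L1 mu (fun t => E t * wr f r t ^+ 2),
      L1 mu (fun t => E t * (f t * wr f r t)) &
      \int[mu]_t (E t * (f t * wr f r t)) =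
      (lambda + r) * \int[mu]_t (E t * wr f r t ^+ 2)].
Proof.
move=> r0; pose h s := expR (r * s) * f s.
have h0 s : s <= 0 -> h s = 0.
  move=> s0; case: f2 => _ sf _; rewrite /h sf ?mulr0//.
  by rewrite negb_and -leNgt s0.
(* Of the exponent [2 * (lambda + r)], the part [2 * lambda] is the weight and [2 * r] comes from
   the square of the factor [e^(-rt)] in [wr_prim]. *)
have th0 : 0 < 2 * (lambda + r) by rewrite mulr_gt0// ltr_wpDr.
have [i1 i2 I] := energy (L1_exp r0) h0 th0.
have e1 t : expR (- (2 * (lambda + r) * t)) * prim h t ^+ 2 = E t * wr f r t ^+ 2.
  rewrite wr_prim// exprMn [RHS]mulrA; congr (_ * _).
  by rewrite expr2 /E /expw -!expRD; congr expR; ring.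
have e2 t : expR (- (2 * (lambda + r) * t)) * (h t * prim h t) = E t * (f t * wr f r t).
  rewrite wr_prim// -/h /h /E /expw; set p := prim _ _.
  have -> : expR (- (2 * (lambda + r) * t)) =
      expR (- (2 * lambda * t)) * expR (- (r * t)) * expR (- (r * t)).
    by rewrite -!expRD; congr expR; ring.
  rewrite -[RHS]mulr1 -(expRxMexpNx_1 (r * t)); ring.
split.
- exact: eq_L1_mu e1 i1.
- exact: eq_L1_mu e2 i2.
- have key (a b c d : R) : a = c -> b = d ->
    2 * b = 2 * (lambda + r) * a -> d = (lambda + r) * c.
    by move=> -> ->; rewrite -mulrA => /mulfI; apply; rewrite pnatr_eq0.
  exact: key (eq_Rint_mu e1) (eq_Rint_mu e2) I.
Qed.

(** Young's inequality with parameter [lambda + r]: by [wr_energy] the term in [wr^2] is again the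
    left-hand side and is absorbed. The decay in [r] makes the bound integrable against the density
    [r^(-alpha)]. *)
Lemma wr_energy_le r : 0 <= r ->
  \int[mu]_t (E t * (f t * wr f r t)) <=
  (\int[mu]_t (E t * f t ^+ 2)) / (lambda + r).
Proof.
move=> r0; have [i1 i2 I] := wr_energy r0; have i3 := L2_itv_weight f2.
have lr : 0 < lambda + r by rewrite ltr_wpDr.
set G := Rintegral _ _ _ in I *; set A := Rintegral _ _ _ in I; set B := Rintegral _ _ _.
suff : 2 * G <= B / (lambda + r) + (lambda + r) * A by rewrite -I; lra.
rewrite mulrC mulrC -RintegralZl// [B / _]mulrC -!RintegralZl// -RintegralD//; last 2 first.
- exact: L1Z.
- exact: L1Z.
apply: Rint_le; [exact: L1Z|by apply: L1D; exact: L1Z|move=> t].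
rewrite (_ : _ + _ = E t * ((lambda + r)^-1 * f t ^+ 2 + (lambda + r) * wr f r t ^+ 2)); last by ring.
rewrite mulrCA ler_pM2l//.
have -> : (lambda + r)^-1 * f t ^+ 2 + (lambda + r) * wr f r t ^+ 2 =
  2 * (f t * wr f r t) + (lambda + r) * ((lambda + r)^-1 * f t - wr f r t) ^+ 2.
  by field; rewrite gt_eqF.
by rewrite lerDl mulr_ge0 ?sqr_ge0// ltW.
Qed.

End L2.

End exponential_memory.

Section fractional_kernel.
Context {R : realType}.
Implicit Types (f g : R -> R) (r x y s t : R).
Notation mu := (@lebesgue_measure R).
Variables (T lambda alpha : R).
Hypotheses (T0 : 0 < T) (l0 : 0 < lambda) (alpha01 : 0 < alpha < 1).

Let b01 : 0 < 1 - alpha <= 1.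
Proof. by case/andP: alpha01 => h1 h2; rewrite subr_gt0 h2 gerBl ltW. Qed.

Let E := expw lambda.

Let rho := powk (1 - alpha).

Let rho_ge0 r : 0 <= rho r. Proof. exact: powk_ge0. Qed.

Let rho0 r : r <= 0 -> rho r = 0.
Proof. by rewrite /rho /powk leNgt => /negbTE ->. Qed.

Lemma L1_wr_kernel f r t : L2_itv T f -> 0 <= r ->
  L1 mu (fun s => if s < t then expR (- (r * (t - s))) * f s else 0).
Proof.
move=> f2 r0; have := L1Z (expR (- (r * t))) (L1_iflt t (L1_exp f2 r0)).
apply: eq_L1_mu => s; case: ifP => _; last by rewrite mulr0.
by rewrite mulrA -expRD; congr (expR _ * _); ring.
Qed.

Lemma wr_le f g r t : L2_itv T f -> L2_itv T g -> 0 <= r ->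
  (forall s, f s <= g s) -> wr f r t <= wr g r t.
Proof.
move=> f2 g2 r0 fg; apply: Rint_le; [exact: L1_wr_kernel f2 r0|exact: L1_wr_kernel g2 r0|].
by move=> s; case: ifP => // _; rewrite ler_wpM2l ?expR_ge0.
Qed.

Lemma wr_norm f r t : L2_itv T f -> 0 <= r ->
  `|wr f r t| <= wr (fun s => `|f s|) r t.
Proof.
move=> f2 r0; apply: le_trans (Rint_norm (L1_wr_kernel t f2 r0)) _.
rewrite le_eqVlt; apply/orP; left; apply/eqP; apply: eq_Rint_mu => s.
by case: ifP; rewrite ?normr0// normrM ger0_norm ?expR_ge0.
Qed.

Lemma wr_ge0 f r t : (forall s, 0 <= f s) -> 0 <= wr f r t.
Proof.
by move=> f0; apply: Rint_ge0 => s; case: ifP => // _; rewrite mulr_ge0 ?expR_ge0.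
Qed.

Let measurable_k f g : measurable_fun setT f -> measurable_fun setT g ->
  measurable_fun setT (fun z : R * R => E z.2 * (g z.2 * (rho z.1 * wr f z.1 z.2))).
Proof.
move=> mf mg; apply: measurable_funM.
  exact: (measurableT_comp (measurable_expw lambda) measurable_snd).
apply: measurable_funM; first exact: (measurableT_comp mg measurable_snd).
apply: measurable_funM; first exact: (measurableT_comp (measurable_powk _) measurable_fst).
exact: measurable_wr.
Qed.

Let fubini_ge0 g : L2_itv T g -> (forall s, 0 <= g s) ->
  L1 (mu \x mu)%E (fun z => E z.2 * (g z.2 * (rho z.1 * wr g z.1 z.2))).
Proof.
move=> g2 g0; have [mg _ _] := g2.
have [iK _] := resolvent_kernel alpha01 l0.
apply: (@L1_prod_le_mu _ _ (fun r => (\int[mu]_t (E t * g t ^+ 2)) * (rho r / (lambda + r)))).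
- exact: measurable_k.
- exact: L1Z iK.
apply: nearW => r /=; have [r0|r0] := leP r 0.
  rewrite (_ : (fun y => _) = cst 0); last first.
    by apply/funext => t; rewrite rho0// mul0r !mulr0.
  split; first exact: integrable0.
  rewrite (_ : (fun y => _) = cst 0); last first.
    by apply/funext => t; rewrite rho0// mul0r !mulr0 normr0.
  by rewrite Rintegral_cst// rho0// !mul0r mulr0.
have [i1 i2 I] := wr_energy l0 g2 (ltW r0).
have kE t : rho r * (E t * (g t * wr g r t)) = E t * (g t * (rho r * wr g r t)) by ring.
have kE' t : rho r * (E t * (g t * wr g r t)) = `|E t * (g t * (rho r * wr g r t))|.
  rewrite -kE ger0_norm// !mulr_ge0// ?wr_ge0//; exact: ltW (expw_gt0 _ _).
split; first exact: eq_L1_mu kE (L1Z _ i2).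
rewrite -(eq_Rint_mu kE') RintegralZl//.
have := ler_wpM2l (rho_ge0 r) (wr_energy_le l0 g2 (ltW r0)).
by rewrite [X in _ <= X]mulrCA.
Qed.

Lemma L1_wr_prod f : L2_itv T f -> L1 (mu \x mu)%E (fun z =>
  expw lambda z.2 * (f z.2 * (powk (1 - alpha) z.1 * wr f z.1 z.2))).
Proof.
move=> f2; have [mf _ _] := f2.
apply: L1_le (fubini_ge0 (L2_itv_norm f2) (fun s => normr_ge0 (f s))) _.
  exact: measurable_k.
move=> -[r t] /=; rewrite !normrM (ger0_norm (ltW (expw_gt0 _ _))) ler_pM2l ?expw_gt0//.
rewrite ler_wpM2l// (ger0_norm (rho_ge0 r)).
have [r0|r0] := leP r 0; first by rewrite rho0// !mul0r.
by rewrite ler_wpM2l// wr_norm// ltW.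
Qed.

Lemma ae_wr_L1 f : L2_itv T f ->
  {ae mu, forall t, 0 < t < T ->
     L1 mu (fun r => powk (1 - alpha) r * wr (fun s => `|f s|) r t)}.
Proof.
move=> f2; have f2' := L2_itv_norm f2.
(* The indicator makes [g] positive on all of []0, T[], so that the factor [E t * g t] of the Fubini
   integrand can be divided out even where [f] vanishes. *)
pose g s := `|f s| + (if 0 < s < T then 1 else 0).
have g2 : L2_itv T g by apply: L2_itvD => //; exact: L2_itv_ind.
have g0 s : 0 <= g s by rewrite addr_ge0//; case: ifP.
apply: filterS (ae_L1_section2 (fubini_ge0 g2 g0)) => t /= it tT.
have gt0 : 0 < E t * g t.
  by rewrite mulr_gt0 ?expw_gt0// /g tT ltr_wpDl.
apply: L1_le (L1Z (E t * g t)^-1 it) _.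
  apply: measurable_funM; first exact: measurable_powk.
  have [mf' _ _] := f2'; exact: (measurable_section2 t (measurable_wr mf')).
move=> r; rewrite normrM (ger0_norm (rho_ge0 r)) mulrA mulrA.
rewrite -[X in _ <= X * _]mulrA mulVf ?mul1r ?gt_eqF//.
have [r0|r0] := leP r 0; first by rewrite rho0// !mul0r.
rewrite ler_wpM2l// ger0_norm ?wr_ge0//.
by apply: wr_le => //; [exact: ltW|move=> s; rewrite lerDl; case: ifP].
Qed.

(** Fubini in [(r, s)] at a fixed time; the hypothesis supplies the absolute integrability. The
    convergence of the fractional integral at this time is part of the conclusion, since it holds
    only almost everywhere. *)
Lemma wfrac_wr f t : L2_itv T f ->
  L1 mu (fun r => powk (1 - alpha) r * wr (fun s => `|f s|) r t) ->
  [/\ L1 mu (fun s => powk alpha (t - s) * f s),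
      L1 mu (fun r => powk (1 - alpha) r * wr f r t) &
      \int[mu]_r (powk (1 - alpha) r * wr f r t) =
      Gamma (1 - alpha) * wfrac alpha f t].
Proof.
move=> f2 it; have [mf _ _] := f2.
pose k (z : R * R) := rho z.1 *
   (if z.2 < t then expR (- (z.1 * (t - z.2))) * f z.2 else 0).
have mk : measurable_fun setT k.
  apply: measurable_funM; first exact: (measurableT_comp (measurable_powk _) measurable_fst).
  have mt : measurable_fun setT (fun z : R * R => (z.1, t, z.2)).
    apply: (measurable_fun_pair (f := fun z : R * R => (z.1, t)) (g := snd)) => //.
    exact: (measurable_fun_pair (f := fst) (g := cst t)).
  exact: (measurableT_comp (measurable_wr_kernel mf) mt).
have k1 r : L1 mu (fun s => k (r, s)) /\ \int[mu]_s k (r, s) = rho r * wr f r t.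
  rewrite /k/=; have [r0|r0] := leP r 0.
    rewrite (_ : (fun y => _) = cst 0); last first.
      by apply/funext => s; rewrite rho0// mul0r.
    by split; [exact: integrable0|rewrite Rintegral_cst// rho0// !mul0r].
  have i1 := L1_wr_kernel t f2 (ltW r0).
  by split; [exact: L1Z|rewrite RintegralZl].
have ik : L1 (mu \x mu)%E k.
  apply: (@L1_prod_le_mu _ _ (fun r => rho r * wr (fun s => `|f s|) r t)) => //.
  apply: nearW => r /=; split; first exact: (k1 r).1.
  have kE s : `|k (r, s)| = rho r *
     (if s < t then expR (- (r * (t - s))) * `|f s| else 0).
    rewrite /k/= normrM (ger0_norm (rho_ge0 r)); congr (_ * _).
    by case: (s < t); [rewrite normrM (ger0_norm (expR_ge0 _))|rewrite normr0].
  rewrite (eq_Rint_mu kE) {kE}.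
  have [r0|r0] := leP r 0.
    have z s : rho r * (if s < t then expR (- (r * (t - s))) * `|f s| else 0) = 0.
      by rewrite rho0// mul0r.
    by rewrite (eq_Rint_mu z) Rintegral_cst// rho0// !mul0r.
  by rewrite RintegralZl//; exact: L1_wr_kernel (L2_itv_norm f2) (ltW r0).
have k2 s : \int[mu]_r k (r, s) = Gamma (1 - alpha) * (powk alpha (t - s) * f s).
  rewrite /k/=; case: (ltP s t) => st; last first.
    rewrite (_ : (fun y => _) = cst 0); last by apply/funext => r; rewrite mulr0.
    by rewrite Rintegral_cst// mul0r /powk subr_gt0 ltNge st/= mul0r mulr0.
  have ts : 0 < t - s by rewrite subr_gt0.
  have i1 := gamma_L1 b01 ts.
  rewrite (_ : (fun y => _) = (fun r => f s * (powk (1 - alpha) r * expR (- ((t - s) * r))))); last first.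
    by apply/funext => r; rewrite [r * _]mulrC /rho; ring.
  by rewrite RintegralZl// gamma_scale// subKr; ring.
have Gn0 : Gamma (1 - alpha) != 0 by rewrite gt_eqF// Gamma_gt0.
have i2 : L1 mu (fun s => powk alpha (t - s) * f s).
  apply: eq_L1_mu (L1Z (Gamma (1 - alpha))^-1 (L1_Rint1 ik)) => s.
  by rewrite k2 mulrA mulVf// mul1r.
split => //.
  by apply: eq_L1_mu (L1_Rint2 ik) => r; rewrite (k1 r).2.
rewrite /wfrac -RintegralZl// -(eq_Rint_mu k2) -(Rint_swap ik).
by apply: eq_Rint_mu => r; rewrite (k1 r).2.
Qed.

End fractional_kernel.

Section coercivity.
Context {R : realType}.
Implicit Types (r x y s t : R).
Notation mu := (@lebesgue_measure R).

Lemma exp_between r s t : 0 < r -> s < t ->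
  L1 mu (fun y => if (s < y) && (y < t) then expR (- (r * y)) else 0) /\
  \int[mu]_y (if (s < y) && (y < t) then expR (- (r * y)) else 0) =
    (expR (- (r * s)) - expR (- (r * t))) / r.
Proof.
move=> r0 st; have [i1 I1] := exp_tail s r0; have [i2 I2] := exp_tail t r0.
have ms : measurable_fun setT (fun y => if (s < y) && (y < t) then expR (- (r * y)) else 0).
  by apply: measurable_fun_ifT => //; [exact: measurable_itvoo|exact: measurable_expM].
have E : {ae mu, forall y : R, (if s < y then expR (- (r * y)) else 0) -
    (if t < y then expR (- (r * y)) else 0) =
    (if (s < y) && (y < t) then expR (- (r * y)) else 0)}.
  exists [set t]; split => //; first exact: lebesgue_measure_set1.
  move=> y /= ny; apply: contrapT => /eqP yt; apply: ny.
  case: (ltgtP y t) yt => // [yt _|ty _]; first by rewrite subr0 andbT.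
  by rewrite (lt_trans st ty) subrr.
split; first exact: ae_L1_mu ms E (L1B i1 i2).
rewrite -(ae_Rint_mu (L1B i1 i2) ms E) RintegralB// I1 I2; ring.
Qed.

Variables (T lambda alpha : R).
Hypotheses (T0 : 0 < T) (l0 : 0 < lambda) (alpha01 : 0 < alpha < 1).
Variables (f : R -> R) (f2 : L2_itv T f).

Let b01 : 0 < 1 - alpha <= 1.
Proof. by case/andP: alpha01 => h1 h2; rewrite subr_gt0 h2 gerBl ltW. Qed.

Let mf : measurable_fun setT f. Proof. by case: f2. Qed.

Let sf : supp_itv T f. Proof. by case: f2. Qed.

Let rho_ge0 r : 0 <= powk (1 - alpha) r. Proof. exact: powk_ge0. Qed.

Let rho0 r : r <= 0 -> powk (1 - alpha) r = 0.
Proof. by rewrite /powk leNgt => /negbTE ->. Qed.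

Let G r := \int[mu]_t (expw lambda t * (f t * wr f r t)).

Lemma frac_energy :
  [/\ L1 mu (fun t => expw lambda t * (f t * wfrac alpha f t)),
      L1 mu (fun r => powk (1 - alpha) r * G r) &
      \int[mu]_r (powk (1 - alpha) r * G r) = Gamma (1 - alpha) *
        \int[mu]_t (expw lambda t * (f t * wfrac alpha f t))].
Proof.
have ik := L1_wr_prod l0 alpha01 f2.
pose k (z : R * R) := expw lambda z.2 * (f z.2 * (powk (1 - alpha) z.1 * wr f z.1 z.2)).
have k1 r : \int[mu]_t k (r, t) = powk (1 - alpha) r * G r.
  have [r0|r0] := leP r 0.
    have kz t : k (r, t) = 0 by rewrite /k/= rho0// mul0r !mulr0.
    by rewrite (Rint_eq0_mu kz) (rho0 r0) mul0r.
  have [_ i2 _] := wr_energy l0 f2 (ltW r0).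
  rewrite /G -RintegralZl//; apply: eq_Rint_mu => t; rewrite /k/=; ring.
have mw := measurable_wfrac alpha mf.
have mE := measurable_expw lambda.
have m1 : measurable_fun setT (fun t => Gamma (1 - alpha) * (expw lambda t * (f t * wfrac alpha f t))).
  by do 3 (apply: measurable_funM => //).
have k2 : {ae mu, forall t, \int[mu]_r k (r, t) =
    Gamma (1 - alpha) * (expw lambda t * (f t * wfrac alpha f t))}.
  apply: ae_imp_mu (ae_wr_L1 T0 l0 alpha01 f2) => t it.
  have [tT|/sf ft0] := boolP (0 < t < T); last first.
    have kz r : k (r, t) = 0 by rewrite /k/= ft0 mul0r !mulr0.
    by rewrite (Rint_eq0_mu kz) ft0 mul0r !mulr0.
  have [_ i2 I2] := wfrac_wr alpha01 f2 (it tT).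
  have -> : Gamma (1 - alpha) * (expw lambda t * (f t * wfrac alpha f t)) =
    expw lambda t * f t * (Gamma (1 - alpha) * wfrac alpha f t) by ring.
  rewrite -I2 -RintegralZl//.
  apply: eq_Rint_mu => r; rewrite /k/=; ring.
have Gn0 : Gamma (1 - alpha) != 0 by rewrite gt_eqF// Gamma_gt0.
have i1 := ae_L1_mu m1 k2 (L1_Rint1 ik).
have i2 : L1 mu (fun t => expw lambda t * (f t * wfrac alpha f t)).
  apply: eq_L1_mu (L1Z (Gamma (1 - alpha))^-1 i1) => t.
  by rewrite mulrA mulVf// mul1r.
split => //; first exact: eq_L1_mu k1 (L1_Rint2 ik).
rewrite -RintegralZl// -(eq_Rint_mu k1).
exact: etrans (Rint_swap ik) (ae_Rint_mu (L1_Rint1 ik) m1 k2).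
Qed.

(** Cauchy-Schwarz in [r]: the square of the integral of [rho * wr] is at most the integral [K] of
    [rho / (lambda + r)] times that of [rho * (lambda + r) * wr^2]. After weighting and integration
    in time, the second factor is the energy of [frac_energy], by [wr_energy], and [K] is evaluated
    by [resolvent_kernel]. *)
Lemma frac_coercive :
  L1 mu (fun t => if 0 < t < T then expw lambda t * wfrac alpha f t ^+ 2 else 0) /\
  \int[mu]_t (if 0 < t < T then expw lambda t * wfrac alpha f t ^+ 2 else 0) <=
  Gamma alpha * powk (1 - alpha) lambda *
    \int[mu]_t (expw lambda t * (f t * wfrac alpha f t)).
Proof.
have [ifw iG IG] := frac_energy.
have [iK IK] := resolvent_kernel alpha01 l0.
set K := Rintegral _ _ _ in IK.
have G1 : 0 < Gamma (1 - alpha) by rewrite Gamma_gt0.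
have G2 : 0 < Gamma alpha.
  by case/andP: alpha01 => h1 h2; rewrite Gamma_gt0// h1 ltW.
have K0 : 0 < K.
  by rewrite IK; apply: mulr_gt0; [exact: mulr_gt0|rewrite /powk l0 powR_gt0].
pose k (z : R * R) := powk (1 - alpha) z.1 * ((lambda + z.1) *
  (expw lambda z.2 * wr f z.1 z.2 ^+ 2)).
have mk : measurable_fun setT k.
  apply: measurable_funM; first exact: (measurableT_comp (measurable_powk _) measurable_fst).
  apply: measurable_funM; first by apply: measurable_funD.
  apply: measurable_funM; first exact: (measurableT_comp (measurable_expw lambda) measurable_snd).
  by apply: measurable_funX; exact: measurable_wr.
have k_ge0 z : 0 <= k z.
  rewrite /k; have [z0|z0] := leP z.1 0; first by rewrite rho0// mul0r.
  apply: mulr_ge0 => //; apply: mulr_ge0; first by rewrite addr_ge0// ltW.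
  by apply: mulr_ge0; [exact: ltW (expw_gt0 _ _)|exact: sqr_ge0].
have k1 r : L1 mu (fun t => k (r, t)) /\ \int[mu]_t k (r, t) = powk (1 - alpha) r * G r.
  have [r0|r0] := leP r 0.
    have kz t : k (r, t) = 0 by rewrite /k/= rho0// mul0r.
    by split; [exact: L1_eq0_mu kz|rewrite (Rint_eq0_mu kz) (rho0 r0) mul0r].
  have [i1 _ I] := wr_energy l0 f2 (ltW r0).
  have i1' := L1Z (powk (1 - alpha) r) (L1Z (lambda + r) i1).
  split; first exact: i1'.
  by rewrite /G I -RintegralZl// -RintegralZl//; exact: L1Z.
have iG' : L1 mu (fun r => powk (1 - alpha) r * G r) := iG.
have ik : L1 (mu \x mu)%E k.
  apply: (L1_prod_le_mu mk iG').
  apply: nearW => r; split; first exact: (k1 r).1.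
  have kn t : `|k (r, t)| = k (r, t) by rewrite ger0_norm.
  by rewrite (eq_Rint_mu kn) (k1 r).2.
have i2 := L1_Rint1 ik.
have mw := measurable_wfrac alpha mf.
have mE := measurable_expw lambda.
pose W t := if 0 < t < T then expw lambda t * wfrac alpha f t ^+ 2 else 0.
have mW : measurable_fun setT W.
  apply: measurable_fun_ifT => //; first exact: measurable_itvoo.
  by apply: measurable_funM => //; exact: measurable_funX.
have W_ge0 t : 0 <= W t.
  by rewrite /W; case: ifP => // _; apply: mulr_ge0; [exact: ltW (expw_gt0 _ _)|exact: sqr_ge0].
have le_ae : {ae mu, forall t, W t <= K / Gamma (1 - alpha) ^+ 2 * \int[mu]_r k (r, t)}.
  apply: ae_imp_mu (ae_and_mu (ae_wr_L1 T0 l0 alpha01 f2) (ae_L1_section2 ik)).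
  move=> t [it ikt]; rewrite /W; case: ifPn => tT; last first.
    by rewrite mulr_ge0 ?divr_ge0 ?sqr_ge0 ?(ltW K0)// Rint_ge0.
  have [_ i3 I3] := wfrac_wr alpha01 f2 (it tT).
  set J := Rintegral _ _ _; set w := wfrac _ _ _ in I3 *.
  have key x : 2 * x * (Gamma (1 - alpha) * w) <= x ^+ 2 * K + (expw lambda t)^-1 * J.
    rewrite -I3 /K /J -!RintegralZl// -RintegralD//; [|exact: L1Z|exact: L1Z].
    apply: Rint_le; [exact: L1Z|by apply: L1D; exact: L1Z|move=> r].
    rewrite /k/=; have [r0|r0] := leP r 0; first by rewrite rho0// !mul0r !mulr0 addr0.
    have lr : 0 < lambda + r by rewrite addr_gt0.
    have -> : x ^+ 2 * (powk (1 - alpha) r / (lambda + r)) + (expw lambda t)^-1 *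
      (powk (1 - alpha) r * ((lambda + r) * (expw lambda t * wr f r t ^+ 2))) =
      2 * x * (powk (1 - alpha) r * wr f r t) +
      powk (1 - alpha) r * (lambda + r) * (x / (lambda + r) - wr f r t) ^+ 2.
      by field; rewrite !gt_eqF// expw_gt0.
    rewrite lerDl; apply: mulr_ge0; last exact: sqr_ge0.
    by apply: mulr_ge0 => //; exact: ltW.
  have E0 := expw_gt0 lambda t.
  (* The value of [x] that optimizes [key] and gives back the product form of Cauchy-Schwarz. *)
  have := key (Gamma (1 - alpha) * w / K).
  have -> : 2 * (Gamma (1 - alpha) * w / K) * (Gamma (1 - alpha) * w) =
    2 * (Gamma (1 - alpha) ^+ 2 * w ^+ 2 / K) by ring.
  have -> : (Gamma (1 - alpha) * w / K) ^+ 2 * K = Gamma (1 - alpha) ^+ 2 * w ^+ 2 / K.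
    by field; rewrite gt_eqF.
  rewrite mulr_natl mulr2n lerD2l => h.
  have -> : expw lambda t * w ^+ 2 = K / Gamma (1 - alpha) ^+ 2 * (expw lambda t *
     (Gamma (1 - alpha) ^+ 2 * w ^+ 2 / K)) by field; rewrite !gt_eqF.
  rewrite ler_wpM2l ?divr_ge0 ?sqr_ge0 ?(ltW K0)//.
  by rewrite mulrC -ler_pdivlMr// [X in _ <= X]mulrC.
have iW : L1 mu W.
  apply: (ae_L1_le_mu mW (L1Z (K / Gamma (1 - alpha) ^+ 2) i2)).
  by apply: ae_imp_mu le_ae => t; rewrite ger0_norm.
split => //; apply: le_trans (ae_Rint_le_mu iW (L1Z _ i2) le_ae) _.
rewrite RintegralZl// -(Rint_swap ik) (eq_Rint_mu (fun r => (k1 r).2)) IG IK.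
rewrite le_eqVlt; apply/orP; left; apply/eqP; field.
by rewrite gt_eqF.
Qed.

End coercivity.

Section primitive_coercivity.
Context {R : realType}.
Implicit Types (r x y s t : R).
Notation mu := (@lebesgue_measure R).
Variables (T lambda alpha : R).
Hypotheses (T0 : 0 < T) (l1 : 1 <= lambda) (alpha01 : 0 < alpha < 1).
Variables (f : R -> R) (f2 : L2_itv T f).

Let l0 : 0 < lambda. Proof. exact: lt_le_trans ltr01 l1. Qed.

Let mf : measurable_fun setT f. Proof. by case: f2. Qed.

Let sf : supp_itv T f. Proof. by case: f2. Qed.

Let f0 s : s <= 0 -> f s = 0.
Proof. by move=> s0; rewrite sf// negb_and -leNgt s0. Qed.

Lemma wr_eq0 r t : t <= 0 -> wr f r t = 0.
Proof.
move=> t0; apply: Rint_eq0_mu => s; case: ltP => // st.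
by rewrite f0 ?mulr0// (le_trans (ltW st)).
Qed.

Lemma measurable_wr1 r : measurable_fun setT (wr f r).
Proof. exact: (measurable_section1 r (measurable_wr mf)). Qed.

(** The integrated form of the equation [wr' + r wr = f] with zero initial value. It is obtained by
    Fubini, integrating the exponential kernel over [s < y < t], as [f] is only square
    integrable. *)
Lemma prim_wr r t : 0 < r -> 0 < t ->
  L1 mu (fun y => if y < t then wr f r y else 0) ->
  prim f t = wr f r t + r * prim (wr f r) t.
Proof.
move=> r0 t0 iw; have if1 := L2_itv_integrable f2.
pose k (z : R * R) := (if z.1 < t then 1 else 0) *
  (if z.2 < z.1 then expR (- (r * (z.1 - z.2))) * f z.2 else 0).
have m1 : measurable_fun setT (fun y => if y < t then 1 else 0 : R).
  by apply: measurable_fun_ifT => //; exact: measurable_fun_ltr.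
have mk : measurable_fun setT k.
  apply: measurable_funM; first exact: (measurableT_comp m1 measurable_fst).
  have mt : measurable_fun setT (fun z : R * R => (r, z.1, z.2)).
    apply: (measurable_fun_pair (f := fun z : R * R => (r, z.1)) (g := snd)) => //.
    exact: (measurable_fun_pair (f := cst r) (g := fst)).
  exact: (measurableT_comp (measurable_wr_kernel mf) mt).
have [i1 _] := ind_itv (ltW t0).
have ik : L1 (mu \x mu)%E k.
  apply: L1_le (L1_prodM i1 (L1_norm if1)) _; first exact: mk.
  move=> [y s] /=; rewrite /k/=; case: (ltP s y) => sy; last first.
    by rewrite mulr0 normr0 mulr_ge0//; case: ifP.
  have [s0|s0] := leP s 0; first by rewrite f0// !mulr0 !normr0 mulr0.
  rewrite (lt_trans s0 sy)/= !normrM; case: (ltP y t) => yt; last by rewrite normr0 !mul0r.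
  rewrite normr1 !mul1r ler_piMl// ger0_norm ?expR_ge0// -expR0 ler_expR.
  by rewrite oppr_le0 mulr_ge0 ?subr_ge0 ?ltW.
have k1 y : \int[mu]_s k (y, s) = (if y < t then wr f r y else 0).
  rewrite /k/= RintegralZl//; last exact: L1_wr_kernel f2 (ltW r0).
  by case: ifP => _; rewrite ?mul1r ?mul0r.
have k2 s : r * \int[mu]_y k (y, s) =
    (if s < t then f s else 0) - (if s < t then expR (- (r * (t - s))) * f s else 0).
  case: (ltP s t) => st; last first.
    rewrite (Rint_eq0_mu (f := fun y => k (y, s))) ?mulr0 ?subrr//.
    move=> y; rewrite /k/=; case: (ltP s y) => sy; last by rewrite mulr0.
    by rewrite ltNge (le_trans st (ltW sy)) mul0r.
  have [ib Ib] := exp_between r0 st.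
  have kE y : (expR (r * s) * f s) *
      (if (s < y) && (y < t) then expR (- (r * y)) else 0) = k (y, s).
    rewrite /k/=; case: (s < y); case: (y < t); rewrite ?mulr0 ?mul0r ?mul1r//=.
    by rewrite mulrAC -expRD; congr (expR _ * _); ring.
  rewrite -(eq_Rint_mu kE) RintegralZl// Ib.
  have -> : expR (- (r * (t - s))) = expR (r * s) * expR (- (r * t)).
    by rewrite -expRD; congr expR; ring.
  rewrite -[X in _ = X - _]mul1r -(expRxMexpNx_1 (r * s)).
  by field; rewrite gt_eqF.
have e : r * prim (wr f r) t = r * \int[mu]_y \int[mu]_s k (y, s).
  by congr (_ * _); apply: eq_Rint_mu => y; rewrite k1.
rewrite e (Rint_swap ik) -RintegralZl//; last exact: L1_Rint1.
rewrite (eq_Rint_mu k2) RintegralB//; last 2 first.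
- exact: L1_iflt.
- exact: L1_wr_kernel f2 (ltW r0).
by rewrite -/(prim f t) -/(wr f r t) addrC subrK.
Qed.

Lemma prim_le_wr r : 0 < r < 1 ->
  L1 mu (fun t => if 0 < t < T then expw lambda t * prim f t ^+ 2 else 0) /\
  \int[mu]_t (if 0 < t < T then expw lambda t * prim f t ^+ 2 else 0) <=
    (2 + T) * \int[mu]_t (expw lambda t * wr f r t ^+ 2).
Proof.
move=> /andP[r0 r1].
have [iw _ _] := wr_energy l0 f2 (ltW r0).
have ll0 : 0 < 2 * lambda by rewrite mulr_gt0.
have wsq0 s : s <= 0 -> wr f r s ^+ 2 = 0 by move=> s0; rewrite wr_eq0// expr0n.
have [iv1 iv2 Iv] : [/\ forall t, L1 mu (fun s => if s < t then wr f r s ^+ 2 else 0),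
    L1 mu (fun t => expw lambda t * prim (fun s => wr f r s ^+ 2) t) &
    \int[mu]_t (expw lambda t * prim (fun s => wr f r s ^+ 2) t) =
    (2 * lambda)^-1 * \int[mu]_t (expw lambda t * wr f r t ^+ 2)].
  exact: volterra_weight ll0 wsq0 iw.
have mw := measurable_wr1 r.
have mp := measurable_prim mf.
have mE := measurable_expw lambda.
(* Square [prim_wr] and apply Cauchy-Schwarz on []0, t[]; the condition [r < 1] removes the factor
   [r^2], so that the constants do not depend on [r]. *)
have key t : 0 < t < T ->
    prim f t ^+ 2 <= 2 * wr f r t ^+ 2 + 2 * T * prim (fun s => wr f r s ^+ 2) t.
  move=> /andP[t0 tT].
  pose v s := if s < t then wr f r s else 0.
  have mv : measurable_fun setT v.
    by apply: measurable_fun_ifT => //; exact: measurable_fun_ltr.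
  have v0 s : ~~ (0 < s < t) -> v s = 0.
    rewrite negb_and -!leNgt /v => /orP[s0|ts]; first by rewrite wr_eq0// if_same.
    by rewrite ltNge ts.
  have v2 s : (if s < t then wr f r s ^+ 2 else 0) = v s ^+ 2.
    by rewrite /v; case: ifP => //; rewrite expr0n.
  have iv : L1 mu (fun s => v s ^+ 2) := eq_L1_mu v2 (iv1 t).
  have cs := cauchy_schwarz_itv t0 mv v0 iv.
  rewrite -(eq_Rint_mu v2) -/(prim (fun s => wr f r s ^+ 2) t) -/(prim (wr f r) t) in cs.
  rewrite (prim_wr r0 t0 (L2_itv_L1 mv v0 iv)).
  set A := wr f r t in cs *; set B := prim _ _ in cs *; set C := prim _ _ in cs *.
  have C0 : 0 <= C by apply: Rint_ge0 => s; case: ifP => // _; exact: sqr_ge0.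
  have h1 : (r * B) ^+ 2 <= T * C.
    apply: (@le_trans _ _ (B ^+ 2)).
      by rewrite exprMn ler_piMl ?sqr_ge0// expr_le1// ltW.
    by apply: le_trans cs _; rewrite ler_wpM2r// ltW.
  have := sqr_ge0 (A - r * B); move: h1; set D := r * B; nra.
pose W t := if 0 < t < T then expw lambda t * prim f t ^+ 2 else 0.
have mW : measurable_fun setT W.
  apply: measurable_fun_ifT => //; first exact: measurable_itvoo.
  by apply: measurable_funM => //; exact: measurable_funX.
pose g t := 2 * (expw lambda t * wr f r t ^+ 2) +
  2 * T * (expw lambda t * prim (fun s => wr f r s ^+ 2) t).
have ig : L1 mu g by apply: L1D; exact: L1Z.
have W0 t : 0 <= W t.
  rewrite /W; case: ifP => // _.
  by apply: mulr_ge0; [exact: ltW (expw_gt0 _ _)|exact: sqr_ge0].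
have P0 t : 0 <= prim (fun s => wr f r s ^+ 2) t.
  by apply: Rint_ge0 => s; case: ifP => // _; exact: sqr_ge0.
have Wg t : W t <= g t.
  have E0 := expw_gt0 lambda t.
  have gE : g t = expw lambda t * (2 * wr f r t ^+ 2 + 2 * T * prim (fun s => wr f r s ^+ 2) t).
    by rewrite /g; ring.
  rewrite gE /W; case: ifPn => tT; first by rewrite ler_wpM2l ?(ltW E0)// key.
  apply: mulr_ge0; first exact: ltW.
  by apply: addr_ge0; apply: mulr_ge0 => //; [exact: sqr_ge0|rewrite mulr_ge0// ltW].
have iW : L1 mu W by apply: L1_le_mu mW ig _ => t; rewrite ger0_norm.
split => //; apply: le_trans (Rint_le_mu iW ig Wg) _.
rewrite RintegralD//; [|exact: L1Z|exact: L1Z].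
rewrite !RintegralZl// Iv.
set J := Rintegral _ _ _.
have J0 : 0 <= J.
  by apply: Rint_ge0 => t; apply: mulr_ge0; [exact: ltW (expw_gt0 _ _)|exact: sqr_ge0].
rewrite [leRHS]mulrDl lerD2l mulrA ler_wpM2r// ler_pdivrMr//.
(* The hypothesis [1 <= lambda] enters here, through [2 * T / (2 * lambda) <= T]. *)
by move: T0 l1; nra.
Qed.

(** The exponentials with [0 < r < 1] suffice: there the density is at least 1 and the energy
    [(lambda + r) A] at least [lambda A], which [prim_le_wr] compares with the primitive. All other
    [r] contribute nonnegative amounts. The unit length of the interval yields the rate [lambda]
    itself. *)
Lemma prim_coercive :
  L1 mu (fun t => if 0 < t < T then expw lambda t * prim f t ^+ 2 else 0) /\
  \int[mu]_t (if 0 < t < T then expw lambda t * prim f t ^+ 2 else 0) <=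
  (2 + T) * Gamma (1 - alpha) / lambda *
    \int[mu]_t (expw lambda t * (f t * wfrac alpha f t)).
Proof.
have [ifw iG IG] := frac_energy T0 l0 alpha01 f2.
(* Any value between 0 and 1 serves: only the integrability of the left-hand side, which does not
   involve [r], is taken from [prim_le_wr]. *)
have h01 : 0 < (2^-1 : R) < 1 by lra.
have [iW _] := prim_le_wr h01; split => //.
set N := Rintegral _ _ _.
have T2 : 0 < 2 + T by rewrite addr_gt0.
have [i1 I1] := ind_itv (@ler01 R).
suff : lambda / (2 + T) * N <= Gamma (1 - alpha) *
    \int[mu]_t (expw lambda t * (f t * wfrac alpha f t)).
  set B := Rintegral _ _ _ => h.
  have -> : (2 + T) * Gamma (1 - alpha) / lambda * B =
    (2 + T) / lambda * (Gamma (1 - alpha) * B) by ring.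
  have -> : N = (2 + T) / lambda * (lambda / (2 + T) * N).
    by field; rewrite !gt_eqF.
  by rewrite ler_wpM2l// divr_ge0// ltW.
rewrite -IG -[leLHS]mulr1 -{2}I1 -RintegralZl//.
apply: Rint_le => [||r]; [exact: L1Z|exact: iG|].
case: ifPn => [r01|_].
  have /andP[r0 r1] := r01.
  have [_ i2 I2] := wr_energy l0 f2 (ltW r0).
  have [_ le] := prim_le_wr r01.
  set J := Rintegral _ _ _ in I2 *; rewrite mulr1.
  set A := \int[mu]_t (expw lambda t * wr f r t ^+ 2) in le I2.
  have A0 : 0 <= A.
    by apply: Rint_ge0 => t; apply: mulr_ge0; [exact: ltW (expw_gt0 _ _)|exact: sqr_ge0].
  apply: (@le_trans _ _ (lambda * A)).
    by rewrite mulrAC ler_pdivrMr// -mulrA ler_pM2l// mulrC.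
  have J1 : lambda * A <= J by rewrite I2 ler_wpM2r// lerDl ltW.
  apply: le_trans J1 _; rewrite ler_peMl//.
    by rewrite I2 mulr_ge0// addr_ge0// ltW.
  rewrite /powk r0 -(powRr0 r) ger_powR ?r0 ?ltW//.
  by case/andP: alpha01 => h _; lra.
rewrite mulr0 /powk; case: ifPn => r0; last by rewrite mul0r.
have [_ i2 I2] := wr_energy l0 f2 (ltW r0).
apply: mulr_ge0; first exact: powR_ge0.
rewrite I2; apply: mulr_ge0; first by rewrite addr_ge0// ltW.
by apply: Rint_ge0 => t; apply: mulr_ge0; [exact: ltW (expw_gt0 _ _)|exact: sqr_ge0].
Qed.

End primitive_coercivity.

(** * Functions whose primitive vanishes almost everywhere *)

Section primitive_zero.
Context {R : realType}.
Implicit Types (f : R -> R) (r x y s t T : R).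
Notation mu := (@lebesgue_measure R).

Lemma itv_not_null (a b : R) (N : set R) : a < b -> measurable N ->
  mu N = 0%E -> ~ (`]a, b[%classic `<=` N).
Proof.
move=> ab mN N0 sub; have : (mu `]a, b[ <= mu N)%E.
  by apply: le_measure; rewrite ?inE//; exact: measurable_itv.
rewrite N0 lebesgue_measure_itv/= lte_fin ab -EFinB lee_fin.
by apply/negP; rewrite -ltNge subr_gt0.
Qed.

(** At almost every [x] the primitive is differentiable with derivative [f x], and it vanishes at
    [x]. If [f x] were nonzero, the primitive would be nonzero on an interval to the right of [x],
    which would then lie in a null set. *)
Lemma prim_ae0 f T : L1 mu f -> (forall s, ~~ (0 < s < T) -> f s = 0) ->
  {ae mu, forall t : R, 0 < t < T -> prim f t = 0} -> {ae mu, forall t : R, f t = 0}.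
Proof.
move=> fi sf [N [mN N0 sN]].
have iA A : measurable A -> mu.-integrable A (EFin \o f).
  by move=> mA; apply: integrableS fi.
have FTC : {ae mu, forall x : R, derivable (fun x => \int[mu]_(t in `]-oo, x]) f t) x 1 /\
    derive1 (fun x => \int[mu]_(t in `]-oo, x]) f t) x = f x}.
  apply: FTC1Ny; first by move=> y; apply: iA; exact: measurable_itv.
  by apply: open_integrable_locally; [exact: openT|exact: fi].
have FE : (fun x => \int[mu]_(t in `]-oo, x]) f t) = prim f.
  apply/funext => x; rewrite -Rintegral_itv_bndo_bndc; last by apply: iA; exact: measurable_itv.
  rewrite Rint_if; apply: eq_Rint_mu => s.
  by rewrite mem_setE/= in_itv.
rewrite FE in FTC.
have aN : {ae mu, forall x : R, ~ N x}.
  by exists N; split => // x /contrapT.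
apply: ae_imp_mu (ae_and_mu FTC aN) => x [[dF Fx] Nx].
have [xT|/sf//] := boolP (0 < x < T).
have Px : prim f x = 0 by apply: contrapT => P0; apply: Nx; apply: sN => /(_ xT).
apply: contrapT => /eqP fx0.
have /cvg_ex[l cl] := dF.
have lf : l = f x.
  by rewrite -Fx derive1E; apply/esym/cvg_lim => //; exact: cl.
have l0 : 0 < `|l| by rewrite normr_gt0 lf.
(* With tolerance [|l|] the difference quotient cannot be 0. *)
move/cvgrPdist_lt : cl => /(_ _ l0) [e /= e0 he].
have /andP[x0 xT'] := xT.
(* The interval is cut at [T], as the primitive is known to vanish almost everywhere only inside
   []0, T[]. *)
apply: (@itv_not_null x (Num.min (x + e) T) N) => //.
  by rewrite lt_min ltrDl e0.
move=> y; rewrite /= in_itv/= lt_min => /and3P[xy ye yT].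
apply: sN => h0; have {h0}Py := h0 (introT andP (conj (lt_trans x0 xy) yT)).
have := he (y - x); rewrite /ball_/= sub0r normrN gtr0_norm ?subr_gt0// ltrBlDl.
move=> /(_ ye); rewrite subr_eq0 gt_eqF// => /(_ isT).
by rewrite /= scaler1 subrK Py Px subrr scaler0 subr0 ltxx.
Qed.

End primitive_zero.

(** * Lower-order operators and the energy bound at one point of space *)

Section lower_order.
Context {R : realType}.
Implicit Types (f v psi dpsi : R -> R) (r x y s t T K lambda : R).
Notation mu := (@lebesgue_measure R).

(** The operator [B^mu_psi] at one point of space, with [v] standing for the fractional integral;
    both orders, [alpha] and 1, are covered by the choice of [v]. *)
Definition bop psi dpsi v t : R := psi t * v t - prim (fun s => dpsi s * v s) t.

Lemma L1_bdM dpsi v K : measurable_fun setT dpsi ->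
  {ae mu, forall s : R, `|dpsi s| <= K} -> L1 mu v ->
  L1 mu (fun s => dpsi s * v s).
Proof.
move=> md bd iv; apply: ae_L1_le_mu (L1Z K (L1_norm iv)) _.
  by apply: measurable_funM => //; exact: L1_measurable iv.
by apply: ae_imp_mu bd => s bds; rewrite normrM ler_wpM2r.
Qed.

Lemma bopB psi dpsi v1 v2 K t : measurable_fun setT dpsi ->
  {ae mu, forall s : R, `|dpsi s| <= K} -> L1 mu v1 -> L1 mu v2 ->
  bop psi dpsi v1 t - bop psi dpsi v2 t = bop psi dpsi (fun s => v1 s - v2 s) t.
Proof.
move=> md bd i1 i2.
have j1 := L1_iflt t (L1_bdM md bd i1); have j2 := L1_iflt t (L1_bdM md bd i2).
have E s : (if s < t then dpsi s * v1 s else 0) - (if s < t then dpsi s * v2 s else 0) =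
    (if s < t then dpsi s * (v1 s - v2 s) else 0).
  by case: ifP => _; rewrite ?subrr// mulrBr.
rewrite /bop -[X in _ = _ - X](eq_Rint_mu E) RintegralB//.
rewrite -/(prim (fun s => dpsi s * v1 s) t) -/(prim (fun s => dpsi s * v2 s) t); ring.
Qed.

Lemma bop_sqr_le psi dpsi v K T t : 0 < t < T -> measurable_fun setT dpsi ->
  {ae mu, forall s : R, `|dpsi s| <= K} -> `|psi t| <= K -> L2_itv T v ->
  bop psi dpsi v t ^+ 2 <=
    2 * K ^+ 2 * (v t ^+ 2 + T * prim (fun s => v s ^+ 2) t).
Proof.
move=> /andP[t0 tT] md bd bp v2; have [mv sv iv2] := v2.
have K0 : 0 <= K by exact: le_trans bp.
have iv := L2_itv_integrable v2.
have idv := L1_bdM md bd iv.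
pose q s := if s < t then v s else 0.
have mq : measurable_fun setT q.
  by apply: measurable_fun_ifT => //; exact: measurable_fun_ltr.
have q0 s : ~~ (0 < s < t) -> q s = 0.
  rewrite /q => ns; case: ifP => // st; apply: sv.
  by apply: contra ns => /andP[-> _].
have qE s : (if s < t then v s ^+ 2 else 0) = q s ^+ 2.
  by rewrite /q; case: ifP => //; rewrite expr0n.
have iq : L1 mu (fun s => q s ^+ 2) := eq_L1_mu qE (L1_iflt t iv2).
have q1 := L2_itv_L1 mq q0 iq.
have nq2 s : `|q s| ^+ 2 = q s ^+ 2 by rewrite -normrX ger0_norm ?sqr_ge0.
have cs : (\int[mu]_s `|q s|) ^+ 2 <= t * \int[mu]_s (q s ^+ 2).
  rewrite -(eq_Rint_mu nq2); apply: cauchy_schwarz_itv => //.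
  - exact: measurableT_comp.
  - by move=> s /q0 ->; rewrite normr0.
  - by apply: eq_L1_mu iq => s; rewrite nq2.
rewrite -(eq_Rint_mu qE) -/(prim (fun s => v s ^+ 2) t) in cs.
have h1 : `|prim (fun s => dpsi s * v s) t| <= K * \int[mu]_s `|q s|.
  apply: le_trans (Rint_norm (L1_iflt t idv)) _; rewrite -RintegralZl//; last exact: L1_norm.
  apply: ae_Rint_le_mu; [exact: L1_norm (L1_iflt t idv)|exact: L1Z (L1_norm q1)|].
  apply: ae_imp_mu bd => s bds; rewrite /q; case: ifP => _; last by rewrite normr0 mulr0.
  by rewrite normrM ler_wpM2r.
rewrite /bop; set A := prim _ _ in h1 *; set B := Rintegral _ _ _ in cs h1.
set C := prim _ _ in cs *.
have B0 : 0 <= B by apply: Rint_ge0.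
have C0 : 0 <= C by apply: Rint_ge0 => s; case: ifP => // _; exact: sqr_ge0.
have h2 : A ^+ 2 <= K ^+ 2 * (T * C).
  apply: (@le_trans _ _ ((K * B) ^+ 2)).
    by rewrite -[A ^+ 2]ger0_norm ?sqr_ge0// normrX lerXn2r ?nnegrE// mulr_ge0.
  rewrite exprMn ler_wpM2l ?sqr_ge0//; apply: le_trans cs _.
  by rewrite ler_wpM2r// ltW.
have h3 : (psi t * v t) ^+ 2 <= K ^+ 2 * v t ^+ 2.
  rewrite exprMn ler_wpM2r ?sqr_ge0//.
  by rewrite -[psi t ^+ 2]ger0_norm ?sqr_ge0// normrX lerXn2r ?nnegrE.
have := sqr_ge0 (psi t * v t + A).
by move: h2 h3; set D := psi t * v t; set KK := K ^+ 2; nra.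
Qed.

End lower_order.

Section energy_bound.
Context {R : realType}.
Implicit Types (f v : R -> R) (r x y s t K lambda C : R).
Notation mu := (@lebesgue_measure R).
Variables (T alpha : R).
Hypotheses (T0 : 0 < T) (alpha01 : 0 < alpha < 1).

(** With [c = (Gamma 1)^-1] this is the fractional integral of order 1, [v0] in the overview;
    [Gamma 1] is carried along unevaluated. The cut-off at [T] is needed for [L2_itv], since the
    primitive is constant from [T] on. *)
Definition prim_itv c f t : R := if 0 < t < T then c * prim f t else 0.

Lemma L2_prim_itv c f : L2_itv T f -> L2_itv T (prim_itv c f).
Proof.
move=> f2; have if1 := L2_itv_integrable f2.
have mp : measurable_fun setT (prim_itv c f).
  apply: measurable_fun_ifT => //; first exact: measurable_itvoo.
  by apply: measurable_funM => //; exact: measurable_prim (L1_measurable if1).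
have [i1 _] := ind_itv (ltW T0).
split => //; first by move=> s ns; rewrite /prim_itv (negbTE ns).
apply: L1_le_mu (L1Z (c ^+ 2 * (\int[mu]_s `|f s|) ^+ 2) i1) _.
  exact: measurable_funX.
move=> t; rewrite ger0_norm ?sqr_ge0// /prim_itv; case: ifP => _; last first.
  by rewrite expr0n mulr0.
rewrite mulr1 exprMn ler_wpM2l ?sqr_ge0//.
rewrite -[X in X <= _]ger0_norm ?sqr_ge0// normrX lerXn2r ?nnegrE//.
  exact: Rint_ge0.
exact: prim_le.
Qed.

Lemma large_lambda C c : 0 <= C -> 0 <= c -> exists2 lambda, 1 <= lambda &
  2 * C * (powk (1 - alpha) lambda + c / lambda) <= 2^-1.
Proof.
move=> C0 c0; have /andP[a0 a1] := alpha01.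
(* The first summand ensures [l^alpha >= 8 C + 1] and the second [l >= 8 C c + 1], so that each of
   the two terms to be bounded is at most 1/4; the last 1 gives [l >= 1]. *)
pose l := (8 * C + 1) `^ alpha^-1 + (8 * C * c + 1).
have Cc0 : 0 <= 8 * C * c by rewrite !mulr_ge0.
have C80 : 0 <= 8 * C by rewrite mulr_ge0.
have l1 : 1 <= l by rewrite /l addrA lerDr addr_ge0// powR_ge0.
have l0 : 0 < l by exact: lt_le_trans ltr01 l1.
exists l => //; rewrite /powk l0 (_ : 1 - alpha - 1 = - alpha); last by ring.
rewrite powRN.
have h1 : 8 * C + 1 <= l `^ alpha.
  have -> : 8 * C + 1 = ((8 * C + 1) `^ alpha^-1) `^ alpha.
    by rewrite -powRrM mulVf ?gt_eqF// powRr1// addr_ge0.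
  by apply: ge0_ler_powR; rewrite ?nnegrE ?powR_ge0 ?(ltW a0) ?(ltW l0)// /l lerDl addr_ge0.
have la0 : 0 < l `^ alpha by rewrite powR_gt0.
have h2 : 8 * C * c + 1 <= l by rewrite /l lerDr powR_ge0.
have h3 : C / l `^ alpha <= 8^-1 by rewrite ler_pdivrMr//; lra.
have h4 : C * c / l <= 8^-1 by rewrite ler_pdivrMr//; lra.
have -> : 2 * C * ((l `^ alpha)^-1 + c / l) = 2 * (C / l `^ alpha) + 2 * (C * c / l).
  by ring.
by move: h3 h4; lra.
Qed.

(** The weight precedes [f], [v] and [P], hence is the same at every point of space. With [A] the
    weighted integral of [f v], the lower-order terms cost at most [A / 2], so the integral of [P]
    is at least [A / 2]. If it is not positive, then [A = 0], the coercivity makes the primitive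
    vanish, and [prim_ae0] gives [f = 0]. *)
Lemma energy_bound C : 0 <= C -> exists2 lambda, 0 < lambda &
  forall f v P, L2_itv T f -> L2_itv T v ->
  {ae mu, forall t : R, 0 < t < T -> v t = (Gamma alpha)^-1 * wfrac alpha f t} ->
  let v0 := prim_itv (Gamma 1)^-1 f in
  L1 mu (fun t => if 0 < t < T then expw lambda t * P t else 0) ->
  {ae mu, forall t : R, 0 < t < T -> f t * v t - C * (v t ^+ 2 + v0 t ^+ 2 +
     prim (fun s => v s ^+ 2) t + prim (fun s => v0 s ^+ 2) t) <= P t} ->
  0 <= \int[mu]_t (if 0 < t < T then expw lambda t * P t else 0) /\
  (\int[mu]_t (if 0 < t < T then expw lambda t * P t else 0) <= 0 ->
   {ae mu, forall t : R, f t = 0}).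
Proof.
move=> C0; have /andP[a0 a1] := alpha01.
have G1 : 0 < (Gamma 1 : R) by rewrite Gamma_gt0// ltr01 lexx.
have Ga : 0 < Gamma alpha by rewrite Gamma_gt0// a0 ltW.
have Gb : 0 < Gamma (1 - alpha) by rewrite Gamma_gt0// subr_gt0 a1 gerBl ltW.
(* The constant of [prim_coercive], with the normalization of [v0] squared and the factor
   [Gamma alpha] that relates [B] to [A]. *)
pose c := (Gamma 1)^-1 ^+ 2 * ((2 + T) * Gamma (1 - alpha)) * Gamma alpha.
have c_ge0 : 0 <= c.
  apply: mulr_ge0; last exact: ltW.
  apply: mulr_ge0; first exact: sqr_ge0.
  by apply: mulr_ge0; [rewrite addr_ge0// ltW|exact: ltW].
have [lambda l1 lC] := large_lambda C0 c_ge0.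
have l0 : 0 < lambda by exact: lt_le_trans ltr01 l1.
exists lambda => // f v P f2 v2 vf v0 iP Ple.
have [mf sf _] := f2; have [mv sv _] := v2.
have v02 : L2_itv T v0 := L2_prim_itv _ f2.
have [mv0 sv0 _] := v02.
have mE := measurable_expw lambda.
have E0 := expw_gt0 lambda.
have [ifw _ _] := frac_energy T0 l0 alpha01 f2.
have iv := L2_itv_weight l0 v2.
have iv0 := L2_itv_weight l0 v02.
pose B := \int[mu]_t (expw lambda t * (f t * wfrac alpha f t)).
have fvE : {ae mu, forall t : R, (Gamma alpha)^-1 *
    (expw lambda t * (f t * wfrac alpha f t)) = expw lambda t * (f t * v t)}.
  apply: ae_imp_mu vf => t vft; have [/vft ->|/sf ->] := boolP (0 < t < T).
    by ring.
  by rewrite !mul0r !mulr0.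
have mfv : measurable_fun setT (fun t => expw lambda t * (f t * v t)).
  by do 2 (apply: measurable_funM => //).
have ifv := ae_L1_mu mfv fvE (L1Z _ ifw).
pose A := \int[mu]_t (expw lambda t * (f t * v t)).
have AE : A = (Gamma alpha)^-1 * B.
  rewrite /A -(ae_Rint_mu (L1Z _ ifw) mfv fvE) RintegralZl//.
have BE : B = Gamma alpha * A by rewrite AE mulrA mulfV ?mul1r ?gt_eqF.
pose V := \int[mu]_t (expw lambda t * v t ^+ 2).
pose V0 := \int[mu]_t (expw lambda t * v0 t ^+ 2).
have Vge0 : 0 <= V.
  by apply: Rint_ge0 => t; apply: mulr_ge0; [exact: ltW|exact: sqr_ge0].
have V0ge0 : 0 <= V0.
  by apply: Rint_ge0 => t; apply: mulr_ge0; [exact: ltW|exact: sqr_ge0].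
have VA : V <= powk (1 - alpha) lambda * A.
  have [iw Iw] := frac_coercive T0 l0 alpha01 f2.
  have vwE : {ae mu, forall t : R, (Gamma alpha)^-1 ^+ 2 *
      (if 0 < t < T then expw lambda t * wfrac alpha f t ^+ 2 else 0) =
      expw lambda t * v t ^+ 2}.
    apply: ae_imp_mu vf => t vft; case: ifPn => [/vft ->|/sv ->]; first by ring.
    by rewrite expr0n !mulr0.
  have mvv := L1_measurable iv.
  rewrite /V -(ae_Rint_mu (L1Z _ iw) mvv vwE) RintegralZl//.
  rewrite -ler_pdivlMl ?exprn_gt0 ?invr_gt0//; apply: le_trans Iw _.
  rewrite -/B BE le_eqVlt; apply/orP; left; apply/eqP.
  by field; rewrite gt_eqF.
have V0A : V0 <= c / lambda * A.
  have [ip Ip] := prim_coercive T0 l1 alpha01 f2.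
  have vpE t : (Gamma 1)^-1 ^+ 2 *
      (if 0 < t < T then expw lambda t * prim f t ^+ 2 else 0) =
      expw lambda t * v0 t ^+ 2.
    by rewrite /v0 /prim_itv; case: ifP => _; [ring|rewrite expr0n !mulr0].
  rewrite /V0 -(eq_Rint_mu vpE) RintegralZl//.
  have := ler_wpM2l (sqr_ge0 (Gamma 1)^-1) Ip.
  by rewrite -/B BE /c; move=> /le_trans; apply; rewrite le_eqVlt; apply/orP; left; apply/eqP; ring.
have pk0 : 0 < powk (1 - alpha) lambda by rewrite /powk l0 powR_gt0.
have A0 : 0 <= A by have := le_trans Vge0 VA; rewrite pmulr_rge0.
have ll0 : 0 < 2 * lambda by rewrite mulr_gt0.
have voltE (q : R -> R) : L2_itv T q ->
    L1 mu (fun t => expw lambda t * prim (fun s => q s ^+ 2) t) /\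
    \int[mu]_t (expw lambda t * prim (fun s => q s ^+ 2) t) <=
    \int[mu]_t (expw lambda t * q t ^+ 2).
  move=> q2; have [_ sq _] := q2.
  have qsq0 s : s <= 0 -> q s ^+ 2 = 0.
    by move=> s0; rewrite sq ?expr0n// negb_and -leNgt s0.
  have [_ i2 I2] : [/\ forall t, L1 mu (fun s => if s < t then q s ^+ 2 else 0),
    L1 mu (fun t => expw lambda t * prim (fun s => q s ^+ 2) t) &
    \int[mu]_t (expw lambda t * prim (fun s => q s ^+ 2) t) =
    (2 * lambda)^-1 * \int[mu]_t (expw lambda t * q t ^+ 2)].
    exact: volterra_weight ll0 qsq0 (L2_itv_weight l0 q2).
  split; first exact: i2.
  rewrite I2; apply: ler_piMl.
    by apply: Rint_ge0 => t; apply: mulr_ge0; [exact: ltW|exact: sqr_ge0].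
  by rewrite invf_le1// (le_trans l1)// ler_peMl ?(ltW l0)// ler1n.
have [jv Jv] := voltE v v2; have [jv0 Jv0] := voltE v0 v02.
pose z t := expw lambda t * v t ^+ 2 + expw lambda t * v0 t ^+ 2 +
  expw lambda t * prim (fun s => v s ^+ 2) t + expw lambda t * prim (fun s => v0 s ^+ 2) t.
have iz : L1 mu z by apply: L1D => //; apply: L1D => //; exact: L1D.
(* The factor 2 appears because, for [2 * lambda >= 1], the weighted integrals of the two primitives
   are at most [V] and [V0] again. *)
have Iz : \int[mu]_t z t <= 2 * (V + V0).
  rewrite /z RintegralD//; last by apply: L1D => //; exact: L1D.
  rewrite RintegralD//; last exact: L1D.
  rewrite RintegralD//; have -> : 2 * (V + V0) = V + V0 + V + V0 by ring.
  exact: lerD (lerD (lexx (V + V0)) Jv) Jv0.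
have pge0 (q : R -> R) t : 0 <= prim (fun s => q s ^+ 2) t.
  by apply: Rint_ge0 => s; case: ifP => // _; exact: sqr_ge0.
have main : A - C * \int[mu]_t z t <=
    \int[mu]_t (if 0 < t < T then expw lambda t * P t else 0).
  rewrite /A -RintegralZl// -RintegralB//; last exact: L1Z.
  apply: ae_Rint_le_mu iP _; first by apply: L1B => //; exact: L1Z.
  apply: ae_imp_mu Ple => t Plet; case: ifPn => [/Plet h|nt].
    have -> : expw lambda t * (f t * v t) - C * z t = expw lambda t * (f t * v t -
      C * (v t ^+ 2 + v0 t ^+ 2 + prim (fun s => v s ^+ 2) t + prim (fun s => v0 s ^+ 2) t)).
      by rewrite /z; ring.
    by rewrite ler_pM2l.
  rewrite sf// mul0r mulr0 sub0r oppr_le0 mulr_ge0// /z.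
  by rewrite !addr_ge0//; apply: mulr_ge0 => //; try exact: ltW; exact: sqr_ge0.
have half : 2^-1 * A <= \int[mu]_t (if 0 < t < T then expw lambda t * P t else 0).
  apply: le_trans main.
  have h1 : C * \int[mu]_t z t <= C * (2 * (V + V0)) by rewrite ler_wpM2l.
  have h2 : C * (2 * (V + V0)) <= 2 * C * (powk (1 - alpha) lambda + c / lambda) * A.
    have -> : C * (2 * (V + V0)) = 2 * C * (V + V0) by ring.
    rewrite -[leRHS]mulrA ler_wpM2l ?mulr_ge0// mulrDl; exact: lerD.
  have h3 := le_trans h1 (le_trans h2 (ler_wpM2r A0 lC)).
  rewrite lerBrDr; apply: le_trans (lerD (lexx _) h3) _.
  by have -> : 2^-1 * A + 2^-1 * A = A by field.
split; first by apply: le_trans half; rewrite mulr_ge0.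
move=> le0; have A00 : A = 0.
  apply/eqP; rewrite eq_le A0 andbT.
  by have := le_trans half le0; rewrite pmulr_rle0.
have V00 : V0 <= 0 by apply: le_trans V0A _; rewrite A00 mulr0.
apply: (prim_ae0 (L2_itv_integrable f2) sf).
have Ev0 t : 0 <= expw lambda t * v0 t ^+ 2.
  by apply: mulr_ge0; [exact: ltW|exact: sqr_ge0].
apply: ae_imp_mu (Rint0_ae0 iv0 Ev0 V00) => t /eqP; rewrite mulf_eq0 gt_eqF//=.
rewrite expf_eq0/= => v0t tT; move: v0t; rewrite /v0 /prim_itv tT mulf_eq0 invr_eq0.
by rewrite (gt_eqF G1) => /eqP.
Qed.

End energy_bound.

(** * Bounds on the coefficients *)

Section rayleigh.
Context {R : realType} {n : nat}.
Implicit Types (x y xi : 'rV[R]_n.+1) (A : 'M[R]_n.+1).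

Lemma vdotC x y : vdot x y = vdot y x.
Proof. by apply: eq_bigr => i _; rewrite mulrC. Qed.

Lemma vdotDl x y xi : vdot (x + y) xi = vdot x xi + vdot y xi.
Proof. by rewrite -big_split; apply: eq_bigr => i _; rewrite mxE mulrDl. Qed.

Lemma vdotZl k x xi : vdot (k *: x) xi = k * vdot x xi.
Proof. by rewrite /vdot mulr_sumr; apply: eq_bigr => i _; rewrite mxE mulrA. Qed.

Lemma vdotE x y : vdot x y = (x *m y^T) ord0 ord0.
Proof. by rewrite mxE; apply: eq_bigr => i _; rewrite mxE. Qed.

Lemma vdot_sym A x y : A^T = A -> vdot (x *m A) y = vdot (y *m A) x.
Proof. by move=> sA; rewrite vdotC !vdotE trmx_mul sA mulmxA. Qed.

Lemma vdot_ge0 x : 0 <= vdot x x.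
Proof. by apply: sumr_ge0 => i _; rewrite -expr2 sqr_ge0. Qed.

Lemma vdot_eq0 x : (vdot x x == 0) = (x == 0).
Proof.
apply/eqP/eqP => [h|->]; last by rewrite /vdot big1// => i _; rewrite mxE mul0r.
apply/rowP => i; rewrite mxE; apply/eqP; rewrite -sqrf_eq0 expr2; apply/eqP.
by move: h => /psumr_eq0P; apply => // j _; rewrite -expr2 sqr_ge0.
Qed.

Lemma sum_continuous (I : finType) (T : topologicalType) (f : I -> T -> R) :
  (forall i, continuous (f i)) -> continuous (fun p => \sum_i f i p).
Proof.
move=> cf; elim: (index_enum I) => [|i s ih] x.
  rewrite (_ : (fun _ => _) = cst 0); first exact: cvg_cst.
  by apply/funext => p; rewrite big_nil.
rewrite (_ : (fun _ => _) = (fun p => f i p + \sum_(j <- s) f j p)).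
  exact: cvgD (cf i x) (ih x).
by apply/funext => p; rewrite big_cons.
Qed.

Lemma continuous_vdotM A : continuous (fun x => vdot (x *m A) x).
Proof.
have cA i : continuous (fun y : 'rV[R]_n.+1 => (y *m A) ord0 i).
  rewrite (_ : (fun _ => _) = (fun y => \sum_j y ord0 j * A j i)).
    apply: (sum_continuous (f := fun j y => y ord0 j * A j i)) => j y.
    by apply: continuousM; [exact: coord_continuous|exact: cst_continuous].
  by apply/funext => y; rewrite mxE.
apply: (sum_continuous (f := fun i y => (y *m A) ord0 i * y ord0 i)) => i x.
by apply: continuousM; [exact: cA|exact: coord_continuous].
Qed.

(* The minimum of the Rayleigh quotient over the unit sphere is attained, and
   it is an eigenvalue: at a minimizer the nonnegative quadratic form of
   [A - m] vanishes to second order in every direction. *)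
Lemma rayleigh_min A c : A^T = A ->
  (forall lambda, eigenvalue A lambda -> c <= lambda) ->
  forall x, c * vdot x x <= vdot (x *m A) x.
Proof.
move=> sA cA.
pose S := [set x : 'rV[R]_n.+1 | vdot x x = 1].
have c1 : continuous (fun x : 'rV[R]_n.+1 => vdot x x).
  rewrite (_ : (fun _ => _) = (fun x => vdot (x *m 1%:M) x)).
    exact: continuous_vdotM.
  by apply/funext => x; rewrite mulmx1.
have cS : compact S.
  apply: bounded_closed_compact.
    exists 1; split => // M M1 x /= Sx.
    rewrite [leLHS]mx_normrE; apply/bigmax_leP; split=> [|[i j] _ /=].
      by rewrite ltW// (lt_trans ltr01).
    rewrite ord1 (le_trans _ (ltW M1))// -(@expr_le1 _ 2)// -normrX ger0_norm ?sqr_ge0//.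
    rewrite -Sx /vdot (bigD1 j)//= -expr2 lerDl sumr_ge0// => k _.
    by rewrite -expr2 sqr_ge0.
  rewrite (_ : S = (fun x => vdot x x) @^-1` [set 1]); last by [].
  apply: closed_comp; first by move=> x _; exact: c1.
  exact: closed_eq.
pose e : 'rV[R]_n.+1 := delta_mx ord0 ord0.
have Se : S e.
  rewrite /S/= /vdot (bigD1 ord0)//= big1 ?addr0 => [|i i0].
    by rewrite !mxE !eqxx mulr1.
  by rewrite !mxE (negbTE i0) andbF mulr0.
have [y Sy ymin] := compact_EVT_min (ex_intro _ e Se) cS
  (continuous_subspaceT (@continuous_vdotM A)).
rewrite /S/= inE/= in Sy.
set m := vdot (y *m A) y in ymin.
have qm x : m * vdot x x <= vdot (x *m A) x.
  have [->|x0] := eqVneq x 0.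
    by rewrite mul0mx /vdot !big1 ?mulr0// => i _; rewrite mxE mul0r.
  have N0 : 0 < vdot x x by rewrite lt_neqAle vdot_ge0 eq_sym vdot_eq0 x0.
  pose s := (Num.sqrt (vdot x x))^-1.
  have s2 : s * s = (vdot x x)^-1 by rewrite -invfM -expr2 sqr_sqrtr// vdot_ge0.
  have Sx : S (s *: x).
    by rewrite /S/= vdotZl vdotC vdotZl mulrA s2 mulVf ?gt_eqF.
  have := ymin (s *: x); rewrite inE => /(_ Sx).
  by rewrite -scalemxAl vdotZl vdotC vdotZl mulrA s2 vdotC ler_pdivlMl// mulrC.
suff : eigenvalue A m.
  by move=> /cA cm x; apply: le_trans (qm x); rewrite ler_wpM2r ?vdot_ge0.
apply/eigenvalueP; exists y; last first.
  by rewrite -vdot_eq0 Sy oner_eq0.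
(* The residual of the eigenvalue equation, taken as the direction of variation: the first-order
   term is then [2 * vdot z z]. *)
pose z := y *m A - m *: y.
suff : z = 0 by move/eqP; rewrite subr_eq0 => /eqP.
apply/eqP; rewrite -vdot_eq0; apply/eqP.
have az : vdot z z = vdot (y *m A) z - m * vdot y z.
  by rewrite {1}/z vdotDl -scaleNr vdotZl mulNr.
set a := vdot z z in az *.
pose k := vdot (z *m A) z - m * vdot z z.
have k0 : 0 <= k by rewrite subr_ge0.
have key s : 0 <= 2 * s * a + s ^+ 2 * k.
  have := qm (y + s *: z).
  rewrite mulmxDl -scalemxAl !vdotDl !vdotZl.
  rewrite ![vdot _ (y + s *: z)]vdotC !vdotDl !vdotZl.
  rewrite -subr_ge0 => h; move: h; rewrite az /k Sy.
  rewrite [vdot y (z *m A)]vdotC (vdot_sym _ _ sA) [vdot y (y *m A)]vdotC -/m.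
  rewrite [vdot z (y *m A)]vdotC [vdot z (z *m A)]vdotC [vdot z y]vdotC => h.
  by apply: le_trans h _; rewrite le_eqVlt; apply/orP; left; apply/eqP; ring.
apply/eqP; rewrite eq_le vdot_ge0 andbT leNgt; apply/negP => a0.
have k1 : 0 < k + 1 by rewrite ltr_wpDl.
(* A step small enough for the linear term to dominate; [k + 1] avoids a division by zero when
   [k = 0]. *)
have := key (- a / (k + 1)).
have -> : 2 * (- a / (k + 1)) * a + (- a / (k + 1)) ^+ 2 * k =
  - (a ^+ 2 * (k + 2) / (k + 1) ^+ 2) by field; rewrite gt_eqF.
rewrite oppr_ge0 leNgt; apply/negP; rewrite negbK.
by rewrite divr_gt0 ?mulr_gt0 ?exprn_gt0// ltr_wpDl.
Qed.

End rayleigh.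

Section measurable_open.
Context {R : realType} {n : nat}.

(** The sigma-algebra is generated by the coordinates, so an open set is written as the countable
    union of the rational cubes contained in it. *)
Lemma measurable_open_rV (A : set 'rV[R]_n.+1) : open A -> measurable A.
Proof.
move=> oA.
pose B (q : 'rV[rat]_n.+1 * nat) : set 'rV[R]_n.+1 :=
  [set y | forall j, ball (ratr (q.1 ord0 j) : R) (q.2.+1%:R^-1) (y ord0 j)].
have mB q : measurable (B q).
  rewrite (_ : B q = \bigcap_(j in [set: 'I_n.+1])
      ((fun y : 'rV[R]_n.+1 => y ord0 j) @^-1`
       ball (ratr (q.1 ord0 j) : R) (q.2.+1%:R^-1))); last first.
    by apply/seteqP; split => [y By j _|y By j] /=; [exact: By|exact: (By j)].
  apply: fin_bigcap_measurable => [|j _]; first exact: finite_finset.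
  rewrite -[X in measurable X]setTI; apply: measurable_coor => //.
  exact: measurable_ball.
rewrite (_ : A = \bigcup_q (if `[< B q `<=` A >] then B q else set0)).
  apply: countable_bigcupT_measurable => [|q]; first exact: countableP.
  by case: ifP => _; [exact: mB|exact: measurable0].
apply/seteqP; split => [x Ax|x [q _]]; last first.
  by case: asboolP => // sub; exact: sub.
have /nbhs_ballP[e /= e0 sub] := open_nbhs_nbhs (conj oA Ax).
(* Half the radius, since a point of the cube and [x] are compared through the rational centre. *)
have e20 : 0 < e / 2 by rewrite divr_gt0.
have [k] := ltr_add_invr e20; rewrite add0r => ke.
have k0 : 0 < (k.+1%:R^-1 : R) by rewrite invr_gt0.
have hq (j : 'I_n.+1) : {q : rat | `|x ord0 j - ratr q| < k.+1%:R^-1}.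
  apply: cid; have [|q] := @rat_in_itvoo R (x ord0 j - k.+1%:R^-1) (x ord0 j + k.+1%:R^-1).
    by rewrite ltrBlDr -addrA ltrDl addr_gt0.
  by rewrite in_itv/= => h; exists q; rewrite ltr_distlC.
exists (\row_j sval (hq j), k) => //.
have BA : B (\row_j sval (hq j), k) `<=` A.
  move=> y /= By; apply: sub; split => // i j; rewrite ord1.
  have := By j; rewrite /= mxE /ball/= => h1; have h2 := svalP (hq j).
  have -> : x ord0 j - y ord0 j = (x ord0 j - ratr (sval (hq j))) + (ratr (sval (hq j)) - y ord0 j).
    by rewrite addrA subrK.
  apply: le_lt_trans (ler_normD _ _) _.
  by rewrite (splitr e) ltrD// (lt_trans _ ke).
rewrite asboolT// => j; rewrite /= mxE /ball/= distrC; exact: (svalP (hq j)).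
Qed.

End measurable_open.

Section ae_swap.
Context d1 d2 (T1 : measurableType d1) (T2 : measurableType d2) (R : realType).
Variable m1 : {sigma_finite_measure set T1 -> \bar R}.
Variable m2 : {sigma_finite_measure set T2 -> \bar R}.

Lemma ae_imp d (T : measurableType d) (m : {measure set T -> \bar R})
    (P Q : T -> Prop) : (forall t, P t -> Q t) ->
  {ae m, forall t, P t} -> {ae m, forall t, Q t}.
Proof. exact: (@filterS _ _ (ae_filter_ringOfSetsType m) P Q). Qed.

Lemma ae_and d (T : measurableType d) (m : {measure set T -> \bar R})
    (P Q : T -> Prop) : {ae m, forall t, P t} ->
  {ae m, forall t, Q t} -> {ae m, forall t, P t /\ Q t}.
Proof. exact: (@filterI _ _ (ae_filter_ringOfSetsType m) P Q). Qed.

Lemma ae_forall d (T : measurableType d) (m : {measure set T -> \bar R})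
    (I : finType) (P : I -> T -> Prop) :
  (forall i, {ae m, forall t, P i t}) -> {ae m, forall t, forall i, P i t}.
Proof.
move=> aP; have : {ae m, forall t, forall i, i \in enum I -> P i t}.
  elim: (enum I) => [|i s ih]; first exact: aeW.
  apply: ae_imp (ae_and (aP i) ih) => t [Pi Ps] j.
  by rewrite in_cons => /predU1P[->|/Ps].
by apply: ae_imp => t Pt i; apply: Pt; rewrite mem_enum.
Qed.

(** Both sides say that the failure set of [b] is null for the product measure: its indicator has
    zero iterated integrals in one order if and only if in the other. *)
Lemma ae_swap (b : T1 * T2 -> bool) : measurable_fun setT b ->
  {ae m1, forall x, {ae m2, forall y, b (x, y)}} ->
  {ae m2, forall y, {ae m1, forall x, b (x, y)}}.
Proof.
move=> mb ab; pose k z : R := if b z then 0 else 1.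
have mk : measurable_fun setT k by apply: measurable_fun_ifT.
have k0 z : 0 <= k z by rewrite /k; case: ifP.
have sec x : {ae m2, forall y, b (x, y)} -> L1 m2 (fun y => k (x, y)) /\
    \int[m2]_y `|k (x, y)| = 0.
  move=> bx; have mkx : measurable_fun setT (fun y => k (x, y)).
    exact: measurable_section1.
  have E : {ae m2, forall y, cst 0 y = k (x, y)}.
    by apply: ae_imp bx => y; rewrite /k => ->.
  have i0 : L1 m2 (cst 0) by exact: integrable0.
  split; first exact: ae_L1 mkx E i0.
  rewrite -(@ae_Rint _ _ _ m2 (cst 0)) ?Rintegral_cst ?mul0r//.
    exact: measurableT_comp.
  by apply: ae_imp E => y <-; rewrite normr0.
have ik : L1 (m1 \x m2)%E k.
  apply: (@L1_prod_le _ _ _ _ _ _ _ _ (cst 0)) => //; first exact: integrable0.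
  by apply: ae_imp ab => x /sec[ix ->].
have I0 : \int[m2]_y \int[m1]_x k (x, y) <= 0.
  rewrite -(Rint_swap ik) -(@ae_Rint _ _ _ m1 (cst 0)) ?Rintegral_cst ?mul0r//.
  - exact: integrable0.
  - exact: measurable_Rint2.
  - apply: ae_imp ab => x /sec[_ <-].
    by apply: eq_Rint => y; rewrite ger0_norm.
have := Rint0_ae0 (L1_Rint1 ik) (fun y => Rint_ge0 m1 (fun x => k0 (x, y))) I0.
move=> h; apply: ae_imp (ae_and h (ae_L1_section2 ik)) => y [Iy iy].
have := Rint0_ae0 iy (fun x => k0 (x, y)); rewrite Iy => /(_ (lexx _)).
apply: ae_imp => x; rewrite /k; case: ifP => // _ /eqP.
by rewrite oner_eq0.
Qed.

End ae_swap.

Section uniform_bound.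
Context {R : realType} {n : nat}.
Variables (Omega : set 'rV[R]_n) (N : ('rV[R]_n -> R) -> \bar R) (T : R).
Hypothesis LooN_le : forall v, (LooN Omega v <= N v)%E.
Implicit Types (v w : 'rV[R]_n -> R) (K : R).

Definition ae_bounded v K :=
  {ae lebesgue_rV n, forall x, Omega x -> `|v x| <= K}.

Lemma LooN_bounded v K : (LooN Omega v <= K%:E)%E -> ae_bounded v K.
Proof.
rewrite /LooN /LpN unlock; case: ifPn => [_ h|m0 _].
  apply: ae_imp (ess_supP h) => x /=.
  by rewrite patchE => + Ox; rewrite mem_set//= lee_fin.
(* The norm of order [+oo] is an essential supremum only if the whole space has positive measure;
   otherwise every property holds almost everywhere. *)
exists setT; split => //; apply/eqP; rewrite eq_le measure_ge0 andbT leNgt.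
exact: m0.
Qed.

Lemma N_lty_bounded v : (N v < +oo)%E -> exists K, ae_bounded v K.
Proof.
move=> Nv; have Lv : (LooN Omega v < +oo)%E by exact: le_lt_trans (LooN_le v) Nv.
have L0 : (0 <= LooN Omega v)%E by exact: Lnorm_ge0.
exists (fine (LooN Omega v)); apply: LooN_bounded; rewrite fineK//.
by rewrite ge0_fin_numE.
Qed.

Lemma ae_boundedD v w K L : ae_bounded v K -> ae_bounded w L ->
  ae_bounded (fun x => v x + w x) (K + L).
Proof.
move=> bv bw; apply: ae_imp (ae_and bv bw) => x [vx wx] Ox.
by rewrite (le_trans (ler_normD _ _))// lerD ?vx ?wx.
Qed.

Lemma ae_bounded_le v K L : K <= L -> ae_bounded v K -> ae_bounded v L.
Proof. by move=> KL; apply: ae_imp => x vx /vx /le_trans; apply. Qed.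

Lemma near_N_le1 (S : Type) (F : set_system S) {FF : Filter F}
    (h : S -> 'rV[R]_n -> R) :
  N (h s) @[s --> F] --> 0%E -> \forall s \near F, ae_bounded (h s) 1.
Proof.
move=> /fine_cvgP[fN /cvgrPdist_lt /(_ _ ltr01)].
move=> h1; apply: filterS (filterI fN h1) => s [fs]; rewrite sub0r normrN => l1.
apply: LooN_bounded; apply: le_trans (LooN_le _) _; rewrite -(fineK fs) lee_fin.
exact: le_trans (ler_norm _) (ltW l1).
Qed.

(** Compactness of [[0, T]]. The bound itself is the parameter of the covering argument: a local
    bound remains valid when enlarged, so it holds for all large [K]. *)
Lemma local_uniform_bound (psi : R -> 'rV[R]_n -> R) :
  (forall t : R, t \in `[0, T] -> exists K, \forall s \near t, s \in `[0, T] ->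
     ae_bounded (psi s) K) ->
  exists K, forall t, t \in `[0, T] -> ae_bounded (psi t) K.
Proof.
move=> loc.
have /compact_near_coveringP nc := @segment_compact R 0 T.
have : \forall K \near +oo, `[0, T]%classic `<=` (fun t => t \in `[0, T] -> ae_bounded (psi t) K).
  apply: nc => t tT; have [K hK] := loc t tT.
  exists ([set s | s \in `[0, T] -> ae_bounded (psi s) K], [set L | K <= L]) => /=.
    by split; [exact: hK|exact: (nbhs_pinfty_ge (num_real K))].
  by move=> [s L] /= [hs KL] sT; apply: ae_bounded_le KL _; exact: hs.
move=> [K [_ hK]]; exists (K + 1) => t tT.
by apply: (hK (K + 1)) => //; rewrite ltrDl.
Qed.

Lemma continuous_uniform_bound psi : curve N T Omega psi ->
  time_continuous N T psi ->
  exists K, forall t, t \in `[0, T] -> ae_bounded (psi t) K.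
Proof.
move=> [_ cpsi] tpsi; apply: local_uniform_bound => t tT.
have [K2 b2] := N_lty_bounded (cpsi t tT).
have := near_N_le1 (FF := within_filter _ (nbhs_filter (t : R))) (tpsi t tT).
rewrite near_withinE => /nbhs_ballP[e /= e0 he].
exists (1 + K2); apply/nbhs_ballP; exists e => //= s bs sT.
have := ae_boundedD (he s bs sT) b2; apply: ae_imp => x.
by rewrite subrK.
Qed.

(** Boundedness near [t] is read off the difference quotient, which lies within 1 of [dpsi t];
    continuity of the curve is not a separate clause of [CkS_with_derivative]. *)
Lemma derivative_uniform_bound psi dpsi : curve N T Omega psi ->
  curve N T Omega dpsi -> time_derivative N T psi dpsi ->
  exists K, forall t, t \in `[0, T] -> ae_bounded (psi t) K.
Proof.
move=> [_ cpsi] [_ cdpsi] tpsi; apply: local_uniform_bound => t tT.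
have [K2 b2] := N_lty_bounded (cpsi t tT).
have [K1' b1'] := N_lty_bounded (cdpsi t tT).
have [K1 K10 b1] : exists2 K1, 0 <= K1 & ae_bounded (dpsi t) K1.
  by exists `|K1'| => //; apply: ae_bounded_le b1'; exact: ler_norm.
have := near_N_le1 (FF := within_filter _
  (within_filter _ (nbhs_filter (t : R)))) (tpsi t tT).
rewrite near_withinE => /nbhs_ballP[e /= e0 he].
(* A difference quotient of size at most [1 + K1] over a distance below [e], added to the bound at
   [t]. *)
exists (Num.max K2 (e * (1 + K1) + K2)).
apply/nbhs_ballP; exists e => //= s bs sT.
(* The limit of the difference quotient is taken over a punctured neighbourhood, so [s = t] is
   treated apart. *)
have [->|st] := eqVneq s t.
  by apply: ae_bounded_le b2; rewrite le_max lexx.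
have h := ae_boundedD (he s bs st sT) b1.
apply: ae_imp (ae_and h b2) => x [hx b2x] Ox; rewrite le_max; apply/orP; right.
have {}hx := hx Ox; rewrite subrK in hx.
have st0 : 0 < `|s - t| by rewrite normr_gt0 subr_eq0.
rewrite -[psi s x](subrK (psi t x)); apply: le_trans (ler_normD _ _) _.
rewrite lerD ?b2x//; move: hx; rewrite normrM normfV ler_pdivrMr// => /le_trans; apply.
rewrite mulrC ler_wpM2r//.
  by rewrite addr_ge0.
by move: bs; rewrite /ball/= distrC => /ltW.
Qed.

End uniform_bound.

(** * Extension by zero and sections in space *)

Section L2_tools.
Context d (T : measurableType d) (R : realType).
Variable m : {measure set T -> \bar R}.
Implicit Types f g : T -> R.

Definition L2 f := measurable_fun setT f /\ L1 m (fun x => f x ^+ 2).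

Lemma L2_measurable f : L2 f -> measurable_fun setT f. Proof. by case. Qed.

Lemma L2M f g : L2 f -> L2 g -> L1 m (fun x => f x * g x).
Proof. by move=> [mf f2] [mg g2]; exact: L1_sqrM. Qed.

Lemma L2D f g : L2 f -> L2 g -> L2 (fun x => f x + g x).
Proof.
move=> [mf f2] [mg g2]; split; first exact: measurable_funD.
apply: (@L1_le _ _ _ _ _ (fun x => 2 * (f x ^+ 2 + g x ^+ 2))).
- by apply: measurable_funX; exact: measurable_funD.
- by apply: L1Z; exact: L1D.
- by move=> x; rewrite ger0_norm ?sqr_ge0//; have := sqr_ge0 (f x - g x); nra.
Qed.

Lemma L2Z k f : L2 f -> L2 (fun x => k * f x).
Proof.
move=> [mf f2]; split; first exact: measurable_funM.
by apply: eq_L1 (L1Z (k ^+ 2) f2) => x; rewrite exprMn.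
Qed.

Lemma L2B f g : L2 f -> L2 g -> L2 (fun x => f x - g x).
Proof.
move=> f2 g2; have := L2D f2 (L2Z (-1) g2).
by rewrite (_ : (fun x => f x + _) = (fun x => f x - g x))//; apply/funext => x; rewrite mulN1r.
Qed.

Lemma L2_0 : L2 (cst 0).
Proof.
split => //; apply: eq_L1 (integrable0 _ _) => x /=.
by rewrite expr0n.
Qed.

Lemma L2_sum (I : finType) (h : I -> T -> R) :
  (forall i, L2 (h i)) -> L2 (fun x => \sum_i h i x).
Proof.
move=> hi; elim: (index_enum I) => [|i s ih].
  rewrite (_ : (fun _ => _) = cst 0); first exact: L2_0.
  by apply/funext => x; rewrite big_nil.
rewrite (_ : (fun _ => _) = (fun x => h i x + \sum_(j <- s) h j x)); first exact: L2D.
by apply/funext => x; rewrite big_cons.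
Qed.

End L2_tools.

(** For a bound known only on almost every section and almost everywhere there, the section
    integrals are compared first. This is the form in which coefficient bounds are available. *)
Lemma ae_prod_L1_le d1 d2 (T1 : measurableType d1) (T2 : measurableType d2)
    (R : realType) (m1 : {sigma_finite_measure set T1 -> \bar R})
    (m2 : {sigma_finite_measure set T2 -> \bar R}) (k h : T1 * T2 -> R) :
  measurable_fun setT k -> L1 (m1 \x m2)%E h ->
  {ae m2, forall y, {ae m1, forall x, `|k (x, y)| <= h (x, y)}} ->
  L1 (m1 \x m2)%E k.
Proof.
move=> mk ih kh.
have mk' : measurable_fun setT (fun z : T2 * T1 => k (z.2, z.1)).
  by apply: measurableT_comp mk _; exact: measurable_swap.
have ik' : L1 (m2 \x m1)%E (fun z : T2 * T1 => k (z.2, z.1)).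
  apply: (@L1_prod_le _ _ _ _ _ _ _ _ (fun y => \int[m1]_x h (x, y)) mk').
    exact: L1_Rint1 ih.
  apply: ae_imp (ae_and kh (ae_L1_section2 ih)) => y [khy ihy] /=.
  have mky : measurable_fun setT (fun x => k (x, y)) by exact: measurable_section2.
  have iky : L1 m1 (fun x => k (x, y)) by exact: ae_L1_le mky ihy khy.
  by split => //; exact: ae_Rint_le (L1_norm iky) ihy khy.
apply: eq_L1 (L1_swap ik') => -[x y] //.
Qed.

Lemma poweR_sqr (R : realType) (x : \bar R) : (0 <= x -> x `^ 2 = x ^+ 2)%E.
Proof.
case: x => [r|_|//]; last by rewrite poweRyr ?pnatr_eq0// expe2 mulyy.
by rewrite lee_fin => r0; rewrite poweR_EFin powR_mulrn// EFin_expe.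
Qed.

Section extension.
Context {R : realType} {n : nat}.
Variables (T : R) (Omega : set 'rV[R]_n).
Hypothesis mO : measurable Omega.
Implicit Types (phi psi : R -> 'rV[R]_n -> R) (q : R * 'rV[R]_n -> R).
Notation mu := (@lebesgue_measure R).
Notation m := (@lebesgue_rV R n).
Notation mm := (mu \x m)%E.

(* Functions on [`]0, T[ `*` Omega] are extended by zero, in order to apply
   Fubini's theorem on the whole product. *)
Definition ext phi (z : R * 'rV[R]_n) : R :=
  if (0 < z.1 < T) && (z.2 \in Omega) then phi z.1 z.2 else 0.

Lemma extE phi t x : 0 < t < T -> Omega x -> ext phi (t, x) = phi t x.
Proof. by move=> tT Ox; rewrite /ext/= tT mem_set. Qed.

Lemma ext_supp phi t x : ~~ (0 < t < T) -> ext phi (t, x) = 0.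
Proof. by move=> /negbTE tT; rewrite /ext/= tT. Qed.

Lemma ext_out phi t x : ~ Omega x -> ext phi (t, x) = 0.
Proof. by move=> Ox; rewrite /ext/= memNset// andbF. Qed.

Lemma measurable_ext phi : jointly_measurable `]0, T[ Omega phi ->
  measurable_fun setT (ext phi).
Proof.
move=> mphi; have mD : measurable (`]0, T[%classic `*` Omega : set (R * 'rV[R]_n)).
  exact: measurableX.
have := (measurable_restrictT (fun z : R * 'rV[R]_n => phi z.1 z.2) mD).1 mphi.
rewrite (_ : _ \_ _ = ext phi)//; apply/funext => -[t x].
rewrite patchE /ext/= -[(_, _) \in _]/(_ \in (`]0, T[%classic `*` Omega)) in_setX/=.
by rewrite mem_setE/= in_itv.
Qed.

Lemma measurable_ext_cc phi : jointly_measurable `[0, T] Omega phi ->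
  measurable_fun setT (ext phi).
Proof.
move=> mphi; apply: measurable_ext; apply: measurable_funS mphi.
  exact: measurableX.
by move=> -[t x] /= []; rewrite !in_itv/= => /andP[/ltW -> /ltW ->].
Qed.

Lemma L2_ext phi : L2L2 T Omega phi -> L2 mm (ext phi).
Proof.
move=> [mphi fin]; have me := measurable_ext mphi; split => //.
have me2 : measurable_fun setT (fun z => (ext phi z ^+ 2)%:E).
  by apply/measurable_EFinP; exact: measurable_funX.
apply/integrable12ltyP => //.
suff -> : (\int[mu]_t \int[m]_x `|((ext phi (t, x)) ^+ 2)%:E| =
  \int[mu]_(t in `]0%R, T[) (LpN 2%:E Omega (phi t) ^+ 2))%E by [].
rewrite [RHS]integral_mkcond; apply: eq_integral => t _.
rewrite patchE mem_setE/= in_itv/=; case: ifPn => tT; last first.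
  by apply: integral0_eq => x _; rewrite ext_supp// expr0n/= normr0.
rewrite /LpN -expe2 -poweR_sqr ?Lnorm_ge0// poweR_Lnorm ?pnatr_eq0//.
apply: eq_integral => x _.
have -> : (`|(EFin \o phi t \_ Omega) x| `^ 2)%E =
    ((`|(phi t \_ Omega) x| `^ 2)%R)%:E by [].
rewrite powR_mulrn// -normrX; congr (`|_|%:E).
by rewrite /ext/= tT/= patchE; case: ifP; rewrite ?expr0n.
Qed.

Lemma measurable_prim2 q : measurable_fun setT q ->
  measurable_fun setT (fun z : R * 'rV[R]_n => prim (fun s => q (s, z.2)) z.1).
Proof.
move=> mq; apply: (measurable_Rint2 mu (k := fun z : R * 'rV[R]_n * R =>
  if z.2 < z.1.1 then q (z.2, z.1.2) else 0)).
have m11 : measurable_fun setT (fun z : R * 'rV[R]_n * R => z.1.1).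
  exact: (measurableT_comp measurable_fst measurable_fst).
have m12 : measurable_fun setT (fun z : R * 'rV[R]_n * R => z.1.2).
  exact: (measurableT_comp measurable_snd measurable_fst).
apply: measurable_fun_ifT => //.
  by apply: measurable_fun_ltr; [exact: measurable_snd|exact: m11].
by apply: (measurableT_comp mq); exact: measurable_fun_pair.
Qed.

End extension.

Section sections.
Context {R : realType} {n : nat}.
Variables (T : R) (Omega : set 'rV[R]_n).
Hypotheses (T0 : 0 < T) (mO : measurable Omega).
Implicit Types (phi psi dpsi : R -> 'rV[R]_n -> R) (q : R * 'rV[R]_n -> R).
Implicit Types (p dp : R * 'rV[R]_n -> R) (t s : R) (x : 'rV[R]_n).
Notation mu := (@lebesgue_measure R).
Notation m := (@lebesgue_rV R n).
Notation mm := (mu \x m)%E.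

Definition time_supp q := forall t x, ~~ (0 < t < T) -> q (t, x) = 0.

Definition ae2_bounded p K :=
  {ae m, forall x, {ae mu, forall t : R, `|p (t, x)| <= K}}.

Definition bop2 p dp q (z : R * 'rV[R]_n) : R :=
  if 0 < z.1 < T then
    bop (fun t => p (t, z.2)) (fun t => dp (t, z.2)) (fun t => q (t, z.2)) z.1
  else 0.

Lemma section_L2_itv q : L2 mm q -> time_supp q ->
  {ae m, forall x, L2_itv T (fun t => q (t, x))}.
Proof.
move=> [mq q2] sq; apply: ae_imp (ae_L1_section2 q2) => x ix; split => //.
  exact: measurable_section2.
by move=> t; exact: sq.
Qed.

Lemma measurable_bop2 p dp q : measurable_fun setT p ->
  measurable_fun setT dp -> measurable_fun setT q ->
  measurable_fun setT (bop2 p dp q).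
Proof.
move=> mp mdp mq; apply: measurable_fun_ifT => //.
  apply: (measurableT_comp (measurable_itvoo 0 T)); exact: measurable_fst.
have E (r : R * 'rV[R]_n -> R) : (fun z : R * 'rV[R]_n => r (z.1, z.2)) = r.
  by apply/funext => -[].
apply: measurable_funB.
  by rewrite (E (fun z => p z * q z)); exact: measurable_funM.
by apply: (measurable_prim2 (q := fun z => dp z * q z)); exact: measurable_funM.
Qed.

Lemma L2_bop2 p dp q K : measurable_fun setT p -> measurable_fun setT dp ->
  L2 mm q -> time_supp q -> ae2_bounded p K -> ae2_bounded dp K ->
  L2 mm (bop2 p dp q).
Proof.
move=> mp mdp q2 sq bp bdp; have [mq iq] := q2.
have mb := measurable_bop2 mp mdp mq; split => //.
pose J x := \int[mu]_t (q (t, x) ^+ 2).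
have iJ : L1 m J := L1_Rint1 iq.
have [i1 _] := ind_itv (ltW T0).
pose h (z : R * 'rV[R]_n) := 2 * K ^+ 2 * (q z ^+ 2 + T * ((if 0 < z.1 < T then 1 else 0) * J z.2)).
have ih : L1 mm h.
  apply: L1Z; apply: (L1D iq); apply: L1Z; exact: (L1_prodM i1 iJ).
apply: (ae_prod_L1_le _ ih); first exact: measurable_funX.
apply: ae_imp (ae_and (ae_and bp bdp) (section_L2_itv q2 sq)) => x [[bpx bdpx] qx].
have mdx : measurable_fun setT (fun t => dp (t, x)) by exact: measurable_section2.
have [_ _ iqx] := qx.
apply: ae_imp_mu bpx => t bptx.
rewrite ger0_norm ?sqr_ge0// /bop2/=; case: ifPn => tT; last first.
  rewrite expr0n /h/= (negbTE tT) mul0r mulr0 addr0.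
  by apply: mulr_ge0; [apply: mulr_ge0 => //|]; exact: sqr_ge0.
have := bop_sqr_le (psi := fun t => p (t, x)) tT mdx bdpx bptx qx; move=> /le_trans; apply.
rewrite /h/= tT mul1r; apply: ler_wpM2l; first by apply: mulr_ge0 => //; exact: sqr_ge0.
rewrite lerD2l; apply: ler_wpM2l; first exact: ltW.
apply: Rint_le_mu; [exact: L1_iflt|exact: iqx|].
by move=> s; case: ifP => // _; exact: sqr_ge0.
Qed.

Lemma fint1_ext phi t x : 0 < t < T -> Omega x ->
  fint 1 phi t x = prim (fun s => (Gamma 1)^-1 * ext T Omega phi (s, x)) t.
Proof.
move=> /andP[t0 tT] Ox; rewrite /fint Rint_if; apply: eq_Rint_mu => s.
rewrite mem_setE/= in_itv/= /omega subrr powRr0 mul1r.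
have [s0|s0] := ltP 0 s; last first.
  rewrite /= ext_supp; first by rewrite mulr0 if_same.
  by rewrite negb_and -leNgt s0.
by case: ltP => //= st; rewrite extE// s0 (lt_trans st).
Qed.

Lemma fint_ext alpha phi t x : 0 < t < T -> Omega x ->
  fint alpha phi t x =
  \int[mu]_s ((Gamma alpha)^-1 * (powk alpha (t - s) * ext T Omega phi (s, x))).
Proof.
move=> /andP[t0 tT] Ox; rewrite /fint Rint_if; apply: eq_Rint_mu => s.
rewrite mem_setE/= in_itv/= /omega /powk subr_gt0.
have [s0|s0] := ltP 0 s; last first.
  rewrite /= ext_supp; first by rewrite !mulr0.
  by rewrite negb_and -leNgt s0.
case: ltP => //= st; last by rewrite mul0r mulr0.
by rewrite extE// ?s0 ?(lt_trans st)//; ring.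
Qed.

Lemma Bop_ext nu psi dpsi phi z : ext T Omega (Bop nu psi dpsi phi) z =
  bop2 (ext T Omega psi) (ext T Omega dpsi) (ext T Omega (fint nu phi)) z.
Proof.
case: z => t x; rewrite /bop2/=; case: ifPn => tT; last by rewrite ext_supp.
have [Ox|Ox] := pselect (Omega x); last first.
  rewrite ext_out// /bop ext_out// mul0r /prim Rint_eq0_mu ?subrr// => s.
  by rewrite ext_out// mul0r if_same.
rewrite !extE// /Bop /bop extE// extE//; congr (_ - _).
rewrite Rint_if; apply: eq_Rint_mu => s.
rewrite mem_setE/= in_itv/=; have [s0|s0] := ltP 0 s; last first.
  rewrite /= ext_supp; first by rewrite mul0r if_same.
  by rewrite negb_and -leNgt s0.
case/andP: tT => _ tT.
by case: ltP => //= st; rewrite !extE// s0 (lt_trans st).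
Qed.

Lemma time_supp_ext phi : time_supp (ext T Omega phi).
Proof. by move=> t x; exact: ext_supp. Qed.

(** With a zero coefficient and a constant in the place of its derivative, [bop2] is minus that
    constant times the primitive, so the estimate is a case of [L2_bop2]. *)
Lemma L2_fint1 phi : L2 mm (ext T Omega phi) -> L2 mm (ext T Omega (fint 1 phi)).
Proof.
move=> p2; pose c := (Gamma 1)^-1 : R.
have h : L2 mm (bop2 (cst 0) (cst c) (ext T Omega phi)).
  apply: (@L2_bop2 _ _ _ `|c|) => //; first exact: time_supp_ext.
    by apply: aeW => x; apply: aeW => t /=; rewrite normr0.
  by apply: aeW => x; apply: aeW.
rewrite (_ : ext T Omega (fint 1 phi) =
  (fun z => -1 * bop2 (cst 0) (cst c) (ext T Omega phi) z)); first exact: L2Z.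
apply/funext => -[t x]; rewrite /bop2/=; case: ifPn => tT; last first.
  by rewrite ext_supp// mulr0.
rewrite /bop mul0r sub0r mulN1r opprK.
have [Ox|Ox] := pselect (Omega x); first by rewrite extE// fint1_ext.
rewrite ext_out// /prim Rint_eq0_mu// => s.
by rewrite ext_out// mulr0 if_same.
Qed.

(** Each time has its own exceptional null set in space; [ae_swap] turns this into a bound at almost
    every point of space for almost every time, the order in which the estimates are made. *)
Lemma ae2_bounded_ext psi K : measurable_fun setT (ext T Omega psi) -> 0 <= K ->
  (forall t, t \in `[0, T] -> ae_bounded Omega (psi t) K) ->
  ae2_bounded (ext T Omega psi) K.
Proof.
move=> mpsi K0 bpsi.
apply: (@ae_swap _ _ _ _ R mu m (fun z => `|ext T Omega psi z| <= K)).
  by apply: measurable_fun_ler => //; exact: measurableT_comp.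
apply: aeW => t; have [tT|tT] := boolP (0 < t < T); last first.
  by apply: aeW => x; rewrite ext_supp// normr0.
have tT' : t \in `[0, T] by case/andP: tT => /ltW h1 /ltW h2; rewrite in_itv/= h1.
apply: ae_imp (bpsi t tT') => x bx.
have [Ox|Ox] := pselect (Omega x); first by rewrite extE// bx.
by rewrite ext_out// normr0.
Qed.

End sections.

Section coefficients.
Context {R : realType} {n : nat}.
Variables (T : R) (Omega : set 'rV[R]_n).
Hypotheses (T0 : 0 < T) (mO : measurable Omega).
Implicit Types (psi dpsi : R -> 'rV[R]_n -> R).
Notation mu := (@lebesgue_measure R).
Notation m := (@lebesgue_rV R n).
Notation mm := (mu \x m)%E.

Definition bounded_coefficient psi K :=
  measurable_fun setT (ext T Omega psi) /\ ae2_bounded (ext T Omega psi) K.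

Lemma bounded_coefficient_le psi K L : K <= L ->
  bounded_coefficient psi K -> bounded_coefficient psi L.
Proof.
move=> KL [mpsi bpsi]; split => //; apply: ae_imp bpsi => x.
by apply: ae_imp_mu => t /le_trans; apply.
Qed.

Lemma bounded_coefficientP psi : jointly_measurable `[0, T] Omega psi ->
  (exists K, forall t, t \in `[0, T] -> ae_bounded Omega (psi t) K) ->
  exists2 K, 0 <= K & bounded_coefficient psi K.
Proof.
move=> mpsi [K bK]; exists `|K| => //; have me := measurable_ext_cc mO mpsi.
split => //; apply: ae2_bounded_ext => // t tT.
exact: ae_bounded_le (ler_norm K) (bK t tT).
Qed.

Section any_norm.
Variable N : ('rV[R]_n -> R) -> \bar R.
Hypothesis LooN_le : forall v, (LooN Omega v <= N v)%E.

Lemma C1_bounded psi dpsi : CkS_with_derivative N T Omega 0 psi dpsi ->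
  exists2 K, 0 <= K & bounded_coefficient psi K /\ bounded_coefficient dpsi K.
Proof.
move=> [cpsi tpsi /= [cdpsi cont]].
have [K K0 bK] := bounded_coefficientP cpsi.1 (derivative_uniform_bound LooN_le cpsi cdpsi tpsi).
have [L L0 bL] := bounded_coefficientP cdpsi.1 (continuous_uniform_bound LooN_le cdpsi cont).
exists (K + L); first exact: addr_ge0.
by split; [apply: bounded_coefficient_le bK; rewrite lerDl|apply: bounded_coefficient_le bL; rewrite lerDr].
Qed.

(** Unlike in [C1_bounded], the clause on [dpsi] provides a derivative instead of continuity, hence
    the second use of [derivative_uniform_bound]. *)
Lemma C2_bounded psi dpsi : CkS_with_derivative N T Omega 1 psi dpsi ->
  exists2 K, 0 <= K & bounded_coefficient psi K /\ bounded_coefficient dpsi K.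
Proof.
move=> [cpsi tpsi /= [cdpsi [ddpsi [tdpsi [cddpsi _]]]]].
have [K K0 bK] := bounded_coefficientP cpsi.1 (derivative_uniform_bound LooN_le cpsi cdpsi tpsi).
have [L L0 bL] := bounded_coefficientP cdpsi.1 (derivative_uniform_bound LooN_le cdpsi cddpsi tdpsi).
exists (K + L); first exact: addr_ge0.
by split; [apply: bounded_coefficient_le bK; rewrite lerDl|apply: bounded_coefficient_le bL; rewrite lerDr].
Qed.

End any_norm.

Lemma LooN_le_W1ooN v : (LooN Omega v <= W1ooN Omega v)%E.
Proof.
apply: le_ereal_inf_tmp => _ [dv _ <-]; exact: bigmax_ge_id.
Qed.

Lemma static_coefficient (k : 'rV[R]_n -> R) : inLp +oo%E Omega k ->
  exists2 K, 0 <= K & bounded_coefficient (fun=> k) K.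
Proof.
move=> [mk fk].
have [K bK] : exists K, ae_bounded Omega k K.
  by apply: (@N_lty_bounded _ _ Omega (LooN Omega)).
exists `|K| => //.
have me : measurable_fun setT (ext T Omega (fun=> k)).
  apply: measurable_ext => //.
  have sub : snd @` (`]0, T[%classic `*` Omega : set (R * 'rV[R]_n)) `<=` Omega.
    by move=> _ [[t x] [_ Ox] <-].
  apply: (measurable_comp mO sub mk).
  exact: measurable_funTS measurable_snd.
split => //; apply: ae2_bounded_ext => // t tT.
exact: ae_bounded_le (ler_norm K) bK.
Qed.

Lemma L2_bounded_mul psi K q : bounded_coefficient psi K -> L2 mm q ->
  time_supp T q -> L2 mm (fun z => ext T Omega psi z * q z).
Proof.
move=> [mpsi bpsi] q2 sq.
(* Multiplication by [psi] is [bop2] with zero in the place of the derivative. *)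
have K0 : L2 mm (bop2 T (ext T Omega psi) (cst 0) q).
  apply: (@L2_bop2 _ _ _ T0 _ _ _ `|K|) => //.
  - apply: ae_imp bpsi => x; apply: ae_imp_mu => t /le_trans; apply; exact: ler_norm.
  - by apply: aeW => x; apply: aeW => t /=; rewrite normr0.
rewrite (_ : (fun z => _) = bop2 T (ext T Omega psi) (cst 0) q)//.
apply/funext => -[t x]; rewrite /bop2/=; case: ifPn => tT; last by rewrite ext_supp// mul0r.
by rewrite /bop /prim Rint_eq0_mu ?subr0// => s; rewrite mul0r if_same.
Qed.

Lemma L2_Bop nu psi dpsi phi K : bounded_coefficient psi K ->
  bounded_coefficient dpsi K -> L2 mm (ext T Omega (fint nu phi)) ->
  L2 mm (ext T Omega (Bop nu psi dpsi phi)).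
Proof.
move=> [mpsi bpsi] [mdpsi bdpsi] p2.
rewrite (_ : ext T Omega (Bop _ _ _ _) =
  bop2 T (ext T Omega psi) (ext T Omega dpsi) (ext T Omega (fint nu phi))).
  by apply: (@L2_bop2 _ _ _ T0 _ _ _ K) => //; exact: time_supp_ext.
by apply/funext => z; exact: Bop_ext.
Qed.

End coefficients.

(** * The energy identity *)

(** Young's inequality in the form [b w <= c w^2 + b^2 / (4 c)] uses exactly the ellipticity
    available and leaves [L Z / (4 c)] for each component; the product [bb * v] costs half of
    [bb^2 + v^2], at most [(L + 1) / 2 * Z]. *)
Lemma absorb_lower_order (R : realType) (I : finType) (k w b : I -> R)
    (uv v bb c L Z : R) : 0 < c -> c * \sum_i w i ^+ 2 <= \sum_i k i * w i ->
  (forall i, b i ^+ 2 <= L * Z) -> bb ^+ 2 <= L * Z -> v ^+ 2 <= Z ->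
  uv - (#|I|%:R * L / (4 * c) + (L + 1) / 2) * Z <=
  uv + \sum_i k i * w i - \sum_i b i * w i + bb * v.
Proof.
move=> c0 kw bL bbL vZ.
have h1 : \sum_i b i * w i <= c * \sum_i w i ^+ 2 + #|I|%:R * L / (4 * c) * Z.
  have -> : #|I|%:R * L / (4 * c) * Z = \sum_(i : I) L * Z / (4 * c).
    by rewrite sumr_const -mulr_natl; field; rewrite gt_eqF.
  rewrite mulr_sumr -big_split; apply: ler_sum => i _ /=.
  have h : b i * w i <= c * w i ^+ 2 + b i ^+ 2 / (4 * c).
    have -> : c * w i ^+ 2 + b i ^+ 2 / (4 * c) =
      b i * w i + c * (w i - b i / (2 * c)) ^+ 2 by field; rewrite gt_eqF.
    by rewrite lerDl mulr_ge0 ?sqr_ge0// ltW.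
  apply: le_trans h _; rewrite lerD2l ler_wpM2r// ?bL//.
  by rewrite invr_ge0 mulr_ge0// ltW.
have h2 : - ((L + 1) / 2 * Z) <= bb * v.
  have := sqr_ge0 (bb + v); move: bbL vZ; nra.
by move: h1 h2 kw; set A := \sum_i b i * w i; set B := \sum_i k i * w i;
  set D := c * _; set E := _ / (4 * c) * Z; set H := (L + 1) / 2 * Z;
  rewrite mulrDl -/E -/H; lra.
Qed.

Lemma sum_sqr_le (R : realType) (K T A D p q P Q b1 b2 b3 b4 : R) : 0 <= T ->
  0 <= P -> 0 <= Q -> A ^+ 2 <= 2 * K ^+ 2 * (p ^+ 2 + T * P) ->
  D ^+ 2 <= 2 * K ^+ 2 * (q ^+ 2 + T * Q) -> b1 - b3 = A -> b2 - b4 = D ->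
  (b1 + b2 - (b3 + b4)) ^+ 2 <= 4 * K ^+ 2 * (1 + T) * (p ^+ 2 + q ^+ 2 + P + Q).
Proof.
move=> T0 P0 Q0 AP DQ bA bD.
have -> : b1 + b2 - (b3 + b4) = A + D by rewrite -bA -bD; ring.
(* Four times this quantity is the slack between [4 K^2 (p^2 + q^2 + T (P + Q))] and the right-hand
   side. *)
have h : 0 <= K ^+ 2 * (T * (p ^+ 2 + q ^+ 2) + P + Q).
  apply: mulr_ge0; first exact: sqr_ge0.
  by do 2 apply: addr_ge0 => //; apply: mulr_ge0 => //; apply: addr_ge0; exact: sqr_ge0.
have h2 : (A + D) ^+ 2 <= 2 * A ^+ 2 + 2 * D ^+ 2.
  by have := sqr_ge0 (A - D); lra.
apply: le_trans h2 _; move: AP DQ h; clear.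
by move: (K ^+ 2) (p ^+ 2) (q ^+ 2) (A ^+ 2) (D ^+ 2) => *; lra.
Qed.

Section extension_algebra.
Context {R : realType} {n : nat}.
Variables (T : R) (Omega : set 'rV[R]_n).
Implicit Types (phi psi : R -> 'rV[R]_n -> R).

Lemma ext_add phi psi z : ext T Omega (fun t x => phi t x + psi t x) z =
  ext T Omega phi z + ext T Omega psi z.
Proof. by rewrite /ext; case: ifP => // _; rewrite addr0. Qed.

Lemma ext_sum (I : finType) (h : I -> R -> 'rV[R]_n -> R) z :
  ext T Omega (fun t x => \sum_i h i t x) z = \sum_i ext T Omega (h i) z.
Proof. by rewrite /ext; case: ifP => // _; rewrite big1. Qed.

Lemma ext_mul phi psi z : ext T Omega (fun t x => phi t x * psi t x) z =
  ext T Omega phi z * ext T Omega psi z.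
Proof. by rewrite /ext; case: ifP => // _; rewrite mul0r. Qed.

Lemma Rint_ext phi t : 0 < t < T ->
  \int[lebesgue_rV n]_(x in Omega) phi t x =
  \int[lebesgue_rV n]_x ext T Omega phi (t, x).
Proof.
by move=> tT; rewrite Rint_if; apply: eq_Rint => x; rewrite /ext/= tT.
Qed.

End extension_algebra.

Lemma vBopE (R : realType) n (nu : R) (F dF : R -> 'rV[R]_n -> 'rV[R]_n)
    (phi : R -> 'rV[R]_n -> R) t x j : vBop nu F dF phi t x ord0 j =
  Bop nu (fun s y => F s y ord0 j) (fun s y => dF s y ord0 j) phi t x.
Proof. by rewrite /vBop mxE. Qed.

Section energy_identity.
Context {R : realType} {d : nat}.
Variables (alpha T : R) (Omega : set 'rV[R]_d.+1) (kappa : 'rV[R]_d.+1 -> 'M[R]_d.+1).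
Variables (F dF G dG : R -> 'rV[R]_d.+1 -> 'rV[R]_d.+1).
Variables (a da b db : R -> 'rV[R]_d.+1 -> R).
Variables (K : R).
Hypotheses (T0 : 0 < T) (mO : measurable Omega).
Notation mu := (@lebesgue_measure R).
Notation m := (@lebesgue_rV R d.+1).
Notation mm := (mu \x m)%E.
Notation bcoef psi := (bounded_coefficient T Omega psi K).
Hypotheses (bF : forall j, bcoef (fun t x => F t x ord0 j))
  (bdF : forall j, bcoef (fun t x => dF t x ord0 j))
  (bG : forall j, bcoef (fun t x => G t x ord0 j))
  (bdG : forall j, bcoef (fun t x => dG t x ord0 j))
  (ba : bcoef a) (bda : bcoef da) (bb : bcoef b) (bdb : bcoef db)
  (bk : forall i j, bcoef (fun _ x => kappa x i j)).
(* [u true] and [u false] are the two solutions. *)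
Variables (u : bool -> R -> 'rV[R]_d.+1 -> R)
  (W : bool -> R -> 'rV[R]_d.+1 -> 'rV[R]_d.+1) (f : R -> 'rV[R]_d.+1 -> R).
Hypotheses (hu : forall i, L2L2 T Omega (u i))
  (hw : forall i, L2L2 T Omega (fint alpha (u i)))
  (hW : forall i j, L2L2 T Omega (fun t x => W i t x ord0 j)).

Definition sol i := ext T Omega (u i).
Definition sol_frac i := ext T Omega (fint alpha (u i)).
Definition sol_grad i j := ext T Omega (fun t x => W i t x ord0 j).
Definition sol_flux i j :=
  ext T Omega (fun t x => (W i t x *m (kappa x)^T) ord0 j).
Definition sol_B1 i j :=
  ext T Omega (fun t x => B1 alpha F dF G dG (u i) t x ord0 j).
Definition sol_B2 i := ext T Omega (B2 alpha a da b db (u i)).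

Definition energy_density z :=
  (sol true z - sol false z) * (sol_frac true z - sol_frac false z) +
  \sum_j (sol_flux true j z - sol_flux false j z) *
         (sol_grad true j z - sol_grad false j z) -
  \sum_j (sol_B1 true j z - sol_B1 false j z) *
         (sol_grad true j z - sol_grad false j z) +
  (sol_B2 true z - sol_B2 false z) * (sol_frac true z - sol_frac false z).

Lemma L2_sol i : L2 mm (sol i). Proof. exact: L2_ext. Qed.

Lemma L2_sol_frac i : L2 mm (sol_frac i). Proof. exact: L2_ext. Qed.

Lemma L2_sol_grad i j : L2 mm (sol_grad i j). Proof. exact: L2_ext. Qed.

Lemma L2_sol_flux i j : L2 mm (sol_flux i j).
Proof.
have := L2_sum (fun l => L2_bounded_mul T0 (bk j l) (L2_sol_grad i l)
  (@time_supp_ext _ _ _ _ _)).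
rewrite (_ : (fun z => \sum_l _) = sol_flux i j)//; apply/funext => z.
rewrite /sol_flux /sol_grad (_ : (fun t x => _) =
  (fun t x => \sum_l kappa x j l * W i t x ord0 l)).
  by rewrite ext_sum; apply: eq_bigr => l _; rewrite ext_mul.
apply/funext => t; apply/funext => x; rewrite mxE.
by apply: eq_bigr => l _; rewrite mxE mulrC.
Qed.

Lemma sol_B1E i j z : sol_B1 i j z =
  ext T Omega (Bop alpha (fun t x => F t x ord0 j) (fun t x => dF t x ord0 j) (u i)) z +
  ext T Omega (Bop 1 (fun t x => G t x ord0 j) (fun t x => dG t x ord0 j) (u i)) z.
Proof.
rewrite -ext_add /sol_B1; congr (ext T Omega _ z).
apply/funext => t; apply/funext => x; rewrite /B1 mxE.
by congr (_ + _); exact: vBopE.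
Qed.

Lemma sol_B2E i z : sol_B2 i z =
  ext T Omega (Bop alpha a da (u i)) z + ext T Omega (Bop 1 b db (u i)) z.
Proof. by rewrite -ext_add. Qed.

Lemma L2_sol_B1 i j : L2 mm (sol_B1 i j).
Proof.
have h1 := L2_Bop T0 (bF j) (bdF j) (L2_sol_frac i).
have h2 := L2_Bop T0 (bG j) (bdG j) (L2_fint1 T0 (L2_sol i)).
by rewrite (funext (sol_B1E i j)); exact: L2D h1 h2.
Qed.

Lemma L2_sol_B2 i : L2 mm (sol_B2 i).
Proof.
have h1 := L2_Bop T0 ba bda (L2_sol_frac i).
have h2 := L2_Bop T0 bb bdb (L2_fint1 T0 (L2_sol i)).
by rewrite (funext (sol_B2E i)); exact: L2D h1 h2.
Qed.

Lemma L1_energy_density : L1 mm energy_density.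
Proof.
have s2 := L2B (L2_sol true) (L2_sol false).
have w2 := L2B (L2_sol_frac true) (L2_sol_frac false).
have g2 j := L2B (L2_sol_grad true j) (L2_sol_grad false j).
have i1 := L2M s2 w2.
have i2 := L1_sum (fun j => L2M (L2B (L2_sol_flux true j) (L2_sol_flux false j)) (g2 j)).
have i3 := L1_sum (fun j => L2M (L2B (L2_sol_B1 true j) (L2_sol_B1 false j)) (g2 j)).
have i4 := L2M (L2B (L2_sol_B2 true) (L2_sol_B2 false)) w2.
exact: L1D (L1B (L1D i1 i2) i3) i4.
Qed.

Lemma energy_density_supp t x : ~~ (0 < t < T) -> energy_density (t, x) = 0.
Proof.
move=> tT; have e0 phi : ext T Omega phi (t, x) = 0 by exact: ext_supp.
have w0 : sol_frac true (t, x) - sol_frac false (t, x) = 0.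
  by rewrite /sol_frac !e0 subrr.
have b0 (h : 'I_d.+1 -> R) :
    \sum_j h j * (sol_grad true j (t, x) - sol_grad false j (t, x)) = 0.
  by apply: big1 => j _; rewrite /sol_grad !e0 subrr mulr0.
by rewrite /energy_density w0 !b0 !mulr0 subr0 !addr0.
Qed.

(** The index [i] selects the equation and [k] the solution whose fractional integral is the test
    function. *)
Definition tested i k z := sol i z * sol_frac k z +
  \sum_j sol_flux i j z * sol_grad k j z -
  \sum_j sol_B1 i j z * sol_grad k j z + sol_B2 i z * sol_frac k z.

Lemma sumBM (I : finType) (p1 p2 q1 q2 : I -> R) :
  \sum_j (p1 j - p2 j) * (q1 j - q2 j) =
  \sum_j p1 j * q1 j - \sum_j p2 j * q1 j - \sum_j p1 j * q2 j + \sum_j p2 j * q2 j.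
Proof. by rewrite -!sumrB -big_split; apply: eq_bigr => j _ /=; ring. Qed.

(** Bilinearity expands the form at the difference into the four crosswise tests, each of which uses
    a test function known to be in H^1_0. *)
Lemma energy_densityE z : energy_density z =
  tested true true z - tested false true z - (tested true false z - tested false false z).
Proof.
rewrite /energy_density /tested.
rewrite (sumBM (fun j => sol_flux true j z) (fun j => sol_flux false j z)
  (fun j => sol_grad true j z) (fun j => sol_grad false j z)).
rewrite (sumBM (fun j => sol_B1 true j z) (fun j => sol_B1 false j z)
  (fun j => sol_grad true j z) (fun j => sol_grad false j z)).
have E (s1 s2 w1 w2 p1 p2 a1 a2 a3 a4 b1 b2 b3 b4 : R) :
  (s1 - s2) * (w1 - w2) + (a1 - a2 - a3 + a4) - (b1 - b2 - b3 + b4) +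
  (p1 - p2) * (w1 - w2) = s1 * w1 + a1 - b1 + p1 * w1 - (s2 * w1 + a2 - b2 + p2 * w1) -
  (s1 * w2 + a3 - b3 + p1 * w2 - (s2 * w2 + a4 - b4 + p2 * w2)) by ring.
exact: E.
Qed.

Hypothesis heq : forall i, {ae mu, forall t : R, t \in `]0, T[ -> forall k : bool,
  inner Omega (u i t) (fint alpha (u k) t)
  + vinner Omega (fun x => W i t x *m (kappa x)^T) (W k t)
  - vinner Omega (B1 alpha F dF G dG (u i) t) (W k t)
  + inner Omega (B2 alpha a da b db (u i) t) (fint alpha (u k) t)
  = inner Omega (f t) (fint alpha (u k) t)}.

Lemma inner_ext phi psi t : 0 < t < T -> inner Omega (phi t) (psi t) =
  \int[m]_x (ext T Omega phi (t, x) * ext T Omega psi (t, x)).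
Proof.
move=> tT; rewrite /inner (@Rint_ext _ _ T Omega (fun t x => phi t x * psi t x) t tT).
by apply: eq_Rint => x; rewrite ext_mul.
Qed.

Lemma vinner_ext (p q : R -> 'rV[R]_d.+1 -> 'rV[R]_d.+1) t : 0 < t < T ->
  vinner Omega (p t) (q t) = \int[m]_x \sum_j
    ext T Omega (fun t x => p t x ord0 j) (t, x) *
    ext T Omega (fun t x => q t x ord0 j) (t, x).
Proof.
move=> tT; rewrite /vinner (@Rint_ext _ _ T Omega (fun t x => vdot (p t x) (q t x)) t tT).
apply: eq_Rint => x; rewrite /vdot ext_sum.
by apply: eq_bigr => j _; rewrite ext_mul.
Qed.

Lemma tested_integral i k : {ae mu, forall t : R, 0 < t < T ->
  L1 m (fun x => tested i k (t, x)) /\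
  \int[m]_x tested i k (t, x) = inner Omega (f t) (fint alpha (u k) t)}.
Proof.
have i1 := ae_L1_section (L2M (L2_sol i) (L2_sol_frac k)).
have i2 := ae_L1_section (L1_sum (fun j => L2M (L2_sol_flux i j) (L2_sol_grad k j))).
have i3 := ae_L1_section (L1_sum (fun j => L2M (L2_sol_B1 i j) (L2_sol_grad k j))).
have i4 := ae_L1_section (L2M (L2_sol_B2 i) (L2_sol_frac k)).
apply: ae_imp_mu (ae_and_mu (ae_and_mu i1 i2) (ae_and_mu (ae_and_mu i3 i4) (heq i))).
move=> t [[j1 j2] [[j3 j4] eqt]] tT.
have tT' : t \in `]0, T[ by rewrite in_itv.
split; first exact: L1D (L1B (L1D j1 j2) j3) j4.
rewrite -(eqt tT' k) /tested RintegralD//; last by apply: L1B => //; exact: L1D.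
rewrite RintegralB//; last exact: L1D.
rewrite RintegralD// (inner_ext (u i))// (inner_ext (B2 alpha a da b db (u i)))//.
by rewrite (vinner_ext (fun t x => W i t x *m (kappa x)^T))//
  (vinner_ext (B1 alpha F dF G dG (u i))).
Qed.

(** The right-hand side of a test depends on the test function [k] but not on the equation [i], so
    the four values cancel in pairs. *)
Lemma energy_density_integral : {ae mu, forall t : R,
  \int[m]_x energy_density (t, x) = 0}.
Proof.
apply: ae_imp_mu (ae_and_mu
  (ae_and_mu (tested_integral true true) (tested_integral false true))
  (ae_and_mu (tested_integral true false) (tested_integral false false))).
move=> t [[h1 h2] [h3 h4]]; have [tT|tT] := boolP (0 < t < T); last first.
  rewrite (eq_Rint m (fun x => energy_density_supp x tT)).
  by rewrite Rintegral_cst// mul0r.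
have [[j1 e1] [j2 e2]] := (h1 tT, h2 tT); have [[j3 e3] [j4 e4]] := (h3 tT, h4 tT).
rewrite (eq_Rint m (fun x => energy_densityE (t, x))).
have IB (p q r s : 'rV[R]_d.+1 -> R) A B : L1 m p -> L1 m q -> L1 m r -> L1 m s ->
    \int[m]_x p x = A -> \int[m]_x q x = A -> \int[m]_x r x = B -> \int[m]_x s x = B ->
    \int[m]_x (p x - q x - (r x - s x)) = 0.
  move=> hp hq hr hs pA qA rB sB; rewrite RintegralB//; [|exact: L1B|exact: L1B].
  by rewrite !RintegralB// pA qA rB sB !subrr.
exact: IB j1 j2 j3 j4 e1 e2 e3 e4.
Qed.

Hypothesis alpha01 : 0 < alpha < 1.

Definition sol_diff z := sol true z - sol false z.
Definition frac_diff z := sol_frac true z - sol_frac false z.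
Definition prim_diff x := prim_itv T (Gamma 1)^-1 (fun t => sol_diff (t, x)).

Definition diff_size x t := frac_diff (t, x) ^+ 2 + prim_diff x t ^+ 2 +
  prim (fun s => frac_diff (s, x) ^+ 2) t + prim (fun s => prim_diff x s ^+ 2) t.

Lemma sol_diff_section : {ae m, forall x, L2_itv T (fun t => sol_diff (t, x))}.
Proof.
apply: section_L2_itv; first exact: L2B (L2_sol true) (L2_sol false).
by move=> t x tT; rewrite /sol_diff /sol !ext_supp// subrr.
Qed.

Lemma frac_diff_section : {ae m, forall x, L2_itv T (fun t => frac_diff (t, x))}.
Proof.
apply: section_L2_itv; first exact: L2B (L2_sol_frac true) (L2_sol_frac false).
by move=> t x tT; rewrite /frac_diff /sol_frac !ext_supp// subrr.
Qed.

(** The fractional integral is linear only at times where both integrals converge; by [ae_wr_L1] and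
    [wfrac_wr] these are almost all times. *)
Lemma frac_diffE : {ae m, forall x, {ae mu, forall t : R, 0 < t < T ->
  frac_diff (t, x) = (Gamma alpha)^-1 * wfrac alpha (fun s => sol_diff (s, x)) t}}.
Proof.
have sx i := section_L2_itv (L2_sol i) (@time_supp_ext _ _ T Omega (u i)).
apply: ae_imp (ae_and (sx true) (sx false)) => x [s1 s2].
have [Ox|Ox] := pselect (Omega x); last first.
  apply: aeW => t tT; rewrite /frac_diff /sol_frac !ext_out// subrr.
  rewrite /wfrac Rint_eq0_mu ?mulr0// => s.
  by rewrite /sol_diff /sol !ext_out// subrr mulr0.
(* The weight parameter is taken to be 1: the integrability obtained does not involve it. *)
apply: ae_imp_mu (ae_and_mu (ae_wr_L1 T0 ltr01 alpha01 s1) (ae_wr_L1 T0 ltr01 alpha01 s2)).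
move=> t [h1 h2] tT.
have [i1 _ _] := wfrac_wr alpha01 s1 (h1 tT).
have [i2 _ _] := wfrac_wr alpha01 s2 (h2 tT).
have E (p q r : R -> R) (k : R) : L1 mu p -> L1 mu q -> (forall s, p s - q s = r s) ->
    \int[mu]_s (k * p s) - \int[mu]_s (k * q s) = k * \int[mu]_s r s.
  by move=> ip iq pqr; rewrite !RintegralZl// -mulrBr -RintegralB// (eq_Rint_mu pqr).
rewrite /frac_diff /sol_frac !extE// (fint_ext _ (u true) tT Ox) (fint_ext _ (u false) tT Ox).
by apply: E => // s; rewrite -mulrBr.
Qed.

Lemma prim_diffE x t : (forall i, L1 mu (fun s => sol i (s, x))) ->
  ext T Omega (fint 1 (u true)) (t, x) - ext T Omega (fint 1 (u false)) (t, x) =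
  prim_diff x t.
Proof.
move=> si; rewrite /prim_diff /prim_itv; case: ifPn => tT; last first.
  by rewrite !ext_supp// subrr.
have [Ox|Ox] := pselect (Omega x); last first.
  rewrite !ext_out// subrr /prim Rint_eq0_mu ?mulr0// => s.
  by rewrite /sol_diff /sol !ext_out// subrr if_same.
have E (p q r : R -> R) (k : R) : L1 mu p -> L1 mu q -> (forall s, p s - q s = r s) ->
    prim (fun s => k * p s) t - prim (fun s => k * q s) t = k * prim r t.
  move=> ip iq pqr; rewrite /prim.
  have pull (h : R -> R) : L1 mu h -> \int[mu]_s (if s < t then k * h s else 0) =
      k * \int[mu]_s (if s < t then h s else 0).
    move=> ih; rewrite -RintegralZl//; last exact: L1_iflt.
    by apply: eq_Rint_mu => s; case: ifP; rewrite ?mulr0.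
  rewrite !pull// -mulrBr -RintegralB//; [|exact: L1_iflt|exact: L1_iflt].
  by congr (_ * _); apply: eq_Rint_mu => s; case: ifP; rewrite ?subrr.
rewrite !extE// (fint1_ext (u true) tT Ox) (fint1_ext (u false) tT Ox).
exact: E (si true) (si false) _.
Qed.

(** A component of [B1] and the operator [B2] have the same shape, a term of order [alpha] plus one
    of order 1, and are estimated together; the first term sees the difference of the [w], the
    second that of the primitives. *)
Lemma lower_order_sqr_le psi dpsi chi dchi :
  bcoef psi -> bcoef dpsi -> bcoef chi -> bcoef dchi ->
  let B i z := ext T Omega (Bop alpha psi dpsi (u i)) z +
               ext T Omega (Bop 1 chi dchi (u i)) z in
  {ae m, forall x, {ae mu, forall t : R, 0 < t < T ->
    (B true (t, x) - B false (t, x)) ^+ 2 <= 4 * K ^+ 2 * (1 + T) * diff_size x t}}.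
Proof.
move=> [mp bp] [mdp bdp] [mc bc] [mdc bdc] B.
have sx i := section_L2_itv (L2_sol i) (@time_supp_ext _ _ T Omega (u i)).
have wx i := section_L2_itv (L2_sol_frac i) (@time_supp_ext _ _ T Omega (fint alpha (u i))).
have vx i := section_L2_itv (L2_fint1 T0 (L2_sol i)) (@time_supp_ext _ _ T Omega (fint 1 (u i))).
apply: ae_imp (ae_and (ae_and (ae_and bp bdp) (ae_and bc bdc))
  (ae_and (ae_forall sx) (ae_and (ae_and (ae_forall wx) (ae_forall vx))
   (ae_and frac_diff_section sol_diff_section)))).
move=> x [[[bpx bdpx] [bcx bdcx]] [s1 [[w1 v1] [wd sd]]]].
apply: ae_imp_mu (ae_and_mu bpx bcx) => t [bpt bct] tT.
have mdpx : measurable_fun setT (fun t => ext T Omega dpsi (t, x)) by exact: measurable_section2.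
have mdcx : measurable_fun setT (fun t => ext T Omega dchi (t, x)) by exact: measurable_section2.
have iw i := L2_itv_integrable (w1 i); have iv i := L2_itv_integrable (v1 i).
have vE : (fun s => ext T Omega (fint 1 (u true)) (s, x) -
    ext T Omega (fint 1 (u false)) (s, x)) = prim_diff x.
  by apply/funext => s; apply: prim_diffE => i; exact: L2_itv_integrable (s1 i).
have pd2 : L2_itv T (prim_diff x) by exact: L2_prim_itv.
have hA := bop_sqr_le (psi := fun t => ext T Omega psi (t, x)) tT mdpx bdpx bpt wd.
have hB := bop_sqr_le (psi := fun t => ext T Omega chi (t, x)) tT mdcx bdcx bct pd2.
have eA := bopB (fun t => ext T Omega psi (t, x)) t mdpx bdpx (iw true) (iw false).
have eB := bopB (fun t => ext T Omega chi (t, x)) t mdcx bdcx (iv true) (iv false).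
rewrite vE in eB.
have BE nu p dp phi : ext T Omega (Bop nu p dp phi) (t, x) =
    bop (fun t => ext T Omega p (t, x)) (fun t => ext T Omega dp (t, x))
      (fun t => ext T Omega (fint nu phi) (t, x)) t.
  by rewrite Bop_ext /bop2/= tT.
have pge0 (q : R -> R) : 0 <= prim (fun s => q s ^+ 2) t.
  by apply: Rint_ge0 => s; case: ifP => // _; exact: sqr_ge0.
have := sum_sqr_le (ltW T0) (pge0 (fun s => frac_diff (s, x))) (pge0 (prim_diff x)) hA hB.
rewrite /diff_size; apply.
  exact: etrans (congr2 _ (BE alpha psi dpsi (u true)) (congr1 _ (BE alpha psi dpsi (u false)))) eA.
exact: etrans (congr2 _ (BE 1 chi dchi (u true)) (congr1 _ (BE 1 chi dchi (u false)))) eB.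
Qed.

Variable c : R.
Hypotheses (c0 : 0 < c)
  (kc : forall x, Omega x -> forall y, c * vdot y y <= vdot (y *m (kappa x)^T) y).

Lemma flux_coercive t x :
  c * \sum_j (sol_grad true j (t, x) - sol_grad false j (t, x)) ^+ 2 <=
  \sum_j (sol_flux true j (t, x) - sol_flux false j (t, x)) *
    (sol_grad true j (t, x) - sol_grad false j (t, x)).
Proof.
have z0 : (forall phi, ext T Omega phi (t, x) = 0) ->
    c * \sum_j (sol_grad true j (t, x) - sol_grad false j (t, x)) ^+ 2 <=
    \sum_j (sol_flux true j (t, x) - sol_flux false j (t, x)) *
      (sol_grad true j (t, x) - sol_grad false j (t, x)).
  move=> e0; rewrite !big1 ?mulr0// => j _; rewrite /sol_grad !e0 subrr ?mulr0//.
  by rewrite expr0n.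
have [tT|tT] := boolP (0 < t < T); last by apply: z0 => phi; exact: ext_supp.
have [Ox|Ox] := pselect (Omega x); last by apply: z0 => phi; exact: ext_out.
have := kc Ox (W true t x - W false t x); rewrite mulmxBl /vdot.
congr (c * _ <= _); apply: eq_bigr => j _.
  by rewrite /sol_grad !extE// !mxE expr2.
rewrite /sol_grad /sol_flux !extE//; congr (_ * _).
  by rewrite [LHS]mxE; congr (_ + _); rewrite [LHS]mxE.
by rewrite !mxE.
Qed.

(** The constant of [lower_order_sqr_le]; [C] below is that of [absorb_lower_order]. Neither depends
    on the point of space, so neither does the [lambda] derived from them. *)
Let L := 4 * K ^+ 2 * (1 + T).
Let C := #|'I_d.+1|%:R * L / (4 * c) + (L + 1) / 2.

Lemma energy_density_ge : {ae m, forall x, {ae mu, forall t : R, 0 < t < T ->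
  sol_diff (t, x) * frac_diff (t, x) - C * diff_size x t <= energy_density (t, x)}}.
Proof.
have hB1 := ae_forall (fun j => lower_order_sqr_le (bF j) (bdF j) (bG j) (bdG j)).
apply: ae_imp (ae_and hB1 (lower_order_sqr_le ba bda bb bdb)) => x [h1 h2].
apply: ae_imp_mu (ae_and_mu (ae_forall h1) h2) => t [b1 b2] tT.
apply: absorb_lower_order => //.
- exact: flux_coercive.
- by move=> j; rewrite !sol_B1E; exact: b1.
- by rewrite !sol_B2E; exact: b2.
- have pge0 (q : R -> R) : 0 <= prim (fun s => q s ^+ 2) t.
    by apply: Rint_ge0 => s; case: ifP => // _; exact: sqr_ge0.
  rewrite /diff_size -!addrA lerDl addr_ge0 ?sqr_ge0// addr_ge0//.
Qed.

Lemma solutions_ae_eq : {ae mu, forall t : R, {ae m, forall x,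
  sol true (t, x) = sol false (t, x)}}.
Proof.
have L0 : 0 <= L.
  apply: mulr_ge0; first by apply: mulr_ge0 => //; exact: sqr_ge0.
  by rewrite addr_ge0// ltW.
have C0 : 0 <= C.
  apply: addr_ge0; last by rewrite divr_ge0// addr_ge0.
  by apply: divr_ge0; apply: mulr_ge0 => //; exact: ltW.
have [lambda l0 key] := energy_bound T0 alpha01 C0.
pose P z : R := if 0 < z.1 < T then expw lambda z.1 * energy_density z else 0.
have iE := L1_energy_density.
have iP : L1 mm P.
  apply: L1_le (L1_norm iE) _.
    apply: measurable_fun_ifT => //.
      exact: (measurableT_comp (measurable_itvoo 0 T) measurable_fst).
    apply: measurable_funM; last exact: L1_measurable iE.
    exact: (measurableT_comp (measurable_expw lambda) measurable_fst).
  move=> -[t x]; rewrite /P/=; case: ifPn => [/andP[t0 _]|_]; last by rewrite normr0.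
  rewrite normrM ger0_norm ?(ltW (expw_gt0 _ _))// ler_piMl//.
  by rewrite /expw -[leRHS]expR0 ler_expR oppr_le0 !mulr_ge0// ltW.
pose N x := \int[mu]_t P (t, x).
have iN : L1 m N := L1_Rint1 iP.
have sN : {ae m, forall x, 0 <= N x /\ (N x <= 0 ->
    {ae mu, forall t : R, sol_diff (t, x) = 0})}.
  apply: ae_imp (ae_and (ae_and sol_diff_section frac_diff_section)
    (ae_and frac_diffE (ae_and energy_density_ge (ae_L1_section2 iP)))).
  move=> x [[s2 w2] [wE [Ege iPx]]].
  exact: (key _ _ (fun t => energy_density (t, x)) s2 w2 wE iPx Ege).
(* In the other order of integration the weight, which depends on time only, leaves the inner
   integral, and this vanishes at almost every time. *)
have IN : \int[m]_x N x = 0.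
  rewrite -(Rint_swap iP) -(@ae_Rint_mu _ (cst 0)).
  - by rewrite Rintegral_cst// mul0r.
  - exact: integrable0.
  - exact: measurable_Rint2 (L1_measurable iP).
  apply: ae_imp_mu (ae_and_mu energy_density_integral (ae_L1_section iE)) => t [Et iEt].
  rewrite /P/=; case: (0 < t < T); last by rewrite Rintegral_cst// mul0r.
  by rewrite RintegralZl// Et mulr0.
have N0 : {ae m, forall x, N x = 0}.
  (* [Rint0_ae0] asks for nonnegativity everywhere, while [N] is nonnegative only almost
     everywhere. *)
  pose M x := Num.max (N x) 0.
  have NM : {ae m, forall x, N x = M x}.
    by apply: ae_imp sN => x [Nx _]; rewrite /M max_l.
  have mM : measurable_fun setT M.
    by apply: measurable_maxr => //; exact: L1_measurable iN.
  have M0 : {ae m, forall x, M x = 0}.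
    apply: Rint0_ae0; first exact: ae_L1 mM NM iN.
      by move=> x; rewrite /M le_max lexx orbT.
    by rewrite -(ae_Rint iN mM NM) IN.
  by apply: ae_imp (ae_and NM M0) => x [-> ->].
have ms i : measurable_fun setT (sol i) := L2_measurable (L2_sol i).
(* Equality is known at almost every point of space for almost every time; with the variables in
   this order [ae_swap] exchanges the two. *)
pose e z := sol true (z.2, z.1) == sol false (z.2, z.1).
have me : measurable_fun setT e.
  have msw i : measurable_fun setT (fun z : 'rV[R]_d.+1 * R => sol i (z.2, z.1)).
    by apply: measurableT_comp (ms i) _; exact: measurable_swap.
  exact: measurable_fun_eqr.
have ae : {ae m, forall x, {ae mu, forall t : R, e (x, t)}}.
  apply: ae_imp (ae_and sN N0) => x [[_ h] Nx].
  have {}h : {ae mu, forall t : R, sol_diff (t, x) = 0} by apply: h; rewrite Nx.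
  by apply: ae_imp_mu h => t /eqP; rewrite subr_eq0.
apply: ae_imp_mu (@ae_swap _ _ _ _ R m mu e me ae) => t.
by apply: ae_imp => x /eqP.
Qed.

End energy_identity.

Lemma choice2 (A B : Type) (P Q : A -> B -> Prop) :
  (forall x, exists2 y, P x y & Q x y) ->
  exists2 f, forall x, P x (f x) & forall x, Q x (f x).
Proof.
move=> PQ; have PQ' x : exists y, P x y /\ Q x y.
  by have [y Py Qy] := PQ x; exists y.
by have [f fPQ] := choice PQ'; exists f => x; have [] := fPQ x.
Qed.

Theorem theorem4p2 (R : realType) (d : nat) (alpha T : R)
    (Omega : set 'rV[R]_d.+1) (kappa : 'rV[R]_d.+1 -> 'M[R]_d.+1)
    (F dF G dG : R -> 'rV[R]_d.+1 -> 'rV[R]_d.+1)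
    (a da b db : R -> 'rV[R]_d.+1 -> R)
    (g : R -> 'rV[R]_d.+1 -> R) (M eta : R) (u0 : 'rV[R]_d.+1 -> R)
    (alpha01 : 0 < alpha < 1) (T_gt0 : 0 < T)
    (domOmega : bounded_lipschitz_domain Omega)
    (kappa_sym : forall x, Omega x -> (kappa x)^T = kappa x)
    (kappa_pos : forall x, Omega x ->
       forall xi : 'rV[R]_d.+1, xi != 0 -> 0 < vdot (xi *m (kappa x)^T) xi)
    (kappa_min : exists2 c : R, 0 < c & forall x, Omega x ->
       forall lambda : R, eigenvalue (kappa x) lambda -> c <= lambda)
    (kappa_Loo : forall i j, inLp +oo%E Omega (fun x => kappa x i j))
    (F_C2 : forall j, CkS_with_derivative (W1ooN Omega) T Omega 1
       (fun t x => F t x ord0 j) (fun t x => dF t x ord0 j))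
    (G_C2 : forall j, CkS_with_derivative (W1ooN Omega) T Omega 1
       (fun t x => G t x ord0 j) (fun t x => dG t x ord0 j))
    (a_C1 : CkS_with_derivative (LooN Omega) T Omega 0 a da)
    (b_C1 : CkS_with_derivative (LooN Omega) T Omega 0 b db)
    (M_gt0 : 0 < M) (eta_gt0 : 0 < eta)
    (g_meas : jointly_measurable `]0, T] Omega g)
    (g_bound : forall t, 0 < t <= T ->
       (LpN 2%:E Omega (g t) <= (M * t `^ (eta - 1))%:E)%E)
    (u0_L2 : inLp 2%:E Omega u0) :
  let f := fun t x =>
    u0 x + \int[lebesgue_measure]_(s in `]0, t[) g s x in
  forall u1 u2 : R -> 'rV[R]_d.+1 -> R,
    weak_solution T alpha Omega kappa F dF G dG a da b db f u1 ->
    weak_solution T alpha Omega kappa F dF G dG a da b db f u2 ->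
    \forall t \ae lebesgue_measure, t \in `]0, T[ ->
      ae_eq (lebesgue_rV d.+1) Omega (u1 t) (u2 t).
Proof.
move=> f u1 u2 [U1 H1 [W1 [L1W h1 e1]]] [U2 H2 [W2 [L2W h2 e2]]].
have mO : measurable Omega by case: domOmega => oO _ _ _ _; exact: measurable_open_rV.
have [c c0 kmin] := kappa_min.
have [KF KF0 bF] := choice2 (fun j => C2_bounded mO (@LooN_le_W1ooN _ _ Omega) (F_C2 j)).
have [KG KG0 bG] := choice2 (fun j => C2_bounded mO (@LooN_le_W1ooN _ _ Omega) (G_C2 j)).
have [Kk Kk0 bk] := choice2 (fun ij : 'I_d.+1 * 'I_d.+1 =>
  static_coefficient T mO (kappa_Loo ij.1 ij.2)).
have [Ka Ka0 ba] := C1_bounded mO (fun=> lexx _) a_C1.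
have [Kb Kb0 bb] := C1_bounded mO (fun=> lexx _) b_C1.
(* One bound for all coefficients: the sum of the individual ones, which are nonnegative. *)
pose K := \sum_j KF j + \sum_j KG j + \sum_ij Kk ij + Ka + Kb.
have sum_le (I : finType) (k : I -> R) i : (forall i, 0 <= k i) -> k i <= \sum_i k i.
  by move=> k0; rewrite (bigD1 i)//= lerDl sumr_ge0.
have sF : 0 <= \sum_j KF j by exact: sumr_ge0.
have sG : 0 <= \sum_j KG j by exact: sumr_ge0.
have sk : 0 <= \sum_ij Kk ij by exact: sumr_ge0.
have FK j : KF j <= K.
  by have := sum_le _ KF j KF0; rewrite /K; move: sG sk Ka0 Kb0; lra.
have GK j : KG j <= K.
  by have := sum_le _ KG j KG0; rewrite /K; move: sF sk Ka0 Kb0; lra.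
have kK i j : Kk (i, j) <= K.
  by have := sum_le _ Kk (i, j) Kk0; rewrite /K; move: sF sG Ka0 Kb0; lra.
have aK : Ka <= K by rewrite /K; move: sF sG sk Kb0; lra.
have bK : Kb <= K by rewrite /K; move: sF sG sk Ka0; lra.
pose u (i : bool) := if i then u1 else u2.
pose W (i : bool) := if i then W1 else W2.
have heq (i : bool) : {ae (@lebesgue_measure R), forall t : R, t \in `]0, T[ -> forall k : bool,
  inner Omega (u i t) (fint alpha (u k) t)
  + vinner Omega (fun x => W i t x *m (kappa x)^T) (W k t)
  - vinner Omega (B1 alpha F dF G dG (u i) t) (W k t)
  + inner Omega (B2 alpha a da b db (u i) t) (fint alpha (u k) t)
  = inner Omega (f t) (fint alpha (u k) t)}.
  have e : \forall t \ae lebesgue_measure, t \in `]0, T[ ->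
      forall v dv, in_H10 Omega v dv -> inner Omega (u i t) v
      + vinner Omega (fun x => W i t x *m (kappa x)^T) dv
      - vinner Omega (B1 alpha F dF G dG (u i) t) dv
      + inner Omega (B2 alpha a da b db (u i) t) v = inner Omega (f t) v.
    by case: i; [exact: e1|exact: e2].
  apply: ae_imp_mu (ae_and_mu e (ae_and_mu h1 h2)) => t [et [ht1 ht2]] tT k.
  by apply: et => //; case: k; [exact: ht1|exact: ht2].
have kc x : Omega x -> forall y, c * vdot y y <= vdot (y *m (kappa x)^T) y.
  (* Symmetry removes the transposition, and the lower bound on the eigenvalues becomes uniform
     ellipticity. *)
  by move=> Ox; rewrite kappa_sym//; apply: rayleigh_min; [exact: kappa_sym|exact: kmin].
have main := @solutions_ae_eq R d alpha T Omega kappa F dF G dG a da b db K T_gt0 mO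
  (fun j => bounded_coefficient_le (FK j) (bF j).1)
  (fun j => bounded_coefficient_le (FK j) (bF j).2)
  (fun j => bounded_coefficient_le (GK j) (bG j).1)
  (fun j => bounded_coefficient_le (GK j) (bG j).2)
  (bounded_coefficient_le aK ba.1) (bounded_coefficient_le aK ba.2)
  (bounded_coefficient_le bK bb.1) (bounded_coefficient_le bK bb.2)
  (fun i j => bounded_coefficient_le (kK i j) (bk (i, j))) u W f.
have hu i : L2L2 T Omega (u i) by case: i; [exact: U1|exact: U2].
have hw i : L2L2 T Omega (fint alpha (u i)) by case: i; [exact: H1|exact: H2].
have hW i j : L2L2 T Omega (fun t x => W i t x ord0 j).
  by case: i; [exact: L1W|exact: L2W].
have ueq := main hu hw hW heq alpha01 c c0 kc.
apply: ae_imp_mu ueq => t ut tT.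
have {}tT : 0 < t < T by move: tT; rewrite in_itv.
by apply: ae_imp ut => x; rewrite /sol => + Ox; rewrite !extE.
Qed.
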